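(* Let $\mathbf{u}=\mathbf{u}_n,\mathbf{v}=\mathbf{v}_n\in\mathbb{S}^{n-1}$ be deterministic sequences and $\mathcal{G}=\mathcal{G}_n\sim\mathsf{GOTE}(4,n)$, all defined on a common probability space. If $\|\mathbf{u}-\mathbf{v}\|_2=o(1)$ as $n\to\infty$, then, almost surely, $\mu_{n^{-1/2}\mathcal{G}\cdot\mathbf{u}\otimes\mathbf{v}}$ converges weakly to $\nu_{\mathsf{sc},\frac13}$.
   Context: $\mathcal{G}\sim\mathsf{GOTE}(4,n)$ means that $\mathcal{G}=(\mathcal{G}_{i_1i_2i_3i_4})$ is a random symmetric tensor of order $4$ and dimension $n$ (invariant under permutations of indices in $[n]$) with density proportional to $\exp\big(-\frac18\|\mathcal{G}\|_F^2\big)$, $\|\mathcal{G}\|_F^2=\sum_{i_1,\dots,i_4\in[n]}\mathcal{G}_{i_1i_2i_3i_4}^2$, with respect to Lebesgue measure on the space of symmetric tensors. Equivalently, entries indexed by distinct multisets are independent and $\mathcal{G}_{i_1i_2i_3i_4}\sim\mathcal{N}(0,4/\#\mathrm{Perm}(i_1,\dots,i_4))$, where $\#\mathrm{Perm}$ is the number of distinct rearrangements. $\mathbb{S}^{n-1}$ is the unit sphere of $\mathbb{R}^n$. $\mathcal{G}\cdot\mathbf{u}\otimes\mathbf{v}$ is the $n\times n$ symmetric matrix with $(i,j)$ entry $\sum_{k,l}\mathcal{G}_{ijkl}u_kv_l$. For a symmetric $n\times n$ matrix $A$ with eigenvalues $\lambda_i$, $\mu_A=\frac1n\sum_{i=1}^n\delta_{\lambda_i}$.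 $\nu_{\mathsf{sc},\sigma^2}$ is the semicircle law with density $\frac{1}{2\pi\sigma^2}\sqrt{4\sigma^2-x^2}$ on $[-2\sigma,2\sigma]$. *)

(* Defs.v *)
From HB Require Import structures.
From mathcomp Require Import all_boot all_order all_algebra.
From mathcomp Require Import all_classical all_reals all_analysis.
From mathcomp Require Import measurable_realfun.
From mathcomp Require polyrcf.

Set Implicit Arguments.
Unset Strict Implicit.
Unset Printing Implicit Defensive.

Import Order.TTheory GRing.Theory Num.Theory.
Import numFieldNormedType.Exports.

Local Open Scope classical_set_scope.
Local Open Scope ring_scope.

(* The library norm on ['cV[R]_n] is the sup norm, hence this definition. *)
Definition norm2 (R : realType) (n : nat) (x : 'cV[R]_n) : R :=
  Num.sqrt (\sum_(i < n) x i ord0 ^+ 2).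

Definition sphere2 (R : realType) (n : nat) : set 'cV[R]_n :=
  [set x | norm2 x = 1].

(* The order-4 contraction G . (u (x) v), a tensor being given by its entries. *)
Definition contract2 (R : realType) (n : nat)
    (A : 4.-tuple 'I_n -> R) (u v : 'cV[R]_n) : 'M[R]_n :=
  \matrix_(i < n, j < n)
    \sum_(k < n) \sum_(l < n) A [tuple i; j; k; l] * u k ord0 * v l ord0.

(* [permutations s] is the duplicate-free list of rearrangements of [s]. *)
Definition nperm (n : nat) (s : 4.-tuple 'I_n) : nat :=
  size (permutations s).

(* GOTE(4, n), by its entries: up to symmetry, independent centred Gaussians
   ([normal_prob] takes the standard deviation).  Distinct multisets of indices
   are given by pairwise non-[perm_eq] tuples; the product rule is required for
   every finite family of such tuples. *)
Definition GOTE4 d (T : measurableType d) (R : realType) (P : probability T R)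
    (n : nat) (G : 4.-tuple 'I_n -> {RV P >-> R}) : Prop :=
  [/\ forall s t : 4.-tuple 'I_n, perm_eq s t -> forall w, G s w = G t w,
      forall s (B : set (measurableTypeR R)), measurable B ->
        distribution P (G s) B =
        normal_prob 0 (Num.sqrt (4 / (nperm s)%:R)) B
    & forall (S : seq (4.-tuple 'I_n))
        (B : 4.-tuple 'I_n -> set (measurableTypeR R)),
        pairwise (fun s t : 4.-tuple 'I_n => ~~ perm_eq s t) S ->
        (forall s, measurable (B s)) ->
        P (\big[setI/setT]_(s <- S) (G s @^-1` B s)) =
        (\prod_(s <- S) P (G s @^-1` B s))%E].

(* Real eigenvalues listed with (algebraic) multiplicity; for a symmetric
   matrix there are n of them. *)
Definition eigenvalues (R : realType) (n : nat) (A : 'M[R]_n) : seq R :=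
  flatten [seq nseq (mup x (char_poly A)) x | x <- polyrcf.rootsR (char_poly A)].

Definition esd (R : realType) (n : nat) (A : 'M[R]_n) :
    {measure set (measurableTypeR R) -> \bar R} :=
  mscale (n%:R^-1 : R)%:nng
    (msum (fun k => \d_((eigenvalues A)`_k : measurableTypeR R))
       (size (eigenvalues A))).

Section semicircle.
Variables (R : realType) (s2 : R).

Definition semicircle_pdf (x : R) : R :=
  if - (2 * Num.sqrt s2) <= x <= 2 * Num.sqrt s2
  then (2 * pi * s2)^-1 * Num.sqrt (4 * s2 - x ^+ 2) else 0.

Lemma semicircle_pdf_ge0 x : 0 <= semicircle_pdf x.
Proof.
rewrite /semicircle_pdf; case: ifP => // _.
have [s20|s20] := leP 0 s2.
  by rewrite mulr_ge0 ?sqrtr_ge0// invr_ge0 !mulr_ge0// pi_ge0.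
rewrite ler0_sqrtr ?mulr0// subr_le0 (le_trans _ (sqr_ge0 x))//.
by rewrite mulr_ge0_le0// ltW.
Qed.

Lemma measurable_semicircle_pdf : measurable_fun [set: R] semicircle_pdf.
Proof.
rewrite /semicircle_pdf; apply: measurable_fun_if => //=.
  by apply: measurable_and => //; exact: measurable_fun_ler.
apply: measurable_funTS; apply: measurable_funM => //.
apply: measurableT_comp => //; last by apply: measurable_funB.
by apply: continuous_measurable_fun; exact: sqrt_continuous.
Qed.

(* The semicircle law of variance s2. *)
Definition semicircle_law : set (measurableTypeR R) -> \bar R :=
  fun A => (\int[lebesgue_measure]_(x in A) (semicircle_pdf x)%:E)%E.

Let semicircle0 : semicircle_law set0 = 0%E.
Proof. by rewrite /semicircle_law integral_set0. Qed.

Let semicircle_ge0 A : (0 <= semicircle_law A)%E.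
Proof. by apply: integral_ge0 => x _; rewrite lee_fin semicircle_pdf_ge0. Qed.

Let semicircle_sigma_additive : semi_sigma_additive semicircle_law.
Proof.
move=> /= F mF tF mUF; rewrite /semicircle_law; apply: cvg_toP.
  apply: ereal_nondecreasing_is_cvgn => m n mn.
  apply: lee_sum_nneg_natr => // k _ _; exact: semicircle_ge0.
rewrite ge0_integral_bigcup//=.
- apply: measurable_funTS; apply: measurableT_comp => //.
  exact: measurable_semicircle_pdf.
- by move=> x _; rewrite lee_fin semicircle_pdf_ge0.
Qed.

HB.instance Definition _ := isMeasure.Build _ _ _ semicircle_law
  semicircle0 semicircle_ge0 semicircle_sigma_additive.

End semicircle.

Definition weak_cvg (R : realType)
    (mu : nat -> {measure set (measurableTypeR R) -> \bar R})
    (nu : {measure set (measurableTypeR R) -> \bar R}) : Prop :=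
  forall f : R -> R, continuous f -> [bounded f x | x in [set: R]] ->
    \int[mu n]_x f x @[n --> \oo] --> \int[nu]_x f x.

(* Main.v *)
Require Import Defs.
From mathcomp Require Import all_boot all_order all_algebra.
From mathcomp Require Import all_classical all_reals all_analysis.
From mathcomp Require Import measurable_realfun.
From mathcomp Require polyrcf complex.
From mathcomp Require Import ring lra zify.
Import Order.TTheory GRing.Theory Num.Theory.
Import numFieldNormedType.Exports.
Local Open Scope classical_set_scope.
Local Open Scope ring_scope.

Set Implicit Arguments.
Unset Strict Implicit.
Unset Printing Implicit Defensive.

(** The proof is by moments.  Write M = n^(-1/2) G . (u (x) v) and
    t_k = n^-1 tr M^k, the k-th moment of the spectral distribution of M.

    The entries of M are centred, jointly Gaussian, and the covariance of the
    entries (i,j) and (a,b) is K(i,j;a,b) / (6 n), where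
      K = (1 + <u,v>^2) (d_ia d_jb + d_ib d_ja) + K',
    d being the Kronecker delta and K' a sum of products with at most one delta
    and otherwise coordinates of u and v ([cov_match24], [match24_contract]).
    Up to K', this is the covariance of a Gaussian orthogonal matrix, whose
    spectrum is asymptotically semicircular of variance s = (1 + <u,v>^2) / 6.
    As <u,v> = 1 - |u - v|^2 / 2 tends to 1, s tends to 1/3.

    Gaussian integration by parts holds for polynomials in the entries of M
    ([stein], [gote_model]).  Applied to tr (M M^k) it yields the
    Schwinger-Dyson equation [schwinger_dyson]
      E Y^(m+1) = E ((A_k - c) Y^m + m (k+1) q_k Y^(m-1)),  Y = t_(k+1) - c,
    where A_k contracts K with M^p and M^q over all p + q = k - 1, and q_k is
    of order n^-2.  In A_k the term d_ib d_ja produces the products t_p t_q;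
    the other terms of K are smaller by a factor n^(-1/2) ([sd_drift_le]).  So
      A_k = s (sum of t_p t_q over p + q = k - 1) + O(n^(-1/2)),
    and the moments m_k of the semicircle law of variance s satisfy the same
    recursion m_(k+1) = s (sum of m_p m_q) exactly ([scmom_rec]).  With
    c = m_(k+1), Young's inequality and induction on k give
      E (t_k - m_k)^(2m) = O(n^-m)  uniformly in u and v
    ([deviation_moments]).

    For m = 2 this is summable in n, hence t_k - m_k tends to 0 almost surely,
    for all k at once ([ae_cvg0]).  Since the limit law has compact support,
    convergence of the moments implies weak convergence ([moments_weak_cvg],
    by polynomial approximation, [weierstrass]). *)

(** * Spectrum of a real symmetric matrix *)

Section spectrum.
Import complex.

Lemma char_poly_diag (F : comNzRingType) n (D : 'rV[F]_n) :
  char_poly (diag_mx D) = \prod_(i < n) ('X - (D ord0 i)%:P).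
Proof.
rewrite char_poly_trig ?diag_mx_is_trig//.
by apply: eq_bigr => i _; rewrite mxE eqxx mulr1n.
Qed.

Lemma char_poly_conj (F : fieldType) n (P A : 'M[F]_n) : P \in unitmx ->
  char_poly (invmx P *m A *m P) = char_poly A.
Proof.
move=> Pu; rewrite /char_poly.
have -> : char_poly_mx (invmx P *m A *m P) =
    map_mx polyC (invmx P) *m char_poly_mx A *m map_mx polyC P.
  rewrite /char_poly_mx mulmxBr mulmxBl -!map_mxM; congr (_ - _).
  by rewrite scalar_mxC -mulmxA -map_mxM mulVmx// map_mx1 mulmx1.
rewrite !det_mulmx mulrAC -det_mulmx -map_mxM mulVmx//.
by rewrite map_mx1 det1 mul1r.
Qed.

Lemma diag_mx_exp (F : comNzRingType) n (D : 'rV[F]_n) k :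
  diag_mx D ^+ k = diag_mx (\row_j D ord0 j ^+ k).
Proof.
elim: k => [|k IH].
  rewrite expr0 -[LHS]diag_const_mx; congr diag_mx.
  by apply/rowP => j; rewrite !mxE expr0.
rewrite exprS IH -mulmxE mulmx_diag; congr diag_mx.
by apply/rowP => j; rewrite !mxE exprS.
Qed.

Lemma expmx_conj (F : fieldType) n (P A : 'M[F]_n) k : P \in unitmx ->
  (invmx P *m A *m P) ^+ k = invmx P *m (A ^+ k) *m P.
Proof.
move=> Pu; elim: k => [|k IH]; first by rewrite !expr0 mulmx1 mulVmx.
by rewrite !exprS IH -!mulmxE !mulmxA mulmxK.
Qed.

(** Over R[i] the matrix is hermitian, hence unitarily diagonalizable with real
    eigenvalues; both identities descend because R embeds in R[i]. *)
Lemma symmetric_spectrum (R : rcfType) n (A : 'M[R]_n) : A^T = A ->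
  exists D : 'rV[R]_n, char_poly A = \prod_(i < n) ('X - (D ord0 i)%:P) /\
    forall k, \tr (A ^+ k) = \sum_(i < n) D ord0 i ^+ k.
Proof.
move=> Asym; pose c := @real_complex R.
pose B := map_mx c A.
have Bherm : B \is hermsymmx.
  apply: realsym_hermsym.
    by apply/is_hermitianmxP; rewrite expr0 scale1r map_mx_id// map_trmx Asym.
  apply/mxOverP => i j; rewrite mxE.
  by apply/complex_realP; exists (A i j).
have /orthomx_spectralP BE := hermitian_normalmx Bherm.
have /mxOverP Dreal := hermitian_spectral_diag_real Bherm.
set P := spectralmx B in BE.
have Pu : P \in unitmx := spectral_unit B.
set D := spectral_diag B in BE Dreal.
exists (\row_j Re (D ord0 j)).
have DE j : c (Re (D ord0 j)) = D ord0 j by apply: RRe_real.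
split.
  apply: (map_poly_inj c); rewrite map_char_poly -/B rmorph_prod /=.
  rewrite BE char_poly_conj// char_poly_diag; apply: eq_bigr => i _.
  rewrite rmorphB /= map_polyX map_polyC /= mxE.
  by congr ('X - _%:P); rewrite -[LHS]DE.
move=> k; apply: (fmorph_inj c).
rewrite -trace_map_mx rmorph_sum /=.
have -> : map_mx c (A ^+ k) = B ^+ k.
  elim: k => [|k IH]; first by rewrite !expr0 map_mx1.
  by rewrite !exprS -!mulmxE map_mxM IH.
rewrite BE expmx_conj// mxtrace_mulC mulmxA mulmxV// mul1mx diag_mx_exp.
rewrite mxtrace_diag; apply: eq_bigr => i _.
by rewrite !mxE rmorphXn; congr (_ ^+ _); rewrite -[LHS]DE.
Qed.

(** Links the listing of the eigenvalues by roots and multiplicities to a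
    diagonalization: in a split polynomial, the multiplicity of x as a root is
    the number of factors 'X - x. *)
Lemma roots_char_poly_perm (R : rcfType) n (p : {poly R}) (D : 'rV[R]_n) :
  p = \prod_(i < n) ('X - (D ord0 i)%:P) ->
  perm_eq (flatten [seq nseq (mup x p) x | x <- polyrcf.rootsR p])
          [seq D ord0 i | i <- enum 'I_n].
Proof.
move=> pE; set s := [seq _ | i <- enum _].
have {pE} pE : p = \prod_(x <- s) ('X - x%:P).
  by rewrite pE big_map big_enum.
have p0 : p != 0 by rewrite pE monic_neq0// monic_prod_XsubC.
have mupE x : mup x p = count_mem x s.
  rewrite pE; elim: (s) => [|a s' IH] /=.
    by rewrite big_nil mupNroot// root1.
  rewrite big_cons mupM ?polyXsubC_eq0 ?monic_neq0 ?monic_prod_XsubC// IH.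
  by rewrite -['X - _]expr1 mup_XsubCX; case: eqVneq.
apply/allP => x _ /=; apply/eqP; rewrite -mupE.
rewrite count_flatten -map_comp sumnE big_map.
rewrite (eq_bigr (fun y => (y == x) * mup x p)%N); last first.
  move=> y _ /=; rewrite count_nseq /=.
  by case: eqVneq => [->|_]; rewrite ?mul1n ?mul0n.
rewrite -big_distrl /=; have := polyrcf.roots_on_rootsR p0 x.
rewrite in_itv /= => xr.
have ur : uniq (polyrcf.rootsR p) by apply: polyrcf.uniq_roots.
have -> : (\sum_(y <- polyrcf.rootsR p) (y == x) = count_mem x (polyrcf.rootsR p))%N.
  by elim: (polyrcf.rootsR p) => [|y l IH]; rewrite ?big_nil// big_cons /= IH.
rewrite (count_uniq_mem _ ur) -xr.
have [_|nr] := boolP (root p x); first by rewrite mul1n.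
by rewrite mul0n mupNroot.
Qed.
End spectrum.

(** * Products of traces of powers *)

Section power_sums.
Variable R : realFieldType.

Lemma exprn_mul_le_add (x y : R) p q : 0 <= x -> 0 <= y ->
  x ^+ p * y ^+ q <= x ^+ (p + q) + y ^+ (p + q).
Proof.
move=> x0 y0; rewrite !exprD; case: (leP x y) => [xy|/ltW yx].
  rewrite (@le_trans _ _ (y ^+ p * y ^+ q))// ?ler_wpDl ?mulr_ge0 ?exprn_ge0//.
  by rewrite ler_wpM2r ?exprn_ge0// lerXn2r.
rewrite (@le_trans _ _ (x ^+ p * x ^+ q))// ?ler_wpDr ?mulr_ge0 ?exprn_ge0//.
by rewrite ler_wpM2l ?exprn_ge0// lerXn2r.
Qed.

(** Bounds power sums of odd order by even ones: as p + q is even, each product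
    |x|^p |y|^q is at most x^(p+q) + y^(p+q). *)
Lemma power_sum_mul_le n (x : 'I_n -> R) p q : ~~ odd (p + q) ->
  `|(\sum_i x i ^+ p) * (\sum_i x i ^+ q)| <= 2 * n%:R * \sum_i x i ^+ (p + q).
Proof.
move=> epq; rewrite big_distrlr /= (le_trans (ler_norm_sum _ _ _))//.
have le1 i : `|\sum_j x i ^+ p * x j ^+ q| <=
    \sum_j (x i ^+ (p + q) + x j ^+ (p + q)).
  apply: le_trans (ler_norm_sum _ _ _) _; apply: ler_sum => j _.
  rewrite normrM !normrX -[x i ^+ _]ger0_norm ?exprn_even_ge0//.
  rewrite -[x j ^+ (_ + _)]ger0_norm ?exprn_even_ge0// !normrX.
  exact: exprn_mul_le_add.
apply: le_trans (ler_sum _ (fun i _ => le1 i)) _.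
rewrite (eq_bigr (fun i => n%:R * x i ^+ (p + q) + \sum_j x j ^+ (p + q)));
  last by move=> i _; rewrite big_split /= sumr_const card_ord mulr_natl.
by rewrite big_split /= -mulr_sumr sumr_const card_ord -mulr_natl; lra.
Qed.

Lemma sum_mul_le n (x y : 'I_n -> R) : (forall i, 0 <= x i) ->
  (forall i, 0 <= y i) -> \sum_i x i * y i <= (\sum_i x i) * (\sum_i y i).
Proof.
move=> x0 y0; rewrite mulr_suml; apply: ler_sum => i _.
rewrite ler_wpM2l// (bigD1 i)//= lerDl; exact: sumr_ge0.
Qed.

End power_sums.

Section trace_powers.
Variables (R : rcfType) (n : nat) (A : 'M[R]_n).
Hypothesis Asym : A^T = A.

Lemma trace_even_ge0 k : ~~ odd k -> 0 <= \tr (A ^+ k).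
Proof.
move=> ek; have [D [_ ->]] := symmetric_spectrum Asym.
by apply: sumr_ge0 => i _; rewrite exprn_even_ge0.
Qed.

Lemma trace_mul_le p q : ~~ odd (p + q) ->
  `|\tr (A ^+ p) * \tr (A ^+ q)| <= 2 * n%:R * \tr (A ^+ (p + q)).
Proof.
have [D [_ trE]] := symmetric_spectrum Asym.
by rewrite !trE; exact: power_sum_mul_le.
Qed.

Lemma traceD_le p q : ~~ odd p -> ~~ odd q ->
  \tr (A ^+ (p + q)) <= \tr (A ^+ p) * \tr (A ^+ q).
Proof.
have [D [_ trE]] := symmetric_spectrum Asym.
move=> ep eq; rewrite !trE; under eq_bigr do rewrite exprD.
by apply: sum_mul_le => i; rewrite exprn_even_ge0.
Qed.

End trace_powers.

(** * Contractions of the covariance kernel *)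

Section cauchy_schwarz.
Variable R : rcfType.

(** By Lagrange's identity. *)
Lemma cauchy_schwarz_sqr (I : finType) (a b : I -> R) :
  (\sum_i a i * b i) ^+ 2 <= (\sum_i a i ^+ 2) * (\sum_i b i ^+ 2).
Proof.
have h : 0 <= \sum_i \sum_j (a i * b j - a j * b i) ^+ 2.
  by apply: sumr_ge0 => i _; apply: sumr_ge0 => j _; exact: sqr_ge0.
have e : \sum_i \sum_j (a i * b j - a j * b i) ^+ 2 =
  2 * ((\sum_i a i ^+ 2) * (\sum_i b i ^+ 2)) - 2 * (\sum_i a i * b i) ^+ 2.
  rewrite (eq_bigr (fun i => a i ^+ 2 * (\sum_j b j ^+ 2)
     - 2 * (a i * b i) * (\sum_j a j * b j) + b i ^+ 2 * (\sum_j a j ^+ 2))).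
    rewrite !big_split /= sumrN -!mulr_suml -mulr_sumr; ring.
  move=> i _; rewrite !mulr_sumr -sumrN -!big_split /=.
  by apply: eq_bigr => j _; ring.
by move: h; rewrite e; lra.
Qed.

Lemma cauchy_schwarz (I : finType) (a b : I -> R) :
  `|\sum_i a i * b i| <=
  Num.sqrt (\sum_i a i ^+ 2) * Num.sqrt (\sum_i b i ^+ 2).
Proof.
have a0 : 0 <= \sum_i a i ^+ 2 by apply: sumr_ge0 => i _; exact: sqr_ge0.
rewrite -sqrtrM// -sqrtr_sqr; apply: ler_wsqrtr.
exact: cauchy_schwarz_sqr.
Qed.

End cauchy_schwarz.

Section covariance_form.
Variables (R : rcfType) (n : nat).
Implicit Types (x y z : 'I_n -> R) (A B : 'M[R]_n).

(** The Frobenius norm. *)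
Definition fro A : R := Num.sqrt (\sum_i \sum_j A i j ^+ 2).

Definition bil x A y : R := \sum_i \sum_j x i * A i j * y j.

Definition dot x y : R := \sum_i x i * y i.

Lemma fro_ge0 A : 0 <= fro A. Proof. exact: sqrtr_ge0. Qed.

Lemma fro_sym_exp A k : A^T = A -> fro (A ^+ k) ^+ 2 = \tr (A ^+ (k + k)).
Proof.
move=> As; have Ak : (A ^+ k)^T = A ^+ k.
  elim: k => [|k IH]; first by rewrite expr0 trmx1.
  by rewrite {1}exprS -mulmxE trmx_mul IH As mulmxE -exprSr.
rewrite sqr_sqrtr; last first.
  by apply: sumr_ge0 => i _; apply: sumr_ge0 => j _; exact: sqr_ge0.
rewrite exprD -mulmxE; apply: eq_bigr => i _; rewrite !mxE.
apply: eq_bigr => j _; rewrite expr2; congr (_ * _).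
by rewrite -{1}Ak mxE.
Qed.

Lemma fro_pair A : fro A = Num.sqrt (\sum_(p : 'I_n * 'I_n) A p.1 p.2 ^+ 2).
Proof. by rewrite /fro pair_bigA. Qed.

Lemma pair_sum_le A B :
  `|\sum_i \sum_j A i j * B i j| <= fro A * fro B.
Proof. by rewrite pair_bigA /= !fro_pair; exact: cauchy_schwarz. Qed.

Lemma fro_tr A : fro A^T = fro A.
Proof.
rewrite /fro exchange_big /=; congr Num.sqrt.
by apply: eq_bigr => i _; apply: eq_bigr => j _; rewrite mxE.
Qed.

(** The bilinear form is the Frobenius product of A with the matrix (x_i y_j),
    which has norm 1. *)
Lemma bil_le x A y : dot x x = 1 -> dot y y = 1 -> `|bil x A y| <= fro A.
Proof.
move=> x1 y1; pose X := \matrix_(i, j) (x i * y j).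
have -> : bil x A y = \sum_i \sum_j X i j * A i j.
  by apply: eq_bigr => i _; apply: eq_bigr => j _; rewrite mxE; ring.
apply: (le_trans (pair_sum_le _ _)).
suff -> : fro X = 1 by rewrite mul1r.
rewrite /fro (eq_bigr (fun i => x i * x i)).
  by rewrite -/(dot x x) x1 sqrtr1.
move=> i _; rewrite -[RHS]mulr1 -y1 mulr_sumr; apply: eq_bigr => j _.
by rewrite mxE; ring.
Qed.

Lemma trace_le A : `|\tr A| <= Num.sqrt n%:R * fro A.
Proof.
have -> : \tr A = \sum_i \sum_j (1%:M : 'M[R]_n) i j * A i j.
  apply: eq_bigr => i _; rewrite (bigD1 i)//= mxE eqxx mul1r big1 ?addr0// => j.
  by rewrite mxE eq_sym => /negPf ->; rewrite mul0r.
apply: (le_trans (pair_sum_le _ _)).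
suff -> : fro 1%:M = Num.sqrt n%:R by [].
rewrite /fro; congr Num.sqrt.
rewrite (eq_bigr (fun=> 1)) ?sumr_const ?card_ord// => i _.
rewrite (bigD1 i)//= mxE eqxx expr1n big1 ?addr0// => j.
by rewrite mxE eq_sym => /negPf ->; rewrite expr0n.
Qed.

Lemma fro_mul A B : fro (A *m B) <= fro A * fro B.
Proof.
rewrite /fro -sqrtrM; last first.
  by apply: sumr_ge0 => i _; apply: sumr_ge0 => j _; exact: sqr_ge0.
apply: ler_wsqrtr; rewrite mulr_suml; apply: ler_sum => i _.
rewrite exchange_big /= mulr_sumr; apply: ler_sum => j _.
rewrite mxE; exact: cauchy_schwarz_sqr.
Qed.

(** This pairing of the indices comes from integrating tr (M M^k) by parts:
    differentiating the entry (j,i) of M^k in the entry (a,b) of M leaves the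
    products of the entry (j,a) of M^p and the entry (b,i) of M^q. *)
Definition contr (K : 'I_n -> 'I_n -> 'I_n -> 'I_n -> R) A B : R :=
  \sum_i \sum_j \sum_a \sum_b K i j a b * (A j a * B b i).

Definition kro (i j : 'I_n) : R := (i == j)%:R.

Lemma sum_krol a (f : 'I_n -> R) : \sum_i kro a i * f i = f a.
Proof.
rewrite (bigD1 a)//= /kro eqxx mul1r big1 ?addr0// => i.
by rewrite eq_sym => /negPf ->; rewrite mul0r.
Qed.

Lemma sum_kror a (f : 'I_n -> R) : \sum_i kro i a * f i = f a.
Proof. by rewrite -[RHS]sum_krol; apply: eq_bigr => i _; rewrite /kro eq_sym. Qed.

Lemma contrD K L A B :
  contr (fun i j a b => K i j a b + L i j a b) A B = contr K A B + contr L A B.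
Proof.
rewrite /contr -big_split; apply: eq_bigr => i _; rewrite -big_split.
apply: eq_bigr => j _; rewrite -big_split; apply: eq_bigr => a _.
by rewrite -big_split; apply: eq_bigr => b _; rewrite mulrDl.
Qed.

Lemma contrZ k K A B :
  contr (fun i j a b => k * K i j a b) A B = k * contr K A B.
Proof.
rewrite /contr mulr_sumr; apply: eq_bigr => i _.
rewrite mulr_sumr; apply: eq_bigr => j _.
rewrite mulr_sumr; apply: eq_bigr => a _.
rewrite mulr_sumr; apply: eq_bigr => b _.
exact/esym/mulrA.
Qed.

(** Every term of the covariance kernel is a product of deltas and coordinates,
    so that its contraction collapses to traces, bilinear forms or a Frobenius
    product.  The pairing d_ib d_ja is the only one that gives the product of
    both traces. *)
Lemma contr_ia_jb A B :
  contr (fun i j a b => kro i a * kro j b) A B = \sum_i \sum_j A i j * B i j.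
Proof.
rewrite /contr exchange_big; apply: eq_bigr => j _; apply: eq_bigr => i _ /=.
transitivity (\sum_a kro i a * \sum_b kro j b * (A j a * B b i)).
  by apply: eq_bigr => a _; rewrite mulr_sumr; apply: eq_bigr => b _; ring.
by rewrite !sum_krol.
Qed.

Lemma contr_ib_ja A B :
  contr (fun i j a b => kro i b * kro j a) A B = \tr A * \tr B.
Proof.
rewrite mulrC mulr_suml; apply: eq_bigr => i _.
rewrite mulr_sumr; apply: eq_bigr => j _.
transitivity (\sum_a kro j a * \sum_b kro i b * (A j a * B b i)).
  by apply: eq_bigr => a _; rewrite mulr_sumr; apply: eq_bigr => b _; ring.
by rewrite !sum_krol mulrC.
Qed.

Lemma contr_ranks x y z w A B :
  contr (fun i j a b => (x a * y b) * (z i * w j)) A B = bil w A x * bil y B z.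
Proof.
rewrite /contr exchange_big /= mulr_suml; apply: eq_bigr => j _.
rewrite mulr_suml exchange_big /=; apply: eq_bigr => a _.
rewrite /bil mulr_sumr exchange_big /=; apply: eq_bigr => b _.
by rewrite mulr_sumr; apply: eq_bigr => i _; ring.
Qed.

Lemma contr_ia x y A B :
  contr (fun i j a b => (kro i a * x b) * y j) A B = bil y (A *m B^T) x.
Proof.
rewrite /contr exchange_big /=; apply: eq_bigr => j _.
transitivity (\sum_i \sum_b y j * (A j i * B b i) * x b).
  apply: eq_bigr => i _; rewrite exchange_big; apply: eq_bigr => b _ /=.
  rewrite -[RHS](sum_krol i (fun a => y j * (A j a * B b i) * x b)).
  by apply: eq_bigr => a _; ring.
rewrite exchange_big; apply: eq_bigr => b _ /=.
rewrite mxE mulr_sumr mulr_suml; apply: eq_bigr => i _.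
by rewrite mxE.
Qed.

Lemma contr_ib x y A B :
  contr (fun i j a b => (x a * kro i b) * y j) A B = bil y A x * \tr B.
Proof.
rewrite mulrC mulr_suml /contr; apply: eq_bigr => i _.
rewrite /bil mulr_sumr; apply: eq_bigr => j _.
rewrite mulr_sumr; apply: eq_bigr => a _.
rewrite -[RHS](sum_krol i (fun b => B b i * (y j * A j a * x a))).
by apply: eq_bigr => b _; ring.
Qed.

Lemma contr_ja x y A B :
  contr (fun i j a b => (kro j a * x b) * y i) A B = \tr A * bil x B y.
Proof.
rewrite mulr_suml /contr exchange_big; apply: eq_bigr => j _ /=.
rewrite exchange_big /bil mulr_sumr.
transitivity (\sum_i \sum_b A j j * (x b * B b i * y i)).
  rewrite exchange_big; apply: eq_bigr => i _; rewrite exchange_big.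
  apply: eq_bigr => b _ /=.
  rewrite -[RHS](sum_krol j (fun a => A j a * (x b * B b i * y i))).
  by apply: eq_bigr => a _; ring.
rewrite exchange_big; apply: eq_bigr => b _ /=.
by rewrite mulr_sumr.
Qed.

Lemma contr_jb x y A B :
  contr (fun i j a b => (x a * kro j b) * y i) A B = bil x (A^T *m B) y.
Proof.
rewrite /contr /bil.
transitivity (\sum_i \sum_a \sum_j x a * (A j a * B j i) * y i).
  apply: eq_bigr => i _; rewrite exchange_big; apply: eq_bigr => a _ /=.
  apply: eq_bigr => j _.
  rewrite -[RHS](sum_krol j (fun b => x a * (A j a * B b i) * y i)).
  by apply: eq_bigr => b _; ring.
rewrite exchange_big; apply: eq_bigr => a _; apply: eq_bigr => i _ /=.
rewrite mxE mulr_sumr mulr_suml; apply: eq_bigr => j _.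
by rewrite mxE.
Qed.

Lemma contr_ji_ab A B :
  contr (fun i j a b => kro j i * kro a b) A B = \sum_i \sum_j A i j * B j i.
Proof.
apply: eq_bigr => i _; rewrite -[LHS]/(\sum_j _) exchange_big.
apply: eq_bigr => a _ /=.
transitivity (\sum_j kro j i * \sum_b kro a b * (A j a * B b i)).
  by apply: eq_bigr => j _; rewrite mulr_sumr; apply: eq_bigr => b _; ring.
by rewrite sum_kror sum_krol.
Qed.

Lemma contr_ji x y A B :
  contr (fun i j a b => (x b * kro j i) * y a) A B = bil x (B *m A) y.
Proof.
rewrite /contr /bil.
transitivity (\sum_i \sum_a \sum_b x b * (B b i * A i a) * y a).
  apply: eq_bigr => i _; rewrite exchange_big; apply: eq_bigr => a _ /=.
  rewrite exchange_big; apply: eq_bigr => b _ /=.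
  rewrite -[RHS](sum_kror i (fun j => x b * (B b i * A j a) * y a)).
  by apply: eq_bigr => j _; ring.
rewrite exchange_big [RHS]exchange_big; apply: eq_bigr => a _ /=.
rewrite exchange_big; apply: eq_bigr => b _ /=.
by rewrite mxE mulr_sumr mulr_suml.
Qed.

Lemma contr_ab x y A B :
  contr (fun i j a b => (kro a b * x i) * y j) A B = bil y (A *m B) x.
Proof.
rewrite /contr /bil exchange_big; apply: eq_bigr => j _ /=.
apply: eq_bigr => i _; rewrite mxE mulr_sumr mulr_suml.
apply: eq_bigr => a _.
rewrite -[RHS](sum_krol a (fun b => y j * (A j a * B b i) * x i)).
by apply: eq_bigr => b _; ring.
Qed.

(** The part of the kernel with one Kronecker delta. *)
Definition mixed x y (i j a b : 'I_n) : R :=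
  ((kro i a * x b) * y j + (x a * kro i b) * y j) +
  ((kro j a * x b) * y i + (x a * kro j b) * y i).

Variables u v : 'I_n -> R.
Hypotheses (u1 : dot u u = 1) (v1 : dot v v = 1) (n0 : (0 < n)%N).
Let c := dot u v.

(** 6 n times the covariance of the entries (i,j) and (a,b) of
    M = n^(-1/2) G . (u (x) v). *)
Definition cov_ker (i j a b : 'I_n) : R :=
  (1 + c ^+ 2) * (kro i a * kro j b + kro i b * kro j a)
  + ((u a * v b) * (u i * v j) + (u a * v b) * (v i * u j)
     + ((v a * u b) * (u i * v j) + (v a * u b) * (v i * u j)))
  + (mixed u u i j a b + c * mixed u v i j a b)
  + (c * mixed v u i j a b + mixed v v i j a b).

Lemma dot_le1 : `|c| <= 1.
Proof.
have := cauchy_schwarz u v; rewrite -/(dot u v) -/c.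
rewrite (eq_bigr (fun i => u i * u i))// -/(dot u u) u1.
by rewrite [X in _ * Num.sqrt X](eq_bigr (fun i => v i * v i))// -/(dot v v) v1 sqrtr1 mulr1.
Qed.

Let sn := Num.sqrt (n%:R : R).

Let sn1 : 1 <= sn.
Proof. by rewrite /sn -[X in X <= _]sqrtr1 ler_wsqrtr// ler1n. Qed.

Let frofro A B : fro A * fro B <= sn * (fro A * fro B).
Proof. by rewrite ler_peMl// mulr_ge0 ?fro_ge0. Qed.

(** Each term contains at most one trace, and a trace is at most sqrt n times the
    Frobenius norm. *)
Lemma contr_mixed_le x y A B : dot x x = 1 -> dot y y = 1 ->
  `|contr (mixed x y) A B| <= 4 * (sn * (fro A * fro B)).
Proof.
move=> x1 y1.
have -> : contr (mixed x y) A B = (bil y (A *m B^T) x + bil y A x * \tr B)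
    + (\tr A * bil x B y + bil x (A^T *m B) y).
  by rewrite /mixed !contrD contr_ia contr_ib contr_ja contr_jb.
have h1 : `|bil y (A *m B^T) x| <= sn * (fro A * fro B).
  apply: le_trans (frofro A B); apply: le_trans (bil_le _ y1 x1) _.
  by rewrite -(fro_tr B) fro_mul.
have h2 : `|bil x (A^T *m B) y| <= sn * (fro A * fro B).
  apply: le_trans (frofro A B); apply: le_trans (bil_le _ x1 y1) _.
  by rewrite -(fro_tr A) fro_mul.
have h3 : `|bil y A x * \tr B| <= sn * (fro A * fro B).
  rewrite normrM mulrCA ler_pM//; first exact: bil_le.
  exact: trace_le.
have h4 : `|\tr A * bil x B y| <= sn * (fro A * fro B).
  rewrite normrM mulrA ler_pM//; last exact: bil_le.
  exact: trace_le.
rewrite !ler_norml in h1 h2 h3 h4 *.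
move/andP: h1 => [? ?]; move/andP: h2 => [? ?]; move/andP: h3 => [? ?].
by move/andP: h4 => [? ?]; apply/andP; split; lra.
Qed.

Lemma contr_ranks_le x y z w A B : dot x x = 1 -> dot y y = 1 ->
  dot z z = 1 -> dot w w = 1 ->
  `|contr (fun i j a b => (x a * y b) * (z i * w j)) A B| <=
   sn * (fro A * fro B).
Proof.
move=> x1 y1 z1 w1; rewrite contr_ranks; apply: le_trans (frofro A B).
by rewrite normrM ler_pM// bil_le.
Qed.

Let c_le k (X Y : R) : 0 <= k -> `|X| <= k * Y -> `|c * X| <= k * Y.
Proof.
move=> k0 h; rewrite normrM -[leRHS]mul1r ler_pM//; exact: dot_le1.
Qed.

Lemma one_c2 : 1 <= 1 + c ^+ 2 /\ 1 + c ^+ 2 <= 2.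
Proof.
split; first by rewrite lerDl sqr_ge0.
by rewrite lerD2l -(real_normK (num_real c)) expr_le1// dot_le1.
Qed.

(** The constant is 2 for the Frobenius product, 4 for the terms without delta
    and 4 times 4 for the terms with one delta. *)
Lemma contr_cov_ker_le A B :
  `|contr cov_ker A B - (1 + c ^+ 2) * (\tr A * \tr B)| <=
  22 * (sn * (fro A * fro B)).
Proof.
have -> : contr cov_ker A B =
    (1 + c ^+ 2) * (\sum_i \sum_j A i j * B i j + \tr A * \tr B)
    + (contr (fun i j a b => (u a * v b) * (u i * v j)) A B
       + contr (fun i j a b => (u a * v b) * (v i * u j)) A B
       + (contr (fun i j a b => (v a * u b) * (u i * v j)) A B
          + contr (fun i j a b => (v a * u b) * (v i * u j)) A B))
    + (contr (mixed u u) A B + c * contr (mixed u v) A B)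
    + (c * contr (mixed v u) A B + contr (mixed v v) A B).
  by rewrite /cov_ker /mixed !(contrD, contrZ) contr_ia_jb contr_ib_ja.
have h1 := contr_mixed_le A B u1 u1.
have h2 := c_le (ler0n _ 4) (contr_mixed_le A B u1 v1).
have h3 := c_le (ler0n _ 4) (contr_mixed_le A B v1 u1).
have h4 := contr_mixed_le A B v1 v1.
have r1 := contr_ranks_le A B u1 v1 u1 v1.
have r2 := contr_ranks_le A B u1 v1 v1 u1.
have r3 := contr_ranks_le A B v1 u1 u1 v1.
have r4 := contr_ranks_le A B v1 u1 v1 u1.
have h0 : `|(1 + c ^+ 2) * \sum_i \sum_j A i j * B i j| <=
    2 * (sn * (fro A * fro B)).
  rewrite normrM; apply: ler_pM => //; last first.
    by apply: le_trans (frofro A B); exact: pair_sum_le.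
  by case: one_c2 => ? ?; rewrite ger0_norm //; lra.
set N := sn * _ in h0 h1 h2 h3 h4 r1 r2 r3 r4 *.
rewrite !mulrDr.
rewrite !ler_norml in h0 h1 h2 h3 h4 r1 r2 r3 r4 *.
move/andP: h1 => [? ?]; move/andP: h2 => [? ?]; move/andP: h3 => [? ?].
move/andP: h4 => [? ?]; move/andP: h0 => [? ?].
move/andP: r1 => [? ?]; move/andP: r2 => [? ?]; move/andP: r3 => [? ?].
by move/andP: r4 => [? ?]; apply/andP; split; lra.
Qed.

Lemma contr_ext K L A B : (forall i j a b, K i j a b = L i j a b) ->
  contr K A B = contr L A B.
Proof.
move=> KL; rewrite /contr; apply: eq_bigr => i _; apply: eq_bigr => j _.
by apply: eq_bigr => a _; apply: eq_bigr => b _; rewrite KL.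
Qed.

(** After the cyclic rotation of the indices that [quad_cov_ker_le] needs, the
    traces are gone, and with them the factor sqrt n. *)
Lemma contr_mixed_rot_le x y A : A^T = A -> dot x x = 1 -> dot y y = 1 ->
  `|contr (fun i j a b => mixed x y j a b i) A A| <= 4 * (fro A * fro A).
Proof.
move=> As x1 y1.
have -> : contr (fun i j a b => mixed x y j a b i) A A =
    bil y (A *m A) x + bil x (A *m A) y + (bil y (A *m A) x + bil y (A *m A) x).
  rewrite /mixed !contrD contr_ji contr_ab; congr (_ + _ + (_ + _)).
    rewrite -[X in X *m _]As -contr_jb; apply: contr_ext => i j a b; ring.
  rewrite -[X in _ *m X]As -contr_ia; apply: contr_ext => i j a b.
  by rewrite /kro eq_sym; ring.
have h1 : `|bil y (A *m A) x| <= fro A * fro A.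
  by apply: le_trans (bil_le _ y1 x1) _; rewrite fro_mul.
have h2 : `|bil x (A *m A) y| <= fro A * fro A.
  by apply: le_trans (bil_le _ x1 y1) _; rewrite fro_mul.
rewrite !ler_norml in h1 h2 *.
move/andP: h1 => [? ?]; move/andP: h2 => [? ?]; apply/andP; split; lra.
Qed.

Lemma contr_ranks_rot_le x y z w A : dot x x = 1 -> dot y y = 1 ->
  dot z z = 1 -> dot w w = 1 ->
  `|contr (fun i j a b => (x b * y i) * (z j * w a)) A A| <= fro A * fro A.
Proof.
move=> x1 y1 z1 w1.
rewrite (@contr_ext _ (fun i j a b => (w a * x b) * (y i * z j))).
  by rewrite contr_ranks normrM ler_pM// bil_le.
by move=> i j a b; ring.
Qed.

(** The quadratic form pairs (i,j) and (a,b), while the product of two traces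
    needs d_ij d_ab, which is not among the terms of the kernel.  The constant
    is 4 for the terms with two deltas, 4 for those without and 4 times 4 for
    those with one. *)
Lemma quad_cov_ker_le A : A^T = A ->
  `|\sum_i \sum_j \sum_a \sum_b cov_ker i j a b * (A i j * A a b)| <=
  24 * (fro A * fro A).
Proof.
move=> As.
have -> : \sum_i \sum_j \sum_a \sum_b cov_ker i j a b * (A i j * A a b) =
    contr (fun i j a b => cov_ker j a b i) A A.
  rewrite /contr [RHS]exchange_big; apply: eq_bigr => i _ /=.
  rewrite [RHS]exchange_big; apply: eq_bigr => j _ /=.
  by rewrite [RHS]exchange_big; apply: eq_bigr => a _ /=.
have -> : contr (fun i j a b => cov_ker j a b i) A A =
    (1 + c ^+ 2) * (contr (fun i j a b => kro j b * kro a i) A A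
       + contr (fun i j a b => kro j i * kro a b) A A)
    + (contr (fun i j a b => (u b * v i) * (u j * v a)) A A
       + contr (fun i j a b => (u b * v i) * (v j * u a)) A A
       + (contr (fun i j a b => (v b * u i) * (u j * v a)) A A
          + contr (fun i j a b => (v b * u i) * (v j * u a)) A A))
    + (contr (fun i j a b => mixed u u j a b i) A A
       + c * contr (fun i j a b => mixed u v j a b i) A A)
    + (c * contr (fun i j a b => mixed v u j a b i) A A
       + contr (fun i j a b => mixed v v j a b i) A A).
  by rewrite /cov_ker /mixed !(contrD, contrZ).
rewrite (@contr_ext (fun i j a b => kro j b * kro a i)
                    (fun i j a b => kro i a * kro j b)); last first.
  by move=> i j a b; rewrite mulrC /kro [a == i]eq_sym.
rewrite contr_ia_jb contr_ji_ab.
have h1 := contr_mixed_rot_le As u1 u1.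
have h2 := c_le (ler0n _ 4) (contr_mixed_rot_le As u1 v1).
have h3 := c_le (ler0n _ 4) (contr_mixed_rot_le As v1 u1).
have h4 := contr_mixed_rot_le As v1 v1.
have r1 := contr_ranks_rot_le A u1 v1 u1 v1.
have r2 := contr_ranks_rot_le A u1 v1 v1 u1.
have r3 := contr_ranks_rot_le A v1 u1 u1 v1.
have r4 := contr_ranks_rot_le A v1 u1 v1 u1.
have h0 : `|(1 + c ^+ 2) * (\sum_i \sum_j A i j * A i j +
    \sum_i \sum_j A i j * A j i)| <= 4 * (fro A * fro A).
  have -> : \sum_i \sum_j A i j * A j i = \sum_i \sum_j A i j * A i j.
    apply: eq_bigr => i _; apply: eq_bigr => j _.
    by rewrite -[in A j i]As mxE.
  set S := \sum_i _; have -> : (1 + c ^+ 2) * (S + S) = ((1 + c ^+ 2) * 2) * S by ring.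
  rewrite normrM; apply: ler_pM => //; last exact: pair_sum_le.
  by case: one_c2 => ? ?; rewrite ger0_norm; lra.
set N := fro A * _ in h0 h1 h2 h3 h4 r1 r2 r3 r4 *.
rewrite !ler_norml in h0 h1 h2 h3 h4 r1 r2 r3 r4 *.
move/andP: h1 => [? ?]; move/andP: h2 => [? ?]; move/andP: h3 => [? ?].
move/andP: h4 => [? ?]; move/andP: h0 => [? ?].
move/andP: r1 => [? ?]; move/andP: r2 => [? ?]; move/andP: r3 => [? ?].
by move/andP: r4 => [? ?]; apply/andP; split; lra.
Qed.

End covariance_form.

(** * Covariances of the tensor entries *)

Section rearrangements.
Variables (T : finType) (R : numFieldType).
Implicit Types (f : T -> T -> T -> T -> R) (i j k l a b c d : T).

(** All 24 orders are summed even if indices coincide, so that a rearrangement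
    is counted as often as there are permutations producing it. *)
Definition sum24 f i j k l : R :=
  f i j k l + f i j l k + f i k j l + f i k l j + f i l j k + f i l k j +
  f j i k l + f j i l k + f j k i l + f j k l i + f j l i k + f j l k i +
  f k i j l + f k i l j + f k j i l + f k j l i + f k l i j + f k l j i +
  f l i j k + f l i k j + f l j i k + f l j k i + f l k i j + f l k j i.

Lemma sum24_eq f g i j k l : (forall a b c d, f a b c d = g a b c d) ->
  sum24 f i j k l = sum24 g i j k l.
Proof. by move=> fg; rewrite /sum24 !fg. Qed.

Lemma sum24_sum (I : finType) (F : I -> T -> T -> T -> T -> R) i j k l :
  \sum_x sum24 (F x) i j k l = sum24 (fun a b c d => \sum_x F x a b c d) i j k l.
Proof. by rewrite /sum24 !big_split. Qed.

(** Matches the first index with one of a, b, c, d and reduces to the same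
    statement for three, then two indices. *)
Lemma sum24_perm f i j k l a b c d :
  perm_eq [:: i; j; k; l] [:: a; b; c; d] -> sum24 f i j k l = sum24 f a b c d.
Proof.
move=> /permP /= H.
have Ha := H (pred1 a); rewrite /= eqxx in Ha.
have : [|| i == a, j == a, k == a | l == a] by move: Ha; do 4 case: eqVneq => _ //=.
have {Ha} red (x y z : T) :
    (forall p : pred T, p x + (p y + (p z + 0)) = p b + (p c + (p d + 0)))%N ->
    (forall g, g x y z + g x z y + g y x z + g y z x + g z x y + g z y x =
      g b c d + g b d c + g c b d + g c d b + g d b c + g d c b :> R).
  move=> {}H g; have Hb := H (pred1 b); rewrite /= eqxx in Hb.
  have two (y' z' : T) : (forall p : pred T, p y' + (p z' + 0) = p c + (p d + 0))%N ->
      (y' = c /\ z' = d) \/ (y' = d /\ z' = c).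
    move=> {}H; have Hc := H (pred1 c); rewrite /= eqxx in Hc.
    have : (y' == c) || (z' == c) by move: Hc; do 2 case: eqVneq => _ //=.
    case/orP => /eqP e; subst.
      left; split => //; have := H (pred1 d); rewrite /= eqxx.
      by case: (eqVneq z' d) => //= _; case: (c == d).
    right; split => //; have := H (pred1 d); rewrite /= eqxx.
    by case: (eqVneq y' d) => //= _; case: (c == d).
  have : [|| x == b, y == b | z == b] by move: Hb; do 3 case: eqVneq => _ //=.
  case/or3P => /eqP e; subst.
  - have [|[-> ->]|[-> ->]] := two y z.
    + by move=> p; exact: addnI (H p).
    + ring.
    + ring.
  - have [|[-> ->]|[-> ->]] := two x z.
    + by move=> p; have := H p; rewrite (addnCA (p x)) => /addnI.
    + ring.
    + ring.
  - have [|[-> ->]|[-> ->]] := two x y.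
    + by move=> p; have := H p; rewrite (addnCA (p y)) (addnCA (p x)) => /addnI.
    + ring.
    + ring.
have fin x y z : (forall p : pred T, p x + (p y + (p z + 0)) =
      p b + (p c + (p d + 0)))%N -> sum24 f a x y z = sum24 f a b c d.
  move=> Hx; have e1 := red _ _ _ Hx (f a); have e2 := red _ _ _ Hx (fun y z w => f y a z w).
  have e3 := red _ _ _ Hx (fun y z w => f y z a w).
  have e4 := red _ _ _ Hx (fun y z w => f y z w a).
  have sE y' z' w' : sum24 f a y' z' w' =
     (f a y' z' w' + f a y' w' z' + f a z' y' w' + f a z' w' y' + f a w' y' z' + f a w' z' y')
    + (f y' a z' w' + f y' a w' z' + f z' a y' w' + f z' a w' y' + f w' a y' z' + f w' a z' y')
    + (f y' z' a w' + f y' w' a z' + f z' y' a w' + f z' w' a y' + f w' y' a z' + f w' z' a y')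
    + (f y' z' w' a + f y' w' z' a + f z' y' w' a + f z' w' y' a + f w' y' z' a + f w' z' y' a).
    by rewrite /sum24; ring.
  by rewrite !sE e1 e2 e3 e4.
case/or4P => /eqP e; subst.
- by apply: fin => p; exact: addnI (H p).
- rewrite -(fin i k l); first by rewrite /sum24; ring.
  by move=> p; have := H p; rewrite (addnCA (p i)) => /addnI.
- rewrite -(fin i j l); first by rewrite /sum24; ring.
  by move=> p; have := H p; rewrite (addnCA (p j)) (addnCA (p i)) => /addnI.
- rewrite -(fin i j k); first by rewrite /sum24; ring.
  by move=> p; have := H p; rewrite (addnCA (p k)) (addnCA (p j)) (addnCA (p i)) => /addnI.
Qed.

Definition kro4 a b c d i j k l : R :=
  (a == i)%:R * (b == j)%:R * (c == k)%:R * (d == l)%:R.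

(** The number of permutations that turn (i,j,k,l) into (a,b,c,d). *)
Definition match24 i j k l a b c d : R := sum24 (kro4 a b c d) i j k l.

Lemma match24_sym i j k l a b c d : match24 i j k l a b c d = match24 a b c d i j k l.
Proof.
rewrite /match24 /sum24 /kro4 ![_ == i]eq_sym ![_ == j]eq_sym ![_ == k]eq_sym.
by rewrite ![_ == l]eq_sym; ring.
Qed.

Lemma match24_perm i j k l a b c d : perm_eq [:: i; j; k; l] [:: a; b; c; d] ->
  match24 i j k l a b c d = match24 i j k l i j k l.
Proof. by move=> h; rewrite match24_sym /match24 (sum24_perm _ h). Qed.

Lemma match24_Nperm i j k l a b c d : ~~ perm_eq [:: i; j; k; l] [:: a; b; c; d] ->
  match24 i j k l a b c d = 0.
Proof.
move=> h; have kro40 i' j' k' l' : perm_eq [:: i; j; k; l] [:: i'; j'; k'; l'] ->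
    kro4 a b c d i' j' k' l' = 0.
  move=> h'; rewrite /kro4; case: eqVneq => [e1|_]; last by rewrite !mul0r.
  case: eqVneq => [e2|_]; last by rewrite mulr0 !mul0r.
  case: eqVneq => [e3|_]; last by rewrite mulr0 !mul0r.
  case: eqVneq => [e4|_]; last by rewrite mulr0.
  by move: h; rewrite e1 e2 e3 e4 h'.
by rewrite /match24 /sum24 !kro40 ?addr0//; apply/permP => p /=;
  move: (nat_of_bool (p i)) (nat_of_bool (p j)) (nat_of_bool (p k)) (nat_of_bool (p l)); lia.
Qed.

Lemma sum_kro4 i j k l : \sum_(t : 4.-tuple T)
  kro4 (tnth t (inord 0)) (tnth t (inord 1)) (tnth t (inord 2)) (tnth t (inord 3))
    i j k l = 1.
Proof.
rewrite (bigD1 [tuple i; j; k; l])//= big1 => [|t].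
  by rewrite /kro4 !(tnth_nth i) !inordK//= !eqxx !mulr1 addr0.
case/tupleP: t => a t; case/tupleP: t => b t; case/tupleP: t => c t.
case/tupleP: t => d t; rewrite tuple0 => h.
rewrite /kro4 !(tnth_nth i) !inordK//=.
case: eqVneq => [e1|_]; last by rewrite !mul0r.
case: eqVneq => [e2|_]; last by rewrite mulr0 !mul0r.
case: eqVneq => [e3|_]; last by rewrite mulr0 !mul0r.
case: eqVneq => [e4|_]; last by rewrite mulr0.
by case/eqP: h; apply: val_inj; rewrite /= e1 e2 e3 e4.
Qed.

Lemma card_perm_tuple (s : 4.-tuple T) :
  #|[pred t : 4.-tuple T | perm_eq s t]| = size (permutations s).
Proof.
rewrite cardE -(size_map val); apply/perm_size/uniq_perm.
- by rewrite (map_inj_uniq val_inj) enum_uniq.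
- exact: permutations_uniq.
move=> x; rewrite mem_permutations; apply/mapP/idP => [[t + ->]|xs].
  by rewrite mem_enum inE perm_sym.
have sx : size x == 4 by rewrite (perm_size xs) size_tuple.
by exists (Tuple sx) => //; rewrite mem_enum inE perm_sym.
Qed.

(** The 24 orders of (i,j,k,l) are spread evenly over its distinct
    rearrangements, each being hit 24 / #Perm times.  This trades the variance
    4 / #Perm for an expression without case distinction on equal indices. *)
Lemma cov_match24 i j k l a b c d :
  4 / (size (permutations [:: i; j; k; l]))%:R *
    (perm_eq [:: i; j; k; l] [:: a; b; c; d])%:R = match24 i j k l a b c d / 6.
Proof.
have [h|h] := boolP (perm_eq _ _); last by rewrite match24_Nperm// mulr0 mul0r.
rewrite mulr1 match24_perm//.
have Hs : \sum_(t : 4.-tuple T) match24 i j k l (tnth t (inord 0))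
    (tnth t (inord 1)) (tnth t (inord 2)) (tnth t (inord 3)) = 24.
  by rewrite /match24 sum24_sum /sum24 !sum_kro4; ring.
rewrite (bigID [pred t : 4.-tuple T | perm_eq [:: i; j; k; l] t]) /= in Hs.
have tE (t : 4.-tuple T) : tval t = [:: tnth t (inord 0); tnth t (inord 1);
    tnth t (inord 2); tnth t (inord 3)].
  case/tupleP: t => x t; case/tupleP: t => y t; case/tupleP: t => z t.
  by case/tupleP: t => w t; rewrite tuple0 /= !(tnth_nth x) !inordK.
rewrite [X in _ + X]big1 in Hs; last first.
  by move=> t; rewrite [in perm_eq _ t]tE => /match24_Nperm.
rewrite addr0 (eq_bigr (fun=> match24 i j k l i j k l)) in Hs; last first.
  by move=> t; rewrite [in perm_eq _ t]tE => /match24_perm.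
rewrite sumr_const (card_perm_tuple [tuple i; j; k; l]) /= -[X in X = _]mulr_natr in Hs.
set N := size _ in Hs *; set m := match24 _ _ _ _ _ _ _ _ in Hs *.
have N0 : N%:R != 0 :> R.
  by apply/eqP => e; move/eqP: Hs; rewrite e mulr0 eq_sym pnatr_eq0.
by apply: (mulIf N0); rewrite mulfVK// mulrAC Hs; field.
Qed.

End rearrangements.

Section contraction.
Variables (R : rcfType) (n : nat) (u v : 'I_n -> R).
Hypotheses (u1 : dot u u = 1) (v1 : dot v v = 1).
Local Notation kro := (@kro R n).
Local Notation match24 := (@match24 _ R).

Lemma sum_sep (X Y : 'I_n -> R) (r : R) :
  \sum_k \sum_l (u k * v l) * (r * X k * Y l) = r * dot u X * dot v Y.
Proof.
rewrite -mulrA mulr_suml mulr_sumr; apply: eq_bigr => k _.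
by rewrite !mulr_sumr; apply: eq_bigr => l _; ring.
Qed.

Lemma dot_krol x a : dot x (kro a) = x a.
Proof. by rewrite -[RHS](sum_krol a); apply: eq_bigr => i _; rewrite mulrC. Qed.

Lemma dotC (x y : 'I_n -> R) : dot x y = dot y x.
Proof. by apply: eq_bigr => i _; rewrite mulrC. Qed.

Lemma sum_kro4_contract i j k l a b : \sum_c \sum_d match24 i j k l a b c d * (u c * v d) =
  sum24 (fun x y z w => kro a x * kro b y * u z * v w) i j k l.
Proof.
transitivity (sum24 (fun x y z w =>
    \sum_c \sum_d kro4 R a b c d x y z w * (u c * v d)) i j k l).
  rewrite -sum24_sum; apply: eq_bigr => c _; rewrite -sum24_sum.
  by apply: eq_bigr => d _; rewrite /match24 /sum24 !mulrDl.
apply: sum24_eq => x y z w.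
rewrite -[u z](sum_kror z) mulr_sumr mulr_suml; apply: eq_bigr => c _.
rewrite -[v w](sum_kror w) mulr_sumr; apply: eq_bigr => d _.
by rewrite /kro4 /kro; ring.
Qed.

(** Of the 24 matchings, those that send neither or both of k, l to c, d give
    terms with two deltas or none; the others give one delta. *)
Lemma match24_contract i j a b :
  \sum_k \sum_l (u k * v l) * \sum_c \sum_d match24 i j k l a b c d * (u c * v d)
  = cov_ker u v i j a b.
Proof.
transitivity (
    (kro a i * kro b j) * dot u u * dot v v +
    (kro a i * kro b j) * dot u v * dot v u +
    (kro a i * u j) * dot u (kro b) * dot v v +
    (kro a i * v j) * dot u (kro b) * dot v u +
    (kro a i * u j) * dot u v * dot v (kro b) +
    (kro a i * v j) * dot u u * dot v (kro b) +
    (kro a j * kro b i) * dot u u * dot v v +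
    (kro a j * kro b i) * dot u v * dot v u +
    (kro a j * u i) * dot u (kro b) * dot v v +
    (kro a j * v i) * dot u (kro b) * dot v u +
    (kro a j * u i) * dot u v * dot v (kro b) +
    (kro a j * v i) * dot u u * dot v (kro b) +
    (kro b i * u j) * dot u (kro a) * dot v v +
    (kro b i * v j) * dot u (kro a) * dot v u +
    (kro b j * u i) * dot u (kro a) * dot v v +
    (kro b j * v i) * dot u (kro a) * dot v u +
    (u i * v j) * dot u (kro a) * dot v (kro b) +
    (u j * v i) * dot u (kro a) * dot v (kro b) +
    (kro b i * u j) * dot u v * dot v (kro a) +
    (kro b i * v j) * dot u u * dot v (kro a) +
    (kro b j * u i) * dot u v * dot v (kro a) +
    (kro b j * v i) * dot u u * dot v (kro a) +
    (u i * v j) * dot u (kro b) * dot v (kro a) +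
    (u j * v i) * dot u (kro b) * dot v (kro a)).
  rewrite -!sum_sep -!big_split; apply: eq_bigr => k _.
  rewrite -!big_split; apply: eq_bigr => l _ /=.
  rewrite sum_kro4_contract /sum24; ring.
rewrite !dot_krol u1 v1 [dot v u]dotC /cov_ker /mixed /kro ![a == _]eq_sym ![b == _]eq_sym.
ring.
Qed.

End contraction.

(** * Change of variables for measures with a density *)

Section density.
Context d d' (T : measurableType d) (T' : measurableType d') (R : realType).
Variables (mu : {measure set T -> \bar R}) (nu : {measure set T' -> \bar R}).
Variables (X : T -> T') (g : T -> R).
Hypotheses (mX : measurable_fun [set: T] X) (mg : measurable_fun [set: T] g).
Hypothesis g0 : forall x, 0 <= g x.
Hypothesis nuE : forall B, measurable B ->
  nu B = (\int[mu]_(x in X @^-1` B) (g x)%:E)%E.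
Local Open Scope ereal_scope.
Import HBNNSimple.

Let nnsfun_case (f : {nnsfun T' >-> R}) :
  \int[nu]_y (f y)%:E = \int[mu]_x ((f (X x))%:E * (g x)%:E).
Proof.
have mXf r : measurable (X @^-1` (f @^-1` [set r])).
  by rewrite -[_ @^-1` _]setTI; exact: mX.
transitivity (\sum_(r \in range f) r%:E * nu (f @^-1` [set r])).
  by rewrite integralT_nnsfun sintegralE.
under [RHS]eq_integral.
  move=> x _; rewrite fimfunE -fsumEFin// ge0_mule_fsuml; last first.
    by move=> r; rewrite EFinM nnfun_muleindic_ge0.
  over.
rewrite [RHS]ge0_integral_fsum//; last 2 first.
  - move=> r; apply: emeasurable_funM; last exact/measurable_EFinP.
    apply/measurable_EFinP.
    apply: measurable_funM => //; apply: (measurableT_comp (measurable_indic _)) => //.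
  - move=> r x _; apply: mule_ge0; last by rewrite lee_fin.
    by rewrite EFinM nnfun_muleindic_ge0.
apply: eq_fsbigr => r /[!inE] -[y _ <-]; rewrite nuE// integral_mkcond -ge0_integralZl//.
- apply: eq_integral => x _; rewrite patchE indicE.
  have -> : (X x \in f @^-1` [set f y]) = (x \in X @^-1` (f @^-1` [set f y])).
    by apply/idP/idP; rewrite !inE.
  by case: ifPn => _; rewrite ?mulr1// ?mulr0 mul0e mule0.
- apply/(measurable_restrictT _ _).1 => //; apply: measurable_funTS.
  exact/measurable_EFinP.
- by move=> x _; rewrite patchE; case: ifPn; rewrite ?lee_fin.
- by rewrite lee_fin.
Qed.

(** The map X serves two purposes: with X the identity, nu has density g; with X
    a random variable, nu is the law of X under the measure of density g. *)
Lemma ge0_integral_density (f : T' -> \bar R) :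
  measurable_fun [set: T'] f -> (forall y, 0 <= f y) ->
  \int[nu]_y f y = \int[mu]_x (f (X x) * (g x)%:E).
Proof.
move=> mf f0; pose f_ := nnsfun_approx measurableT mf.
have cf y : (f_ n y)%:E @[n --> \oo] --> f y by exact: cvg_nnsfun_approx.
have ndf y : {homo (fun n => (f_ n y)%:E) : m n / (m <= n)%N >-> m <= n}.
  by move=> m n mn; rewrite lee_fin; exact/lefP/nd_nnsfun_approx.
transitivity (limn (fun n => \int[nu]_y (f_ n y)%:E)).
  rewrite -monotone_convergence//=.
  - by apply: eq_integral => y _; apply/esym/cvg_lim.
  - by move=> n; exact/measurable_EFinP/measurable_funTS.
  - by move=> n y _; rewrite lee_fin.
transitivity (limn (fun n => \int[mu]_x ((f_ n (X x))%:E * (g x)%:E))).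
  by apply: congr_lim; apply/funext => n; exact: nnsfun_case.
rewrite -monotone_convergence//=.
- apply: eq_integral => x _; apply/cvg_lim => //.
  exact: cvgeZr (cf (X x)).
- move=> n; apply: emeasurable_funM; last exact/measurable_EFinP.
  apply/measurable_EFinP.
  exact: measurableT_comp.
- by move=> n x _; rewrite mule_ge0 ?lee_fin.
- move=> x _ m n mn; apply: lee_wpmul2r; first by rewrite lee_fin.
  exact: ndf.
Qed.

Lemma integral_density (f : T' -> R) : measurable_fun [set: T'] f ->
  mu.-integrable [set: T] (fun x => (f (X x) * g x)%:E) ->
  nu.-integrable [set: T'] (EFin \o f) /\
  \int[nu]_y (f y)%:E = \int[mu]_x (f (X x) * g x)%:E.
Proof.
move=> mf fgi; have mEf : measurable_fun setT (EFin \o f) by exact/measurable_EFinP.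
split.
  apply/integrableP; split => //.
  rewrite ge0_integral_density//; last exact: measurableT_comp.
  move/integrableP : fgi => [_]; congr (_ < +oo); apply: eq_integral => x _ /=.
  by rewrite normrM EFinM (ger0_norm (g0 x)).
rewrite integralE [in RHS]integralE; congr (_ - _).
  rewrite ge0_integral_density//; last exact: measurable_funepos.
  apply: eq_integral => x _ /=; rewrite funepos.unlock /= -!EFin_max -EFinM.
  by rewrite maxr_pMl// mul0r.
rewrite ge0_integral_density//; last exact: measurable_funeneg.
apply: eq_integral => x _ /=; rewrite funeneg.unlock /= -!EFin_max -EFinM.
by rewrite maxr_pMl// mul0r mulNr//.
Qed.

End density.

(** * Moments of a centred normal variable *)

Section gaussian_moments.
Variable R : realType.
Local Notation leb := (@lebesgue_measure R).
Implicit Types (f F : R -> R).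

Lemma integral_is_derive f F (a b : R) : a < b ->
  (forall x : R, is_derive x 1 F (f x)) -> continuous f ->
  (\int[leb]_(x in `[a, b]) (f x)%:E = (F b - F a)%:E)%E.
Proof.
move=> ab dF cf.
have cF : continuous F.
  move=> x; apply: differentiable_continuous; apply/derivable1_diffP.
  exact: (@ex_derive _ _ _ _ _ _ _ (dF x)).
rewrite (@continuous_FTC2 _ f F)//.
- exact: continuous_subspaceT.
- split; first by move=> x _; exact: (@ex_derive _ _ _ _ _ _ _ (dF x)).
  + exact/cvg_at_right_filter/cF.
  + exact/cvg_at_left_filter/cF.
- move=> x _; rewrite derive1E; exact: (@derive_val _ _ _ _ _ _ _ (dF x)).
Qed.

Lemma cvg_integral_itv f : leb.-integrable setT (EFin \o f) ->
  (\int[leb]_(x in `[(- n.+1%:R)%R, (n.+1%:R)%R]) (f x)%:E @[n --> \oo] -->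
   \int[leb]_x (f x)%:E)%E.
Proof.
move=> fi; have mf : measurable_fun setT (EFin \o f) by case/integrableP: fi.
pose f_ (n : nat) := (EFin \o f) \_ `[(- n.+1%:R)%R, (n.+1%:R)%R]%classic.
have mf_ n : measurable_fun setT (f_ n).
  by apply/(measurable_restrictT _ _).1 => //; exact: measurable_funTS.
have [| |_ _] := @dominated_convergence _ _ _ leb setT measurableT f_
  (EFin \o f) (abse \o (EFin \o f)) mf_ mf _ (integrable_abse fi).
- apply: aeW => x _; apply: cvg_near_cst; near=> n.
  rewrite /f_ patchE ifT// inE /= in_itv /= -ler_norml.
  rewrite (@le_trans _ _ n%:R) ?ler_nat//; near: n; exact: nbhs_infty_ger.
- apply: aeW => x n _ /=; rewrite /f_ patchE; case: ifPn => // _.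
  by rewrite abse0 lee_fin.
by move=> h; under eq_fun do rewrite integral_mkcond; exact: h.
Unshelve. all: by end_near. Qed.

(** The integral over [-n, n] is F n - F (-n), which tends to 0 because F x is
    O(1/x). *)
Lemma integral_derive_eq0 f F : (forall x : R, is_derive x 1 F (f x)) ->
  continuous f -> leb.-integrable setT (EFin \o f) ->
  (exists C, forall x, `|x * F x| <= C) -> (\int[leb]_x (f x)%:E = 0)%E.
Proof.
move=> dF cf fi [C FC].
have h := cvg_integral_itv fi.
have C0 : 0 <= C by apply: le_trans (FC 0).
suff h0 : (\int[leb]_(x in `[(- n.+1%:R)%R, (n.+1%:R)%R]) (f x)%:E @[n --> \oo] --> 0)%E.
  by rewrite -(cvg_lim _ h)// (cvg_lim _ h0).
have e n : (F n.+1%:R - F (- n.+1%:R))%:E =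
    (\int[leb]_(x in `[(- n.+1%:R)%R, (n.+1%:R)%R]) (f x)%:E)%E.
  rewrite (@integral_is_derive f F)//.
  by rewrite ltrNl -subr_gt0 opprK -mulr2n pmulrn_lgt0// ltr0n.
under eq_fun do rewrite -e.
apply: cvg_EFin; first by near=> n.
apply: (@squeeze_cvgr _ _ _ _ (fun n => (- (2 * C)) * harmonic n) (fun n => 2 * C * harmonic n)).
- near=> n.
  have n0 : (0 : R) < n.+1%:R by rewrite ltr0n.
  have h1 := FC n.+1%:R; have h2 := FC (- n.+1%:R).
  rewrite mulNr normrN !normrM !(ger0_norm (ltW n0)) in h1 h2.
  rewrite mulNr -ler_norml (le_trans (ler_normB _ _))//= ler_pdivlMr// mulrDl.
  by rewrite [_ * n.+1%:R]mulrC [X in _ + X]mulrC; lra.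
- by rewrite -(mulr0 (- (2 * C))); apply: cvgMl_tmp; exact: cvg_harmonic.
- by rewrite -(mulr0 (2 * C)); apply: cvgMl_tmp; exact: cvg_harmonic.
Unshelve. all: by end_near. Qed.

Variable s : R.
Hypothesis s0 : s != 0.

Let c : R := (s ^+ 2 *+ 2)^-1.

Let c0 : 0 < c.
Proof. by rewrite invr_gt0 pmulrn_lgt0// exprn_even_gt0. Qed.

Lemma normal_fun0E x : normal_fun 0 s x = expR (- (c * x ^+ 2)).
Proof. by rewrite /normal_fun subr0 mulNr mulrC. Qed.

(** From expR y >= y^k / k! at y = t x^2. *)
Lemma pow_expR_bounded k (t : R) : 0 < t ->
  exists C, forall x, `|x ^+ k * expR (- (t * x ^+ 2))| <= C.
Proof.
move=> t0; exists (1 + (t ^+ k)^-1 * k`!%:R) => x.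
have t20 : 0 <= t * x ^+ 2 by rewrite mulr_ge0 ?sqr_ge0 ?ltW.
have e1 : 1 <= expR (t * x ^+ 2) by rewrite -[X in X <= _]expR0 ler_expR.
rewrite normrM (ger0_norm (expR_ge0 _)) expRN ler_pdivrMr ?expR_gt0//.
have k0 : 0 < k`!%:R :> R by rewrite ltr0n fact_gt0.
have p2k : (x ^+ 2) ^+ k <= (t ^+ k)^-1 * k`!%:R * expR (t * x ^+ 2).
  rewrite -mulrA ler_pdivlMl ?exprn_gt0// -exprMn -ler_pdivrMl//.
  case: k k0 => [|k] k0; first by rewrite fact0 expr0 invr1 mul1r.
  have := expR_ge1Dxn k t20; rewrite mulrC; lra.
rewrite mulrDl mul1r normrX; case: (leP `|x| 1) => x1.
  rewrite (@le_trans _ _ 1) ?exprn_ile1// (le_trans e1)// lerDl.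
  by rewrite !mulr_ge0 ?invr_ge0 ?exprn_ge0 ?expR_ge0// ltW.
rewrite (le_trans _ (le_trans p2k _)) ?lerDr ?expR_ge0//.
by rewrite -(real_normK (num_real x)) -exprM ler_eXn2l// leq_pmull.
Qed.

Let w := normal_fun 0 s.

Let is_derive_w (x : R) : is_derive x 1 w (- (2 * c * x) * w x).
Proof.
have -> : w = expR \o (fun x : R => - (c * x ^+ 2)).
  by apply/funext => y; rewrite /w normal_fun0E.
have dg : is_derive x 1 (fun x : R => - (c * x ^+ 2)) (- (c * (2 * x))).
  have -> : (fun x : R => - (c * x ^+ 2)) = - (c \*: ((@id R) ^+ 2)).
    by apply/funext => y.
  by apply: is_derive_eq; rewrite /GRing.scale /=; ring.
apply: is_derive_eq => /=; rewrite -/(normal_fun _ _ _) -normal_fun0E /w; ring.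
Qed.

(** Half of the exponent absorbs the power of x; the other half is, up to a
    constant, the normal density of standard deviation sqrt 2 * s. *)
Lemma gaussian_poly_integrable k : leb.-integrable setT
  (fun x => (x ^+ k * normal_pdf 0 s x)%:E).
Proof.
have [C hC] := pow_expR_bounded k (divr_gt0 c0 (ltr0n R 2)).
pose s' := Num.sqrt 2 * s.
have s'0 : s' != 0 by rewrite mulf_neq0// gt_eqF// sqrtr_gt0.
have nfE x : normal_fun 0 s x = expR (- (c / 2 * x ^+ 2)) * normal_fun 0 s' x.
  rewrite normal_fun0E /normal_fun subr0 -expRD; congr expR.
  rewrite exprMn sqr_sqrtr// /c -(mulr_natr (s ^+ 2)) -(mulr_natr (2 * _)); field.
  exact: s0.
pose D := normal_peak s * C / normal_peak s'.
have p0 := normal_peak_ge0 s.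
have p'0 := normal_peak_gt0 s'0.
have mpdf := @measurable_normal_pdf R 0 s.
have h : leb.-integrable setT (fun x => (D%:E * (normal_pdf 0 s' x)%:E)%E).
  exact/integrableZl/integrable_normal_pdf.
apply: (le_integrable measurableT _ _ h).
- apply/measurable_EFinP; apply: measurable_funM => //.
- move=> x _; rewrite lee_fin /= normal_pdfE// normal_pdfE// nfE.
  rewrite [X in `|X|](_ : _ = normal_peak s * ((x ^+ k * expR (- (c / 2 * x ^+ 2))) * normal_fun 0 s' x)); last by ring.
  rewrite [X in _ <= `|X|](_ : _ = normal_peak s * (C * normal_fun 0 s' x)); last first.
    by rewrite /D; field; rewrite gt_eqF.
  rewrite !normrM ler_wpM2l// ler_wpM2r//.
  by rewrite -normrM (le_trans (hC x))// ler_norm.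
Qed.

Let gaussian_ibp_integrable k : leb.-integrable setT (fun x =>
  ((k%:R * x ^+ k.-1 - x ^+ k.+1 / s ^+ 2) * normal_pdf 0 s x)%:E).
Proof.
rewrite [X in integrable _ _ X](_ : _ = (fun x => k%:R%:E * (x ^+ k.-1 * normal_pdf 0 s x)%:E
   - ((s ^+ 2)^-1)%:E * (x ^+ k.+1 * normal_pdf 0 s x)%:E)%E); last first.
  by apply/funext => x; rewrite -!EFinM -EFinB /=; congr EFin; ring.
by apply: integrableB => //; apply: integrableZl => //; exact: gaussian_poly_integrable.
Qed.

(** The integrand is the derivative of x^k times the density. *)
Lemma gaussian_ibp k : (\int[leb]_x
  ((k%:R * x ^+ k.-1 - x ^+ k.+1 / s ^+ 2) * normal_pdf 0 s x)%:E = 0)%E.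
Proof.
pose p := normal_peak s.
have pdfE x : normal_pdf 0 s x = p * w x by rewrite normal_pdfE.
have cE : 2 * c = (s ^+ 2)^-1 by rewrite /c -(mulr_natr (s ^+ 2)); field.
have cX j : continuous (fun x : R => x ^+ j) by move=> x; exact: exprn_continuous.
have cpdf : continuous (normal_pdf 0 s) by exact: continuous_normal_pdf.
apply: (@integral_derive_eq0 _ (fun x => x ^+ k * normal_pdf 0 s x)).
- move=> x.
  have -> : (fun x => x ^+ k * normal_pdf 0 s x) = p \*: ((@id R) ^+ k * w).
    by apply/funext => y; rewrite pdfE !fctE /GRing.scale /= mulrCA.
  have h := is_deriveZ p (is_deriveM (is_deriveX k (is_derive_id x (1 : R))) (is_derive_w x)).
  apply: (is_derive_eq h); rewrite pdfE !fctE /GRing.scale /= -cE exprS; ring.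
- move=> x; apply: cvgM; last exact: cpdf.
  by apply: cvgB; apply: cvgM; (exact: cX || exact: cvg_cst).
- exact: gaussian_ibp_integrable.
- have [C hC] := pow_expR_bounded k.+1 c0.
  exists (p * C) => x; rewrite pdfE /w normal_fun0E.
  rewrite [X in `|X|](_ : _ = p * (x ^+ k.+1 * expR (- (c * x ^+ 2)))); last first.
    by rewrite (exprS x k); ring.
  by rewrite normrM ger0_norm ?normal_peak_ge0// ler_wpM2l ?normal_peak_ge0.
Qed.

Context d (T : measurableType d) (P : probability T R) (X : {RV P >-> R}).
Hypothesis X_normal : forall B : set (measurableTypeR R), measurable B ->
  distribution P X B = normal_prob 0 s B.

Let integral_normal_rv (f : R -> R) : measurable_fun setT f ->
  leb.-integrable setT (fun x => (f x * normal_pdf 0 s x)%:E) ->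
  P.-integrable setT (EFin \o (f \o X)) /\
  (\int[P]_w (f (X w))%:E = \int[leb]_x (f x * normal_pdf 0 s x)%:E)%E.
Proof.
move=> mf fi.
have mpdf := @measurable_normal_pdf R 0 s.
have pdf0 := @normal_pdf_ge0 R 0 s.
have nuE B : measurable B -> distribution P X B =
    (\int[leb]_(x in idfun @^-1` B) (normal_pdf 0 s x)%:E)%E.
  by move=> mB; rewrite X_normal.
have [fint fE] := @integral_density _ _ (measurableTypeR R) R R
  leb (distribution P X) idfun (normal_pdf 0 s) (@measurable_id _ _ setT)
  mpdf pdf0 nuE f mf fi.
have fXi : P.-integrable setT (EFin \o (f \o X)).
  apply/integrableP; split.
    by apply/measurable_EFinP; apply: measurableT_comp.
  move/integrableP : fint => [_].
  by rewrite ge0_integral_distribution//; apply: measurableT_comp => //; exact/measurable_EFinP.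
split=> //; rewrite -fE integral_distribution//; exact/measurable_EFinP.
Qed.

Lemma normal_moment_integrable k :
  P.-integrable setT (EFin \o (fun w => X w ^+ k)).
Proof.
have [] // := @integral_normal_rv (fun x => x ^+ k).
exact: gaussian_poly_integrable.
Qed.

(** The one-variable case of Gaussian integration by parts, from which the
    multivariate case [stein] is deduced. *)
Lemma normal_moment_rec k : \int[P]_w (X w ^+ k.+1) =
  s ^+ 2 * (k%:R * \int[P]_w (X w ^+ k.-1)).
Proof.
have h : \int[P]_w (k%:R * X w ^+ k.-1 - X w ^+ k.+1 / s ^+ 2) = 0.
  have [| |_ hE] := @integral_normal_rv (fun x => k%:R * x ^+ k.-1 - x ^+ k.+1 / s ^+ 2).
  - apply: measurable_funB; first exact: measurable_funM.
    exact: measurable_funM.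
  - exact: gaussian_ibp_integrable.
  by rewrite /Rintegral hE gaussian_ibp.
have mi j : P.-integrable setT (EFin \o (fun w => X w ^+ j)).
  exact: normal_moment_integrable.
have mZl j (r : R) : P.-integrable setT (EFin \o (fun w => r * X w ^+ j)).
  exact: (integrableZl measurableT r (mi j)).
have mZr j (r : R) : P.-integrable setT (EFin \o (fun w => X w ^+ j * r)).
  exact: (integrableZr measurableT r (mi j)).
move: h; rewrite RintegralB// RintegralZl// RintegralZr//.
move=> /eqP; rewrite subr_eq0 => /eqP ->.
by rewrite mulrC divfK// expf_neq0.
Qed.

End gaussian_moments.

(** * Expectation of a product of independent variables *)

Section real_integrable.
Context d (T : measurableType d) (R : realType) (mu : {measure set T -> \bar R}).
Implicit Types F G : T -> R.

Lemma real_integrableD F G : mu.-integrable setT (EFin \o F) ->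
  mu.-integrable setT (EFin \o G) ->
  mu.-integrable setT (EFin \o (fun w => F w + G w)).
Proof. by move=> iF iG; apply: eq_integrable (integrableD measurableT iF iG). Qed.

Lemma real_integrableB F G : mu.-integrable setT (EFin \o F) ->
  mu.-integrable setT (EFin \o G) ->
  mu.-integrable setT (EFin \o (fun w => F w - G w)).
Proof. by move=> iF iG; apply: eq_integrable (integrableB measurableT iF iG). Qed.

Lemma real_integrableZ r F : mu.-integrable setT (EFin \o F) ->
  mu.-integrable setT (EFin \o (fun w => r * F w)).
Proof. by move=> iF; apply: eq_integrable (integrableZl measurableT r iF). Qed.

Lemma real_integrable_sum (J : Type) (l : seq J) (F : J -> T -> R) :
  (forall j, mu.-integrable setT (EFin \o F j)) ->
  mu.-integrable setT (EFin \o (fun w => \sum_(j <- l) F j w)).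
Proof.
move=> iF; elim: l => [|j l IH].
  by under eq_fun do rewrite big_nil; exact: integrable0.
by under eq_fun do rewrite big_cons; exact: real_integrableD.
Qed.

Lemma Rintegral_sum (J : Type) (l : seq J) (F : J -> T -> R) :
  (forall j, mu.-integrable setT (EFin \o F j)) ->
  \int[mu]_w (\sum_(j <- l) F j w) = \sum_(j <- l) \int[mu]_w F j w.
Proof.
move=> iF; elim: l => [|j l IH].
  under eq_Rintegral do rewrite big_nil.
  by rewrite big_nil /Rintegral integral0.
under eq_Rintegral do rewrite big_cons.
by rewrite RintegralD// ?IH ?big_cons//; exact: real_integrable_sum.
Qed.

End real_integrable.

Section independence.
Context d (T : measurableType d) (R : realType) (P : probability T R).
Variables (I : choiceType) (X : I -> {RV P >-> R}).
Implicit Types (S : seq I) (f : I -> R -> R) (B : I -> set R).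

Definition product_rule S := forall B, (forall s, measurable (B s)) ->
  P (\big[setI/setT]_(s <- S) (X s @^-1` B s)) =
  (\prod_(s <- S) P (X s @^-1` B s))%E.

Lemma product_rule_perm S S' : perm_eq S S' -> product_rule S -> product_rule S'.
Proof.
by move=> SS' PS B mB; rewrite -(perm_big _ SS') PS//; exact: perm_big.
Qed.

Lemma indic_bigsetI S B w :
  \prod_(s <- S) \1_(B s) (X s w) = \1_(\big[setI/setT]_(s <- S) (X s @^-1` B s)) w :> R.
Proof.
elim: S => [|s S IH]; first by rewrite !big_nil indicT.
by rewrite !big_cons indicI IH /= /indic; congr (_ * _)%R.
Qed.

Let measurable_preim s (A : set R) : measurable A -> measurable (X s @^-1` A).
Proof. by move=> mA; rewrite -[_ @^-1` _]setTI; exact: measurable_funPT. Qed.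

(** Replaces the indicators by the functions f s one variable at a time.  With
    the indicator of a set A at the variable s, the induction hypothesis says
    that the expectation, as a function of A, is a multiple of the law of X s;
    [ge0_integral_density] then integrates f s. *)
Lemma ge0_expectation_indep f (m : I -> R) :
  (forall s, measurable_fun setT (f s)) -> (forall s x, 0 <= f s x) ->
  (forall s, \int[P]_w (f s (X s w))%:E = (m s)%:E)%E ->
  forall S1 S2 B, (forall s, measurable (B s)) -> uniq (S1 ++ S2) ->
  product_rule (S1 ++ S2) ->
  (\int[P]_w (\prod_(s <- S1) f s (X s w) *
              \prod_(s <- S2) \1_(B s) (X s w))%:E =
   (\prod_(s <- S1) m s * \prod_(s <- S2) fine (P (X s @^-1` B s)))%:E)%E.
Proof.
move=> mf f0 fm; elim=> [|s S1 IH] S2 B mB.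
  move=> _ /= PS; rewrite big_nil mul1r.
  under eq_integral do rewrite big_nil mul1r indic_bigsetI.
  rewrite integral_indic//; last first.
    by apply: bigsetI_measurable => s _; exact: measurable_preim.
  rewrite setIT; apply: (etrans (PS B mB)); rewrite -prodEFin; apply: eq_bigr => s _.
  by rewrite fineK// fin_num_measure//; exact: measurable_preim.
rewrite cat_cons => uS PS.
have mXs : measurable_fun setT (X s) by exact: measurable_funPT.
pose g w := \prod_(s <- S1) f s (X s w) * \prod_(s <- S2) \1_(B s) (X s w).
have m0 t : 0 <= m t.
  by rewrite -lee_fin -fm; apply: integral_ge0 => w _; rewrite lee_fin.
pose c := \prod_(s <- S1) m s * \prod_(s <- S2) fine (P (X s @^-1` B s)).
have c0 : 0 <= c.
  by rewrite mulr_ge0// ?prodr_ge0// => t _; rewrite ?fine_ge0.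
have mg : measurable_fun setT g.
  apply: measurable_funM; apply: measurable_prod => t _.
    exact: measurableT_comp.
  by apply: measurableT_comp => //; exact: measurable_indic.
have g0 w : 0 <= g w by rewrite mulr_ge0// prodr_ge0// => t _; rewrite ?f0.
have pS : perm_eq (s :: S1 ++ S2) (S1 ++ s :: S2) by rewrite -cat1s perm_catCA.
have uS' : uniq (S1 ++ s :: S2) by rewrite -(perm_uniq pS).
have PS' := product_rule_perm pS PS.
have sS2 : s \notin S2.
  by move: uS; rewrite /= mem_cat negb_or => /andP[/andP[]].
(* the law of X s, up to the factor c, is the image of the measure of density g *)
have nuE A : measurable A -> mscale (NngNum c0) (distribution P (X s)) A =
    (\int[P]_(w in X s @^-1` A) (g w)%:E)%E.
  move=> mA; rewrite integral_mkcond.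
  pose B' t := if t == s then A else B t.
  have mB' t : measurable (B' t) by rewrite /B'; case: ifP.
  have B'S2 t : t \in S2 -> B' t = B t.
    by rewrite /B'; case: eqVneq => // ->; rewrite (negPf sS2).
  have e1 : \prod_(t <- s :: S2) fine (P (X t @^-1` B' t)) =
      fine (P (X s @^-1` A)) * \prod_(t <- S2) fine (P (X t @^-1` B t)).
    rewrite big_cons {1}/B' eqxx; congr (_ * _).
    by apply: eq_big_seq => t tS; rewrite B'S2.
  have e2 w : \prod_(t <- s :: S2) \1_(B' t) (X t w) =
      \1_A (X s w) * \prod_(t <- S2) \1_(B t) (X t w) :> R.
    rewrite big_cons {1}/B' eqxx; congr (_ * _).
    by apply: eq_big_seq => t tS; rewrite B'S2.
  have := IH (s :: S2) B' mB' uS' PS'.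
  rewrite e1 mulrCA -/c EFinM fineK; last first.
    by apply: fin_num_measure; exact: measurable_preim.
  move=> IHs; rewrite /mscale /= muleC -[LHS]IHs; apply: eq_integral => w _.
  rewrite e2 mulrCA -/(g w) patchE indicE.
  have -> : (X s w \in A) = (w \in X s @^-1` A) by apply/idP/idP; rewrite !inE.
  by case: (w \in _); rewrite ?mul1r ?mul0r.
have mEf : measurable_fun setT (EFin \o f s) by exact/measurable_EFinP.
have Ef0 x : (0 <= (EFin \o f s) x)%E by rewrite lee_fin f0.
have := ge0_integral_density mXs mg g0 nuE mEf Ef0.
rewrite ge0_integral_mscale// ge0_integral_distribution//=.
under [X in (_ * X)%E]eq_integral do rewrite /=.
rewrite [X in (_ * X)%E](fm s) => hs.
transitivity (\int[P]_w ((f s (X s w))%:E * (g w)%:E))%E.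
  by apply: eq_integral => w _; rewrite big_cons -mulrA EFinM.
by rewrite -hs -EFinM big_cons -mulrA mulrC.
Qed.

Definition nn_integrable s (h : R -> R) :=
  [/\ measurable_fun setT h, forall x, 0 <= h x &
      P.-integrable setT (EFin \o (h \o X s))].

(** Signed functions are handled one variable at a time, by linearity, as
    differences of nonnegative ones: S1 lists the variables still to be treated. *)
Lemma expectation_indep f S1 S2 : uniq (S1 ++ S2) -> product_rule (S1 ++ S2) ->
  (forall s, s \in S1 -> exists a b, [/\ nn_integrable s a, nn_integrable s b &
     forall x, f s x = a x - b x]) ->
  (forall s, s \in S2 -> nn_integrable s (f s)) ->
  P.-integrable setT (EFin \o (fun w => \prod_(s <- S1 ++ S2) f s (X s w))) /\
  \int[P]_w (\prod_(s <- S1 ++ S2) f s (X s w)) =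
  \prod_(s <- S1 ++ S2) \int[P]_w f s (X s w).
Proof.
elim: S1 f S2 => [|s S1 IH] f S2 uS PS fS1 fS2.
  pose f' s := if s \in S2 then f s else cst 0.
  have f'P s : nn_integrable s (f' s).
    rewrite /f'; case: ifPn => [/fS2//|_]; split => //; exact: integrable0.
  pose m s := \int[P]_w f' s (X s w).
  have fm s : (\int[P]_w (f' s (X s w))%:E = (m s)%:E)%E.
    rewrite /m /Rintegral fineK//; apply: integrable_fin_num => //.
    by case: (f'P s).
  have h := @ge0_expectation_indep f' m (fun s => let: And3 h _ _ := f'P s in h)
    (fun s => let: And3 _ h _ := f'P s in h) fm S2 [::] (fun=> setT) (fun=> measurableT).
  rewrite cats0 in h; have {}h := h uS PS.
  have hE w : \prod_(s <- S2) f' s (X s w) * \prod_(s <- [::]) \1_setT (X s w) =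
     \prod_(s <- [::] ++ S2) f s (X s w) :> R.
    by rewrite big_nil mulr1; apply: eq_big_seq => s sS2; rewrite /f' sS2.
  have {}h : (\int[P]_w (\prod_(s <- [::] ++ S2) f s (X s w))%:E =
      (\prod_(s <- [::] ++ S2) \int[P]_w f s (X s w))%:E)%E.
    under eq_integral do rewrite -hE.
    rewrite h big_nil mulr1; congr EFin; apply: eq_big_seq => s sS2.
    by rewrite /m /f' sS2.
  split; last by rewrite /Rintegral h.
  apply/integrableP; split.
    apply/measurable_EFinP; apply: measurable_prod => s sS2.
    by have [mf _ _] := fS2 _ sS2; exact: measurableT_comp.
  under eq_integral => w _.
    rewrite /= ger0_norm; last first.
      rewrite big_seq prodr_ge0// => s sS2.
      by have [_ f0 _] := fS2 _ sS2.
    over.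
  by rewrite h ltry.
have pS : perm_eq (s :: S1 ++ S2) (S1 ++ s :: S2) by rewrite -cat1s perm_catCA.
have uS' : uniq (S1 ++ s :: S2) by rewrite -(perm_uniq pS).
have PS' := product_rule_perm pS PS.
have [sS1 sS2] : s \notin S1 /\ s \notin S2.
  by move: uS; rewrite /= mem_cat negb_or => /andP[/andP[]].
have [a [b [aP bP fab]]] := fS1 s (mem_head _ _).
pose upd (h : R -> R) t := if t == s then h else f t.
have updS h w (k : seq I) : s \notin k ->
    \prod_(t <- k) upd h t (X t w) = \prod_(t <- k) f t (X t w).
  by move=> sk; apply: eq_big_seq => t tk; rewrite /upd; case: eqVneq tk sk => // -> ->.
have key h : nn_integrable s h ->
    P.-integrable setT (EFin \o (fun w => h (X s w) * \prod_(t <- S1 ++ S2) f t (X t w))) /\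
    \int[P]_w (h (X s w) * \prod_(t <- S1 ++ S2) f t (X t w)) =
    (\int[P]_w h (X s w)) * \prod_(t <- S1 ++ S2) \int[P]_w f t (X t w).
  move=> hP.
  have sS : s \notin S1 ++ S2 by rewrite mem_cat negb_or sS1.
  have e1 w : \prod_(t <- S1 ++ s :: S2) upd h t (X t w) =
      h (X s w) * \prod_(t <- S1 ++ S2) f t (X t w).
    by rewrite -(perm_big _ pS) big_cons updS// /upd eqxx.
  have e2 : \prod_(t <- S1 ++ s :: S2) \int[P]_w upd h t (X t w) =
      (\int[P]_w h (X s w)) * \prod_(t <- S1 ++ S2) \int[P]_w f t (X t w).
    rewrite -(perm_big _ pS) big_cons {1}/upd eqxx; congr (_ * _).
    by apply: eq_big_seq => t tk; rewrite /upd; case: eqVneq tk sS => // -> ->.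
  have [||i1 i2] := IH (upd h) (s :: S2) uS' PS'.
  - move=> t tS1; have [a' [b' [? ? ?]]] := fS1 t (mem_behead (s := s :: S1) tS1).
    exists a', b'; split => // x; rewrite /upd.
    by case: eqVneq tS1 sS1 => // -> ->.
  - move=> t; rewrite inE /upd; case: eqVneq => [-> //|_ /= tS2]; exact: fS2.
  rewrite -e2 -i2; split; first by under eq_fun do rewrite -e1.
  by apply: eq_Rintegral => w _; rewrite e1.
have [ia Ea] := key _ aP; have [ib Eb] := key _ bP.
have [ma _ iA] := aP; have [mb _ iB] := bP.
have e w : \prod_(t <- (s :: S1) ++ S2) f t (X t w) =
    a (X s w) * \prod_(t <- S1 ++ S2) f t (X t w) -
    b (X s w) * \prod_(t <- S1 ++ S2) f t (X t w).
  by rewrite big_cons fab mulrBl.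
split; first by under eq_fun do rewrite e; exact: real_integrableB.
under eq_Rintegral do rewrite e.
rewrite RintegralB// Ea Eb -mulrBl -RintegralB// big_cons.
by congr (_ * _); apply: eq_Rintegral => w _; rewrite fab.
Qed.

End independence.

(** * Integration by parts for polynomials in Gaussian variables *)

Section polynomial_derivation.
Context (T : Type) (R : comPzRingType) (J K : Type).
Variables (Y : J -> T -> R) (D : K -> J -> R).

(** F is a polynomial in the variables Y j, and dF s is its image under the
    derivation that sends Y j to the constant D s j.  Being a relation between
    functions, it applies to powers and traces of random matrices without
    encoding them as formal polynomials. *)
Inductive pderiv : (T -> R) -> (K -> T -> R) -> Prop :=
| pderiv_cst c : pderiv (fun=> c) (fun _ _ => 0)
| pderiv_var j : pderiv (Y j) (fun s _ => D s j)
| pderivD F dF G dG : pderiv F dF -> pderiv G dG ->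
    pderiv (fun w => F w + G w) (fun s w => dF s w + dG s w)
| pderivM F dF G dG : pderiv F dF -> pderiv G dG ->
    pderiv (fun w => F w * G w) (fun s w => dF s w * G w + F w * dG s w).

Lemma pderiv_eq F dF G dG : pderiv F dF -> (forall w, F w = G w) ->
  (forall s w, dF s w = dG s w) -> pderiv G dG.
Proof.
move=> h FG dFG; have -> : G = F by apply/funext => w.
by have -> : dG = dF by apply/funext => s; apply/funext => w.
Qed.

Lemma pderivZ c F dF : pderiv F dF ->
  pderiv (fun w => c * F w) (fun s w => c * dF s w).
Proof.
move=> h; apply: pderiv_eq (pderivM (pderiv_cst c) h) _ _ => // s w.
by rewrite mul0r add0r.
Qed.

Lemma pderiv_sum (A : Type) (l : seq A) (F : A -> T -> R) dF :
  (forall a, pderiv (F a) (dF a)) ->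
  pderiv (fun w => \sum_(a <- l) F a w) (fun s w => \sum_(a <- l) dF a s w).
Proof.
move=> h; elim: l => [|a l IH].
  by apply: pderiv_eq (pderiv_cst 0) _ _ => [w|s w]; rewrite big_nil.
by apply: pderiv_eq (pderivD (h a) IH) _ _ => [w|s w]; rewrite big_cons.
Qed.

Lemma pderivX F dF m : pderiv F dF ->
  pderiv (fun w => F w ^+ m) (fun s w => m%:R * F w ^+ m.-1 * dF s w).
Proof.
move=> h; elim: m => [|m IH].
  by apply: pderiv_eq (pderiv_cst 1) _ _ => [w|s w]; rewrite ?expr0// !mul0r.
apply: pderiv_eq (pderivM h IH) _ _ => [w|s w]; first by rewrite exprS.
case: m IH => [|m] _; first by rewrite expr0 /=; ring.
by rewrite /= !exprS; ring.
Qed.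

End polynomial_derivation.

Section wick.
Context d (T : measurableType d) (R : realType) (P : probability T R).
Variables (I : finType) (X : I -> {RV P >-> R}) (r : I -> I) (v : I -> R).
Hypothesis X_r : forall s w, X s w = X (r s) w.
Let S := undup [seq r s | s <- enum I].
Hypothesis S_indep : product_rule X S.
Hypothesis X_int : forall s k, P.-integrable setT (EFin \o (fun w => X s w ^+ k)).
Hypothesis X_rec : forall s k,
  \int[P]_w (X s w ^+ k.+1) = v s * (k%:R * \int[P]_w (X s w ^+ k.-1)).

Let S_r s : r s \in S.
Proof. by rewrite mem_undup map_f// mem_enum. Qed.

Let uniqS : uniq S. Proof. exact: undup_uniq. Qed.

(** A power x^a is the difference of the nonnegative functions
    x^(2a) + x^a + 1 and x^(2a) + 1. *)
Lemma expectation_multipower (a : I -> nat) :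
  P.-integrable setT (EFin \o (fun w => \prod_(s <- S) X s w ^+ a s)) /\
  \int[P]_w (\prod_(s <- S) X s w ^+ a s) =
  \prod_(s <- S) \int[P]_w (X s w ^+ a s).
Proof.
have := @expectation_indep _ _ _ P _ X (fun s x => x ^+ a s) S [::].
rewrite cats0; apply => // s _.
exists (fun x => x ^+ (2 * a s) + x ^+ a s + 1), (fun x => x ^+ (2 * a s) + 1).
have mX k : measurable_fun setT (fun x : R => x ^+ k) by exact: measurable_funX.
have i1 : P.-integrable setT (EFin \o (fun=> 1 : R)).
  by have := X_int s 0; under eq_fun do rewrite expr0.
split.
- split.
  + by do 2 (apply: measurable_funD => //).
  + by move=> x; rewrite mulnC exprM; have := sqr_ge0 (x ^+ a s + 1 / 2); lra.
  + by do 2 (apply: real_integrableD => //); exact: X_int.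
- split.
  + by apply: measurable_funD.
  + by move=> x; rewrite mulnC exprM; have := sqr_ge0 (x ^+ a s); lra.
  + by apply: real_integrableD => //; exact: X_int.
- by move=> x; ring.
Qed.

Definition mono (L : seq I) w := \prod_(t <- L) X t w.

(** The covariance of X s and X t when X s depends only on the class r s and
    distinct classes are independent. *)
Definition cov s t : R := v s * (r s == r t)%:R.

(** The derivative of the monomial L, by Leibniz, for the derivation that sends
    X t to cov s t. *)
Fixpoint dmono s (L : seq I) w : R := if L is t :: L' then
  cov s t * mono L' w + X t w * dmono s L' w else 0.

Let cnt (L : seq I) p := count (fun t => r t == p) L.

Let prodS_delta (pr : pred I) t w :
  \prod_(p <- S | pr p) X p w ^+ (r t == p) = if pr (r t) then X t w else 1.
Proof.
case: ifPn => h.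
  rewrite big_mkcond (bigD1_seq (r t))//= h eqxx expr1 -X_r big1 ?mulr1// => p.
  by rewrite eq_sym => /negPf ->; rewrite expr0 if_same.
by rewrite big1// => p pp; case: eqVneq => [e|_]; rewrite ?expr0//; move: h; rewrite e pp.
Qed.

Let prodS_cons (pr : pred I) t L w :
  \prod_(p <- S | pr p) X p w ^+ cnt (t :: L) p =
  (if pr (r t) then X t w else 1) * \prod_(p <- S | pr p) X p w ^+ cnt L p.
Proof.
by rewrite -prodS_delta -big_split; apply: eq_bigr => p _; rewrite /cnt /= exprD.
Qed.

Lemma monoE L w : mono L w = \prod_(p <- S) X p w ^+ cnt L p.
Proof.
rewrite /mono; elim: L => [|t L IH].
  by rewrite big_nil big1// => p _; rewrite expr0.
by rewrite big_cons prodS_cons IH.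
Qed.

Lemma mono_integrable L : P.-integrable setT (EFin \o mono L).
Proof.
have -> : mono L = (fun w => \prod_(p <- S) X p w ^+ cnt L p).
  by apply/funext => w; exact: monoE.
by have [] := expectation_multipower (cnt L).
Qed.

Let bump_down s L p := if p == r s then (cnt L p).-1 else cnt L p.

Let prodS_split s (a : I -> nat) w : \prod_(p <- S) X p w ^+ a p =
  X s w ^+ a (r s) * \prod_(p <- S | p != r s) X p w ^+ a p.
Proof. by rewrite (bigD1_seq (r s))//= -X_r. Qed.

(** Collecting equal factors: the derivation lowers by one the exponent of the
    class of s. *)
Lemma dmonoE s L w : dmono s L w =
  v s * ((cnt L (r s))%:R * \prod_(p <- S) X p w ^+ bump_down s L p).
Proof.
have E L' : \prod_(p <- S) X p w ^+ bump_down s L' p =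
    X s w ^+ (cnt L' (r s)).-1 * \prod_(p <- S | p != r s) X p w ^+ cnt L' p.
  rewrite (prodS_split s) /bump_down eqxx; congr (_ * _).
  by apply: eq_bigr => p /negPf ->.
elim: L => [|t L IH] /=; first by rewrite mul0r mulr0.
have cE : cnt (t :: L) (r s) = ((r s == r t) + cnt L (r s))%N.
  by rewrite /cnt /= eq_sym.
rewrite IH !E monoE (prodS_split s) prodS_cons cE /cov [r t == r s]eq_sym.
case: eqVneq => [e|_] /=; last by rewrite add0n; ring.
rewrite (X_r t) -e -X_r; case: (cnt L (r s)) => [|k] /=.
  by rewrite expr0; ring.
by rewrite exprS -natr1 -[in RHS]natr1; ring.
Qed.

Lemma dmono_integrable s L : P.-integrable setT (EFin \o dmono s L).
Proof.
have -> : dmono s L = (fun w => v s * ((cnt L (r s))%:R *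
    \prod_(p <- S) X p w ^+ bump_down s L p)).
  by apply/funext => w; exact: dmonoE.
do 2 apply: real_integrableZ.
by have [] := expectation_multipower (bump_down s L).
Qed.

(** Both sides factor over the independent classes, and only the factor of the
    class of s differs; there the identity is the recursion X_rec. *)
Lemma wick s L : \int[P]_w (X s w * mono L w) = \int[P]_w dmono s L w.
Proof.
have -> : \int[P]_w (X s w * mono L w) = \int[P]_w mono (s :: L) w.
  by apply: eq_Rintegral => w _; rewrite /mono big_cons.
under eq_Rintegral do rewrite monoE.
under [RHS]eq_Rintegral do rewrite dmonoE.
have [ia Ea] := expectation_multipower (bump_down s L).
rewrite !RintegralZl//; last exact: real_integrableZ.
rewrite Ea; have [_ ->] := expectation_multipower (cnt (s :: L)).
rewrite !(bigD1_seq (r s) (S_r s) uniqS) /= /bump_down !eqxx /= add1n.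
have -> : \int[P]_w (X (r s) w ^+ (cnt L (r s)).+1) =
    v s * ((cnt L (r s))%:R * \int[P]_w (X (r s) w ^+ (cnt L (r s)).-1)).
  under eq_Rintegral do rewrite -X_r.
  by under [in RHS]eq_Rintegral do rewrite -X_r; exact: X_rec.
rewrite !mulrA; congr (_ * _); apply: eq_bigr => p /negPf pr.
by rewrite pr /= eq_sym pr.
Qed.

Lemma dmono_cat s L1 L2 w :
  dmono s (L1 ++ L2) w = dmono s L1 w * mono L2 w + mono L1 w * dmono s L2 w.
Proof.
elim: L1 => [|t L1 IH] /=; first by rewrite /mono big_nil; ring.
by rewrite IH /mono big_cat big_cons /=; ring.
Qed.

(** Monomials span the polynomials, so that linear identities such as [wick]
    extend to every F. *)
Lemma pderiv_monomials F dF : pderiv (fun j : I => X j : T -> R) cov F dF ->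
  exists l : seq (R * seq I),
    (forall w, F w = \sum_(x <- l) x.1 * mono x.2 w) /\
    (forall s w, dF s w = \sum_(x <- l) x.1 * dmono s x.2 w).
Proof.
elim=> {F dF} [c|j|F dF G dG _ [l1 [F1 F2]] _ [l2 [G1 G2]]|
   F dF G dG _ [l1 [F1 F2]] _ [l2 [G1 G2]]].
- exists [:: (c, [::])]; split => [w|s w]; rewrite big_seq1 /=.
    by rewrite /mono big_nil mulr1.
  by rewrite mulr0.
- exists [:: (1, [:: j])]; split => [w|s w]; rewrite big_seq1 /=.
    by rewrite /mono big_seq1 mul1r.
  by rewrite /mono big_nil; ring.
- exists (l1 ++ l2); split => [w|s w]; first by rewrite big_cat F1 G1.
  by rewrite big_cat F2 G2.
- exists [seq (x.1 * y.1, x.2 ++ y.2) | x <- l1, y <- l2]; split => [w|s w].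
    rewrite big_allpairs_dep /= F1 G1 mulr_suml; apply: eq_bigr => x _.
    rewrite mulr_sumr; apply: eq_bigr => y _ /=.
    by rewrite /mono big_cat /=; ring.
  rewrite big_allpairs_dep /= F1 F2 G1 G2 !mulr_suml -big_split.
  apply: eq_bigr => x _ /=; rewrite !mulr_sumr -big_split.
  by apply: eq_bigr => y _ /=; rewrite dmono_cat; ring.
Qed.

Lemma pderiv_integrable F dF : pderiv (fun j : I => X j : T -> R) cov F dF ->
  P.-integrable setT (EFin \o F).
Proof.
move=> /pderiv_monomials[l [/funext -> _]].
by apply: real_integrable_sum => x; apply: real_integrableZ; exact: mono_integrable.
Qed.

(** Gaussian integration by parts.  The index set may contain repeated variables
    (the entries of a symmetric tensor), which is why the derivation uses the
    covariances and not the partial derivatives in independent coordinates. *)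
Lemma stein F dF s : pderiv (fun j : I => X j : T -> R) cov F dF ->
  \int[P]_w (X s w * F w) = \int[P]_w dF s w.
Proof.
move=> /pderiv_monomials[l [FE dFE]].
under [RHS]eq_Rintegral do rewrite dFE.
have dm x : P.-integrable setT (EFin \o (fun w => x.1 * dmono s x.2 w)).
  by apply: real_integrableZ; exact: dmono_integrable.
have sm x : P.-integrable setT (EFin \o (fun w => X s w * mono x w)).
  have := mono_integrable (s :: x).
  by rewrite (_ : mono (s :: x) = fun w => X s w * mono x w)//; apply/funext => w; rewrite /mono big_cons.
rewrite Rintegral_sum//.
transitivity (\int[P]_w (\sum_(x <- l) x.1 * (X s w * mono x.2 w))).
  apply: eq_Rintegral => w _; rewrite FE mulr_sumr.
  by apply: eq_bigr => x _; rewrite mulrCA.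
rewrite Rintegral_sum; last by move=> x; exact: real_integrableZ.
apply: eq_bigr => x _; rewrite !RintegralZl//; last exact: dmono_integrable.
by rewrite wick.
Qed.

End wick.

(** * The contracted tensor as a Gaussian matrix *)

Section matrix_model.
Context d (T : measurableType d) (R : realType) (P : probability T R).

(** The derivative of a polynomial is again a polynomial, which makes it
    integrable. *)
Lemma pderiv_derivable (J K : Type) (Y : J -> T -> R) (D : K -> J -> R) F dF s :
  pderiv Y D F dF -> exists ddF, pderiv Y D (dF s) ddF.
Proof.
elim=> {F dF} [c|j|F dF G dG _ [ddF dF'] _ [ddG dG']|
  F dF G dG F' [ddF dF'] G' [ddG dG']].
- by exists (fun _ _ => 0); exact: pderiv_cst.
- by exists (fun _ _ => 0); exact: pderiv_cst.
- by eexists; exact: (pderivD dF' dG').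
- by eexists; exact: (pderivD (pderivM dF' G') (pderivM F' dG')).
Qed.

(** The chain rule for linear functions Z of the variables Y. *)
Lemma pderiv_chain (J K : Type) (Y : J -> T -> R) (D : K -> J -> R) (I : finType)
    (Z : I -> T -> R) (dZ : K -> I -> R) F g :
  (forall p, pderiv Y D (Z p) (fun s _ => dZ s p)) ->
  pderiv Z (fun q p => (q == p)%:R) F g ->
  pderiv Y D F (fun s w => \sum_p dZ s p * g p w).
Proof.
move=> dYZ; elim=> {F g} [c|p|F dF G dG _ iF _ iG|F dF G dG _ iF _ iG].
- by apply: pderiv_eq (pderiv_cst _ _ c) _ _ => // s w; rewrite big1// => p _; rewrite mulr0.
- apply: pderiv_eq (dYZ p) _ _ => // s w.
  rewrite (bigD1 p)//= eqxx mulr1 big1 ?addr0// => q /negPf ->.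
  by rewrite mulr0.
- apply: pderiv_eq (pderivD iF iG) _ _ => // s w.
  by rewrite -big_split; apply: eq_bigr => p _ /=; rewrite mulrDr.
- apply: pderiv_eq (pderivM iF iG) _ _ => // s w.
  rewrite mulr_suml mulr_sumr -big_split.
  by apply: eq_bigr => p _ /=; ring.
Qed.

Definition entry n (M : T -> 'M[R]_n) (p : 'I_n * 'I_n) w : R := M w p.1 p.2.

Definition grad n (M : T -> 'M[R]_n) :=
  pderiv (entry M) (fun q p => (q == p)%:R).

(** All that the moment computations need to know about the random matrix M. *)
Record gaussian_model n (u v : 'I_n -> R) (M : T -> 'M[R]_n) : Prop := {
  model_n0 : (0 < n)%N;
  model_u : dot u u = 1;
  model_v : dot v v = 1;
  model_sym : forall w, (M w)^T = M w;
  model_int : forall F g, grad M F g -> P.-integrable setT (EFin \o F);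
  model_ibp : forall F g, grad M F g -> forall i j,
    \int[P]_w (M w i j * F w) =
    \sum_a \sum_b cov_ker u v i j a b / (6 * n%:R) * \int[P]_w g (a, b) w }.

Section gote.
Variables (n : nat) (u v : 'cV[R]_n) (G : 4.-tuple 'I_n -> {RV P >-> R}).
Hypotheses (n0 : (0 < n)%N) (hu : sphere2 u) (hv : sphere2 v) (hG : GOTE4 G).

(** One index tuple per multiset: at these, the entries of G are independent. *)
Let rep (s : 4.-tuple 'I_n) : 4.-tuple 'I_n :=
  choose (fun t : 4.-tuple 'I_n => perm_eq s t) s.

Let perm_rep (s : 4.-tuple 'I_n) : perm_eq s (rep s).
Proof. by apply: (@chooseP _ (fun t : 4.-tuple 'I_n => perm_eq s t) s); exact: perm_refl. Qed.

Let rep_eq (s t : 4.-tuple 'I_n) : (rep s == rep t) = perm_eq s t.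
Proof.
apply/eqP/idP => [e|st].
  by rewrite (perm_trans (perm_rep s))// e perm_sym perm_rep.
have e : (fun x : 4.-tuple 'I_n => perm_eq s x) =1 (fun x => perm_eq t x).
  by move=> x; apply/permPl : (val x).
rewrite /rep (eq_choose e); apply: choose_id; first by rewrite perm_sym.
exact: perm_refl.
Qed.

Let rep_idem s : rep (rep s) = rep s.
Proof. by apply/eqP; rewrite rep_eq perm_sym. Qed.

Let G_rep s w : G s w = G (rep s) w.
Proof. by case: hG => + _ _; apply. Qed.

Let G_indep : product_rule G (undup [seq rep s | s <- enum {: 4.-tuple 'I_n}]).
Proof.
move=> B mB; case: hG => _ _; apply => //.
set S := undup _; have : uniq S by exact: undup_uniq.
rewrite uniq_pairwise; apply: (@sub_in_pairwise _ (mem S)); last exact/allP.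
move=> x y.
rewrite !mem_undup => /mapP[s _ ->] /mapP[t _ ->] /=.
by rewrite -rep_eq !rep_idem.
Qed.

Let var (s : 4.-tuple 'I_n) : R := 4 / (nperm s)%:R.

Let var_gt0 s : 0 < var s.
Proof.
rewrite divr_gt0// ltr0n /nperm -has_predT; apply/hasP.
by exists (val s) => //; rewrite mem_permutations.
Qed.

Let sd0 s : Num.sqrt (var s) != 0.
Proof. by rewrite gt_eqF// sqrtr_gt0. Qed.

Let G_normal s B : measurable B ->
  distribution P (G s) B = normal_prob 0 (Num.sqrt (var s)) B.
Proof. by case: hG => _ h _; exact: h. Qed.

Let G_int s k : P.-integrable setT (EFin \o (fun w => G s w ^+ k)).
Proof. exact: (@normal_moment_integrable R (Num.sqrt (var s)) (sd0 s) _ _ P (G s) (@G_normal s) k). Qed.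

Let G_rec s k : \int[P]_w (G s w ^+ k.+1) =
  var s * (k%:R * \int[P]_w (G s w ^+ k.-1)).
Proof.
by rewrite (normal_moment_rec (sd0 s) (@G_normal s)) sqr_sqrtr// ltW.
Qed.

Let uf (i : 'I_n) := u i ord0.
Let vf (i : 'I_n) := v i ord0.
Let scale : R := (Num.sqrt n%:R)^-1.
Let M w : 'M[R]_n := scale *: contract2 (fun s => G s w) u v.

Let sphere_dot (x : 'cV[R]_n) : sphere2 x -> dot (fun i => x i ord0) (fun i => x i ord0) = 1.
Proof.
move=> hx; have x0 : 0 <= \sum_i x i ord0 ^+ 2.
  by apply: sumr_ge0 => i _; exact: sqr_ge0.
rewrite -[RHS](expr1n _ 2) -[in RHS]hx /norm2 sqr_sqrtr//.
Qed.

Let ME a b w : M w a b = \sum_k \sum_l (scale * (uf k * vf l)) * G [tuple a; b; k; l] w.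
Proof.
rewrite !mxE mulr_sumr; apply: eq_bigr => k _; rewrite mulr_sumr.
by apply: eq_bigr => l _; rewrite /uf /vf; ring.
Qed.

Let cv := cov rep var.

Let dM s (p : 'I_n * 'I_n) : R :=
  \sum_k \sum_l (scale * (uf k * vf l)) * cv s [tuple p.1; p.2; k; l].

Let pderiv_M p : pderiv (fun t : 4.-tuple 'I_n => G t : T -> R) cv (entry M p)
  (fun s _ => dM s p).
Proof.
apply: pderiv_eq (pderiv_sum (index_enum _) (fun k => pderiv_sum (index_enum _) (fun l =>
  pderivZ (scale * (uf k * vf l)) (pderiv_var _ cv [tuple p.1; p.2; k; l])))) _ _.
- by move=> w; rewrite /entry ME.
- by [].
Qed.

Let chainM F g : grad M F g -> pderiv (fun t : 4.-tuple 'I_n => G t : T -> R) cv F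
  (fun s w => \sum_p dM s p * g p w).
Proof. exact: pderiv_chain pderiv_M. Qed.

Let cvE i j k l a b c d' : cv [tuple i; j; k; l] [tuple a; b; c; d'] =
  match24 R i j k l a b c d' / 6.
Proof. by rewrite -cov_match24 /cv /cov rep_eq /var /nperm. Qed.

Let sum_dM i j a b : \sum_k \sum_l (scale * (uf k * vf l)) * dM [tuple i; j; k; l] (a, b) =
  cov_ker uf vf i j a b / (6 * n%:R).
Proof.
have sc2 : scale ^+ 2 = n%:R^-1 by rewrite /scale exprVn sqr_sqrtr.
rewrite -match24_contract; [|exact: sphere_dot|exact: sphere_dot].
rewrite mulr_suml; apply: eq_bigr => k _; rewrite mulr_suml; apply: eq_bigr => l _.
rewrite /dM !mulr_sumr mulr_suml; apply: eq_bigr => c _.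
rewrite !mulr_sumr mulr_suml; apply: eq_bigr => d' _.
rewrite cvE /= invfM -sc2; ring.
Qed.

(** The entries of M are linear in those of G, so the chain rule turns [stein]
    for G into integration by parts for M; [sum_dM] identifies the covariance. *)
Lemma gote_model : gaussian_model uf vf M.
Proof.
have stM F g s : grad M F g -> \int[P]_w (G s w * F w) =
    \int[P]_w (\sum_p dM s p * g p w).
  by move=> h; exact: (stein G_rep G_indep G_int G_rec s (chainM h)).
have gint F g : grad M F g -> P.-integrable setT (EFin \o F).
  by move=> h; exact: (pderiv_integrable G_rep G_indep G_int (chainM h)).
split => //; try exact: sphere_dot.
- move=> w; apply/matrixP => i j; rewrite mxE !ME.
  apply: eq_bigr => k _; apply: eq_bigr => l _; congr (_ * _).
  case: hG => + _ _; apply; apply/permP => p /=; rewrite addnCA; done.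
move=> F g h i j.
have igM p : P.-integrable setT (EFin \o g p).
  by have [dg hg] := pderiv_derivable p h; exact: gint hg.
have iGF s : P.-integrable setT (EFin \o (fun w => G s w * F w)).
  exact: (pderiv_integrable G_rep G_indep G_int
    (pderivM (pderiv_var _ cv s) (chainM h))).
transitivity (\sum_k \sum_l (scale * (uf k * vf l)) *
    \int[P]_w (G [tuple i; j; k; l] w * F w)).
  have iZ k l : P.-integrable setT (EFin \o (fun w =>
      (scale * (uf k * vf l)) * (G [tuple i; j; k; l] w * F w))).
    exact: real_integrableZ.
  transitivity (\int[P]_w (\sum_k \sum_l
      (scale * (uf k * vf l)) * (G [tuple i; j; k; l] w * F w))).
    apply: eq_Rintegral => w _; rewrite ME mulr_suml; apply: eq_bigr => k _.
    by rewrite mulr_suml; apply: eq_bigr => l _; rewrite -mulrA.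
  rewrite Rintegral_sum; last by move=> k; exact: real_integrable_sum.
  apply: eq_bigr => k _; rewrite Rintegral_sum//.
  by apply: eq_bigr => l _; rewrite RintegralZl.
transitivity (\sum_k \sum_l (scale * (uf k * vf l)) *
    \sum_a \sum_b dM [tuple i; j; k; l] (a, b) * \int[P]_w g (a, b) w).
  apply: eq_bigr => k _; apply: eq_bigr => l _; congr (_ * _).
  rewrite (stM _ _ _ h) Rintegral_sum; last by move=> p; exact: real_integrableZ.
  rewrite pair_bigA /=; apply: eq_bigr => -[a b] _.
  by rewrite RintegralZl.
transitivity (\sum_a \sum_b (\sum_k \sum_l (scale * (uf k * vf l)) *
    dM [tuple i; j; k; l] (a, b)) * \int[P]_w g (a, b) w).
  under [RHS]eq_bigr do (under eq_bigr do (rewrite mulr_suml; under eq_bigr do rewrite mulr_suml)).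
  under [RHS]eq_bigr do rewrite exchange_big /=.
  rewrite [RHS]exchange_big /=; apply: eq_bigr => k _.
  under [RHS]eq_bigr do rewrite exchange_big /=.
  rewrite [RHS]exchange_big /=; apply: eq_bigr => l _.
  rewrite mulr_sumr; apply: eq_bigr => a _; rewrite mulr_sumr.
  by apply: eq_bigr => b _; rewrite mulrA.
by apply: eq_bigr => a _; apply: eq_bigr => b _; rewrite sum_dM.
Qed.

End gote.
End matrix_model.

(** * The Schwinger-Dyson equation *)

Section schwinger_dyson.
Context d (T : measurableType d) (R : realType) (P : probability T R).
Variables (n : nat) (u v : 'I_n -> R) (M : T -> 'M[R]_n).

(** The derivative of a power of M in the entry (a,b) is the sum of
    M^p E_ab M^q over p + q = k - 1. *)
Lemma grad_exp k i j : grad M (fun w => (M w ^+ k) i j)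
  (fun q w => \sum_(p < k) (M w ^+ p) i q.1 * (M w ^+ (k - 1 - p)) q.2 j).
Proof.
elim: k i j => [|k IH] i j.
  apply: pderiv_eq (pderiv_cst _ _ ((1%:M : 'M[R]_n) i j)) _ _ => [w|q w].
    by rewrite expr0.
  by rewrite big_ord0.
have := pderiv_sum (index_enum 'I_n) (fun l => pderivM (pderiv_var (entry M) _ (i, l)) (IH l j)).
move=> /pderiv_eq; apply => [w|[a b] w] /=.
  by rewrite exprS -mulmxE mxE.
rewrite big_split /= big_ord_recl expr0; congr (_ + _).
  rewrite subn1 subn0 /= (bigD1 b)//= xpair_eqE eqxx andbT big1 ?addr0.
    by rewrite mxE eq_sym.
  by move=> l lb; rewrite xpair_eqE [b == l]eq_sym (negPf lb) andbF mul0r.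
under eq_bigr do rewrite mulr_sumr.
rewrite exchange_big; apply: eq_bigr => p _ /=.
rewrite exprS -mulmxE mxE mulr_suml; apply: eq_bigr => l _.
rewrite /entry /= mulrA; suff -> : (k.+1 - 1 - bump 0 p = k - 1 - p)%N by [].
by rewrite /bump /=; lia.
Qed.

Definition tmom k w : R := n%:R^-1 * \tr (M w ^+ k).

Lemma grad_tmom k : grad M (tmom k)
  (fun q w => n%:R^-1 * (k%:R * (M w ^+ k.-1) q.2 q.1)).
Proof.
have := pderivZ n%:R^-1 (pderiv_sum (index_enum 'I_n) (fun i => grad_exp k i i)).
move=> /pderiv_eq; apply => // -[a b] w; congr (_ * _) => /=.
rewrite exchange_big /= (eq_bigr (fun=> (M w ^+ k.-1) b a)).
  by rewrite sumr_const card_ord mulr_natl.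
move=> p _; have -> : k.-1 = (k - 1 - p + p)%N by case: k p => [[]//|k] [p pk] /=; lia.
by rewrite exprD -mulmxE mxE; apply: eq_bigr => i _; rewrite mulrC.
Qed.

Local Notation K := (cov_ker u v).

(** What remains of t_(k+1) = n^-1 tr (M M^k) when the factor M is integrated by
    parts. *)
Definition sd_drift k w : R := (6 * n%:R ^+ 2)^-1 *
  \sum_(p < k) contr K (M w ^+ p) (M w ^+ (k - 1 - p)).

(** Pairs M^k with the gradient of t_(k+1), which is (k+1) / n times M^k; it
    arises when the derivative hits the factor Y^m in [schwinger_dyson]. *)
Definition sd_quad k w : R := (6 * n%:R ^+ 3)^-1 *
  \sum_i \sum_j \sum_a \sum_b K i j a b * ((M w ^+ k) i j * (M w ^+ k) a b).

(** The random variables for which [gaussian_model] provides integrability. *)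
Definition polyrv (F : T -> R) := exists g, grad M F g.

Lemma polyrvD F G : polyrv F -> polyrv G -> polyrv (fun w => F w + G w).
Proof. by move=> [f hf] [g hg]; eexists; exact: pderivD hf hg. Qed.

Lemma polyrvM F G : polyrv F -> polyrv G -> polyrv (fun w => F w * G w).
Proof. by move=> [f hf] [g hg]; eexists; exact: pderivM hf hg. Qed.

Lemma polyrv_cst c : polyrv (fun=> c).
Proof. by eexists; exact: pderiv_cst. Qed.

Lemma polyrvX F m : polyrv F -> polyrv (fun w => F w ^+ m).
Proof. by move=> [f hf]; eexists; exact: pderivX hf. Qed.

Lemma polyrv_sum (A : Type) (l : seq A) (F : A -> T -> R) :
  (forall a, polyrv (F a)) -> polyrv (fun w => \sum_(a <- l) F a w).
Proof.
move=> h; have [g hg] := choice h.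
by eexists; exact: pderiv_sum hg.
Qed.

Lemma polyrv_exp k i j : polyrv (fun w => (M w ^+ k) i j).
Proof. by eexists; exact: grad_exp. Qed.

Lemma polyrv_tmom k : polyrv (tmom k).
Proof. by eexists; exact: grad_tmom. Qed.

Lemma polyrv_drift k : polyrv (sd_drift k).
Proof.
apply: polyrvM; first exact: polyrv_cst.
do 5 (apply: polyrv_sum => ?).
by apply: polyrvM; [exact: polyrv_cst|apply: polyrvM; exact: polyrv_exp].
Qed.

Lemma polyrv_quad k : polyrv (sd_quad k).
Proof.
apply: polyrvM; first exact: polyrv_cst.
do 4 (apply: polyrv_sum => ?).
by apply: polyrvM; [exact: polyrv_cst|apply: polyrvM; exact: polyrv_exp].
Qed.

Hypothesis mod : gaussian_model P u v M.
Let n0 := model_n0 mod.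
Let nR0 : n%:R != 0 :> R. Proof. by rewrite pnatr_eq0 -lt0n. Qed.
Local Notation E := (fun F : T -> R => \int[P]_w F w).

Lemma polyrv_int F : polyrv F -> P.-integrable setT (EFin \o F).
Proof. by move=> [g hg]; exact: (model_int mod hg). Qed.

(** Integration by parts of the factor M in t_(k+1) = n^-1 tr (M M^k), against
    (M^k)_ji Y^m.  The derivative of (M^k)_ji gives the drift, that of Y^m the
    quadratic term. *)
Lemma schwinger_dyson k (c : R) m : let Y w := tmom k.+1 w - c in
  E (fun w => Y w ^+ m.+1) =
  E (fun w => (sd_drift k w - c) * Y w ^+ m +
              m%:R * Y w ^+ m.-1 * (k.+1%:R * sd_quad k w)).
Proof.
move=> Y.
pose gY (q : 'I_n * 'I_n) w := n%:R^-1 * (k.+1%:R * (M w ^+ k) q.2 q.1).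
have hY : grad M Y gY.
  apply: pderiv_eq (pderivD (grad_tmom k.+1) (pderiv_cst _ _ (- c))) _ _ => // q w.
  by rewrite addr0.
have hQ := pderivX m hY.
set gQ := (fun s w => _ * gY s w) in hQ.
have ibp i j := model_ibp mod (pderivM (grad_exp k j i) hQ) i j.
have pY : polyrv Y by exists gY.
have pQ m' : polyrv (fun w => Y w ^+ m') by exact: polyrvX.
have pij i j : polyrv (fun w => M w i j * ((M w ^+ k) j i * Y w ^+ m)).
  apply: polyrvM; last by apply: polyrvM => //; exact: polyrv_exp.
  by have := polyrv_exp 1 i j; under eq_fun do rewrite expr1.
pose G i j a b w := (\sum_(p < k) (M w ^+ p) j a * (M w ^+ (k - 1 - p)) b i) * Y w ^+ m +
   (M w ^+ k) j i * gQ (a, b) w.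
have pG i j a b : polyrv (G i j a b).
  apply: polyrvD; apply: polyrvM => //; last 1 first.
  - rewrite /gQ; apply: polyrvM; first by apply: polyrvM => //; exact: polyrv_cst.
    by do 2 (apply: polyrvM; first exact: polyrv_cst); exact: polyrv_exp.
  - by apply: polyrv_sum => p; apply: polyrvM; exact: polyrv_exp.
  - exact: polyrv_exp.
have trE : E (fun w => tmom k.+1 w * Y w ^+ m) =
    n%:R^-1 * \sum_i \sum_j \sum_a \sum_b K i j a b / (6 * n%:R) * E (G i j a b).
  transitivity (E (fun w => n%:R^-1 * \sum_i \sum_j M w i j * ((M w ^+ k) j i * Y w ^+ m))).
    apply: eq_Rintegral => w _; rewrite /tmom -mulrA; congr (_ * _).
    rewrite /mxtrace mulr_suml; apply: eq_bigr => i _.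
    rewrite exprS -mulmxE mxE mulr_suml; apply: eq_bigr => j _.
    by rewrite mulrA.
  rewrite RintegralZl//; last first.
    by apply: polyrv_int; do 2 (apply: polyrv_sum => ?).
  rewrite Rintegral_sum; last by move=> i; apply: polyrv_int; apply: polyrv_sum.
  congr (_ * _); apply: eq_bigr => i _.
  rewrite Rintegral_sum; last by move=> j; apply: polyrv_int.
  by apply: eq_bigr => j _; rewrite ibp.
have expsym w x y : (M w ^+ k) x y = (M w ^+ k) y x.
  suff e : (M w ^+ k)^T = M w ^+ k by rewrite -[in LHS]e mxE.
  elim: (k) => [|k' IH]; first by rewrite expr0 trmx1.
  by rewrite {1}exprS -mulmxE trmx_mul IH (model_sym mod) mulmxE -exprSr.
have GE w : n%:R^-1 * (\sum_i \sum_j \sum_a \sum_b K i j a b / (6 * n%:R) * G i j a b w) =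
    sd_drift k w * Y w ^+ m + m%:R * Y w ^+ m.-1 * (k.+1%:R * sd_quad k w).
  have -> : sd_drift k w = \sum_i \sum_j \sum_a \sum_b (6 * n%:R ^+ 2)^-1 *
      (K i j a b * \sum_(p < k) (M w ^+ p) j a * (M w ^+ (k - 1 - p)) b i).
    rewrite /sd_drift /contr mulr_sumr.
    under eq_bigr do rewrite mulr_sumr.
    rewrite exchange_big; apply: eq_bigr => i _ /=.
    under eq_bigr do rewrite mulr_sumr.
    rewrite exchange_big; apply: eq_bigr => j _ /=.
    under eq_bigr do rewrite mulr_sumr.
    rewrite exchange_big; apply: eq_bigr => a _ /=.
    under eq_bigr do rewrite mulr_sumr.
    rewrite exchange_big; apply: eq_bigr => b _ /=.
    by rewrite !mulr_sumr.
  rewrite /sd_quad mulr_sumr mulr_suml [in X in _ + X]mulr_sumr mulr_sumr mulr_sumr -big_split.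
  apply: eq_bigr => i _ /=.
  rewrite mulr_sumr mulr_suml [in X in _ + X]mulr_sumr mulr_sumr mulr_sumr -big_split.
  apply: eq_bigr => j _ /=.
  rewrite mulr_sumr mulr_suml [in X in _ + X]mulr_sumr mulr_sumr mulr_sumr -big_split.
  apply: eq_bigr => a _ /=.
  rewrite mulr_sumr mulr_suml [in X in _ + X]mulr_sumr mulr_sumr mulr_sumr -big_split.
  apply: eq_bigr => b _ /=.
  rewrite /G /gQ /gY /= [(M w ^+ k) j i]expsym [(M w ^+ k) b a]expsym.
  set S := \sum_(p < k) _; field; exact: nR0.
have E1 : E (fun w => tmom k.+1 w * Y w ^+ m) =
    E (fun w => sd_drift k w * Y w ^+ m + m%:R * Y w ^+ m.-1 * (k.+1%:R * sd_quad k w)).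
  have pc i j a b : polyrv (fun w => K i j a b / (6 * n%:R) * G i j a b w).
    by apply: polyrvM => //; exact: polyrv_cst.
  under [RHS]eq_Rintegral do rewrite -GE.
  rewrite trE RintegralZl//; last by apply: polyrv_int; do 4 (apply: polyrv_sum => ?).
  congr (_ * _); rewrite Rintegral_sum; last first.
    by move=> i; apply: polyrv_int; do 3 (apply: polyrv_sum => ?).
  apply: eq_bigr => i _; rewrite Rintegral_sum; last first.
    by move=> j; apply: polyrv_int; do 2 (apply: polyrv_sum => ?).
  apply: eq_bigr => j _; rewrite Rintegral_sum; last first.
    by move=> a; apply: polyrv_int; apply: polyrv_sum.
  apply: eq_bigr => a _; rewrite Rintegral_sum; last by move=> b; apply: polyrv_int.
  by apply: eq_bigr => b _; rewrite RintegralZl//; apply: polyrv_int.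
have ptY : polyrv (fun w => tmom k.+1 w * Y w ^+ m).
  by apply: polyrvM => //; exact: polyrv_tmom.
have pcY : polyrv (fun w => c * Y w ^+ m) by apply: polyrvM => //; exact: polyrv_cst.
have pR : polyrv (fun w => sd_drift k w * Y w ^+ m + m%:R * Y w ^+ m.-1 * (k.+1%:R * sd_quad k w)).
  apply: polyrvD; first by apply: polyrvM => //; exact: polyrv_drift.
  apply: polyrvM; apply: polyrvM => //; try exact: polyrv_cst.
  exact: polyrv_quad.
transitivity (E (fun w => tmom k.+1 w * Y w ^+ m - c * Y w ^+ m)).
  by apply: eq_Rintegral => w _; rewrite exprS /Y mulrBl.
rewrite RintegralB//; try exact: polyrv_int.
rewrite E1 -RintegralB//; try exact: polyrv_int.
by apply: eq_Rintegral => w _; ring.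
Qed.

End schwinger_dyson.

(** * Bounds on the terms of the Schwinger-Dyson equation *)

Section elementary_inequalities.
Variable R : realType.

(** According to whether x <= e y, one of the two terms dominates. *)
Lemma young (x y e : R) m : 0 <= x -> 0 <= y -> 0 < e ->
  x * y ^+ m <= e * y ^+ m.+1 + e^-1 ^+ m * x ^+ m.+1.
Proof.
move=> x0 y0 e0; have ei0 : 0 <= e^-1 by rewrite invr_ge0 ltW.
case: (leP x (e * y)) => h.
  rewrite (@le_trans _ _ (e * y ^+ m.+1))//.
    by rewrite exprS mulrA ler_wpM2r// exprn_ge0.
  by rewrite lerDl mulr_ge0 ?exprn_ge0.
rewrite (@le_trans _ _ (e^-1 ^+ m * x ^+ m.+1))//.
  rewrite exprS mulrCA -exprMn ler_wpM2l// lerXn2r ?nnegrE ?mulr_ge0//.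
  by rewrite ler_pdivlMl// ltW.
by rewrite lerDr mulr_ge0 ?exprn_ge0// ltW.
Qed.

Lemma exprD_le (x y : R) m : 0 <= x -> 0 <= y ->
  (x + y) ^+ m <= 2 ^+ m * (x ^+ m + y ^+ m).
Proof.
move=> x0 y0; have [xm ym] : 0 <= x ^+ m /\ 0 <= y ^+ m by rewrite !exprn_ge0.
case: (leP x y) => h.
  rewrite (@le_trans _ _ ((2 * y) ^+ m))//.
    by rewrite lerXn2r ?nnegrE ?addr_ge0 ?mulr_ge0//; lra.
  by rewrite exprMn ler_wpM2l ?exprn_ge0// lerDr.
rewrite (@le_trans _ _ ((2 * x) ^+ m))//.
  by rewrite lerXn2r ?nnegrE ?addr_ge0 ?mulr_ge0//; lra.
by rewrite exprMn ler_wpM2l ?exprn_ge0// lerDl.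
Qed.

Lemma expr_sum_le k (g : 'I_k -> R) m : (forall i, 0 <= g i) ->
  (\sum_i g i) ^+ m.+1 <= (2 ^+ m.+1) ^+ k * \sum_i g i ^+ m.+1.
Proof.
elim: k g => [|k IH] g g0; first by rewrite !big_ord0 expr0n mulr0.
rewrite !big_ord_recl /= (le_trans (exprD_le _ _ _))//; first exact: sumr_ge0.
rewrite (exprS (2 ^+ m.+1) k) -mulrA ler_wpM2l ?exprn_ge0// mulrDr lerD//; last exact: IH.
rewrite ler_peMl ?exprn_ge0//; do 2 apply: exprn_ege1; lra.
Qed.

End elementary_inequalities.

Section pointwise_bounds.
Context d (T : measurableType d) (R : realType) (P : probability T R).
Variables (n : nat) (u v : 'I_n -> R) (M : T -> 'M[R]_n).
Hypothesis mod : gaussian_model P u v M.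
Let n0 := model_n0 mod.
Let nR0 : 0 < n%:R :> R. Proof. by rewrite ltr0n. Qed.
Let Msym := model_sym mod.
Local Notation t := (tmom M).

Let trE k w : \tr (M w ^+ k) = n%:R * t k w.
Proof. by rewrite /tmom mulVKf// gt_eqF. Qed.

Lemma tmom_ge0 k w : ~~ odd k -> 0 <= t k w.
Proof. by move=> ek; rewrite mulr_ge0 ?invr_ge0 ?ler0n//; exact: trace_even_ge0. Qed.

Lemma tmom_mul_le p q w : ~~ odd (p + q) -> `|t p w * t q w| <= 2 * t (p + q) w.
Proof.
move=> epq; have := trace_mul_le (Msym w) epq.
rewrite !trE; move: (t p w) (t q w) (t (p + q) w) => a b c h.
rewrite -(@ler_pM2l _ (n%:R ^+ 2)) ?exprn_gt0//.
have e1 : n%:R ^+ 2 * `|a * b| = `|n%:R * a * (n%:R * b)|.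
  by rewrite !normrM !(gtr0_norm nR0); ring.
by rewrite e1 (le_trans h)// le_eqVlt; apply/orP; left; apply/eqP; ring.
Qed.

Lemma tmomD_le p q w : ~~ odd p -> ~~ odd q -> t (p + q) w <= n%:R * (t p w * t q w).
Proof.
move=> ep eq; have := traceD_le (Msym w) ep eq; rewrite !trE -mulrA ler_pM2l//.
by move=> h; rewrite mulrCA.
Qed.

Lemma tmom0 w : t 0 w = 1.
Proof. by rewrite /tmom expr0 mxtrace1 mulVf// gt_eqF. Qed.

(** The variance of the semicircle law close to the spectrum of M. *)
Definition var_scale : R := (1 + dot u v ^+ 2) / 6.

Lemma var_scale_bounds : 0 <= var_scale <= 3^-1.
Proof.
have [h1 h2] := one_c2 (model_u mod) (model_v mod).
by rewrite /var_scale; apply/andP; split; lra.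
Qed.

(** The size of sqrt n |M^p| |M^q| relative to n^2, where |.| is the Frobenius
    norm: this is what [contr_cov_ker_le] loses. *)
Definition sqrt_err p q w := Num.sqrt (n%:R^-1 * (t (p + p) w * t (q + q) w)).

Lemma sqrt_err_ge0 p q w : 0 <= sqrt_err p q w. Proof. exact: sqrtr_ge0. Qed.

Let even2 p : ~~ odd (p + p). Proof. by rewrite addnn odd_double. Qed.

Lemma sqr_sqrt_err p q w :
  sqrt_err p q w ^+ 2 = n%:R^-1 * (t (p + p) w * t (q + q) w).
Proof.
by rewrite sqr_sqrtr//; apply: mulr_ge0; rewrite ?invr_ge0 ?ler0n//; apply: mulr_ge0; exact: tmom_ge0.
Qed.

Let fro2 p w : fro (M w ^+ p) ^+ 2 = n%:R * t (p + p) w.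
Proof. by rewrite fro_sym_exp// trE. Qed.

Let sqrt_errE p q w : Num.sqrt n%:R * (fro (M w ^+ p) * fro (M w ^+ q)) =
  n%:R ^+ 2 * sqrt_err p q w.
Proof.
apply/eqP; rewrite -(@eqrXn2 _ 2)//; last 2 first.
- by rewrite !mulr_ge0 ?fro_ge0 ?sqrtr_ge0.
- by rewrite mulr_ge0 ?sqrtr_ge0 ?exprn_ge0.
by rewrite !exprMn sqr_sqrt_err !fro2 sqr_sqrtr//; apply/eqP; field; rewrite gt_eqF.
Qed.

Lemma sd_drift_le k w :
  `|sd_drift u v M k w - var_scale * \sum_(p < k) t p w * t (k - 1 - p) w| <=
  4 * \sum_(p < k) sqrt_err p (k - 1 - p) w.
Proof.
rewrite /sd_drift !mulr_sumr -sumrB (le_trans (ler_norm_sum _ _ _))//.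
apply: ler_sum => p _; set q := (k - 1 - p)%N.
have := contr_cov_ker_le (model_u mod) (model_v mod) n0 (M w ^+ p) (M w ^+ q).
rewrite sqrt_errE !trE => h.
have -> : (6 * n%:R ^+ 2)^-1 * contr (cov_ker u v) (M w ^+ p) (M w ^+ q) -
    var_scale * (t p w * t q w) = (6 * n%:R ^+ 2)^-1 *
    (contr (cov_ker u v) (M w ^+ p) (M w ^+ q) -
       (1 + dot u v ^+ 2) * (n%:R * t p w * (n%:R * t q w))).
  by rewrite /var_scale; field; rewrite gt_eqF.
have n20 : 0 < n%:R ^+ 2 :> R by rewrite exprn_gt0.
rewrite normrM gtr0_norm ?invr_gt0 ?mulr_gt0// ler_pdivrMl ?mulr_gt0//.
rewrite (le_trans h)//.
have := mulr_ge0 (ltW n20) (sqrt_err_ge0 p q w); lra.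
Qed.

Lemma sd_quad_le k w : `|sd_quad u v M k w| <= 4 * n%:R^-1 ^+ 2 * t (k + k) w.
Proof.
have As : (M w ^+ k)^T = M w ^+ k.
  elim: k => [|k IH]; first by rewrite expr0 trmx1.
  by rewrite {1}exprS -mulmxE trmx_mul IH Msym mulmxE -exprSr.
have := quad_cov_ker_le (model_u mod) (model_v mod) As.
rewrite -expr2 fro2 => h.
have n30 : 0 < n%:R ^+ 3 :> R by rewrite exprn_gt0.
rewrite /sd_quad normrM gtr0_norm ?invr_gt0 ?mulr_gt0// ler_pdivrMl ?mulr_gt0//.
rewrite (le_trans h)// le_eqVlt; apply/orP; left; apply/eqP; field.
by rewrite gt_eqF.
Qed.

(** t_2p t_2q <= 2 t_(2(p+q)) <= 2 n t_(p+q)^2, and the factor n cancels the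
    one in the definition of the error. *)
Lemma sqrt_err_le p q w : ~~ odd (p + q) -> sqrt_err p q w <= 2 * t (p + q) w.
Proof.
move=> epq; have t0 := tmom_ge0 w epq.
have t20 : 0 <= 2 * t (p + q) w by rewrite pmulr_rge0.
rewrite -(@ler_pXn2r _ 2)// ?nnegrE ?sqrt_err_ge0 ?t20//.
rewrite sqr_sqrt_err ler_pdivrMl//.
have e1 : (p + p + (q + q))%N = (p + q + (p + q))%N by lia.
have epp : ~~ odd (p + p + (q + q)) by rewrite e1 even2.
rewrite (le_trans (ler_norm _))// (le_trans (tmom_mul_le _ epp))//.
have := tmomD_le w epq epq; rewrite e1 exprMn expr2.
have := mulr_ge0 (ltW nR0) (mulr_ge0 t0 t0); lra.
Qed.

(** For an odd index all products t_p t_q have p + q = 2k even, so that they and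
    the errors are bounded by t_2k.  This starts the induction before any
    concentration is known. *)
Lemma sd_drift_apriori k w : `|sd_drift u v M k.*2.+1 w| <=
  10 * k.*2.+1%:R * t k.*2 w.
Proof.
have h := sd_drift_le k.*2.+1 w.
have epq (p : 'I_k.*2.+1) : (p + (k.*2.+1 - 1 - p) = k.*2)%N.
  by case: p => p /= pk; lia.
have h1 : `|\sum_(p < k.*2.+1) t p w * t (k.*2.+1 - 1 - p) w| <=
    k.*2.+1%:R * (2 * t k.*2 w).
  rewrite (le_trans (ler_norm_sum _ _ _))//.
  rewrite (@le_trans _ _ (\sum_(p < k.*2.+1) 2 * t k.*2 w))//.
    apply: ler_sum => p _; have := @tmom_mul_le p (k.*2.+1 - 1 - p) w.
    by rewrite epq odd_double; apply.
  by rewrite sumr_const card_ord -[leLHS]mulr_natl.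
have h2 : \sum_(p < k.*2.+1) sqrt_err p (k.*2.+1 - 1 - p) w <=
    k.*2.+1%:R * (2 * t k.*2 w).
  rewrite (@le_trans _ _ (\sum_(p < k.*2.+1) 2 * t k.*2 w))//.
    apply: ler_sum => p _; have := @sqrt_err_le p (k.*2.+1 - 1 - p) w.
    by rewrite epq odd_double; apply.
  by rewrite sumr_const card_ord -[leLHS]mulr_natl.
have /andP[s0 s3] := var_scale_bounds.
set D := sd_drift _ _ _ _ _ in h *; set S := \sum_(p < k.*2.+1) t p w * t (k.*2.+1 - 1 - p) w in h h1.
have h3 : `|var_scale * S| <= k.*2.+1%:R * (2 * t k.*2 w).
  by rewrite normrM (ger0_norm s0); apply: (le_trans _ h1); apply: ler_piMl => //; lra.
rewrite -[D](subrK (var_scale * S)) (le_trans (ler_normD _ _))//.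
rewrite (le_trans (lerD h h3))//; lra.
Qed.

End pointwise_bounds.

(** * The recursion of the semicircle moments *)

Section semicircle_moments.
Variable R : realFieldType.
Variable s : R.

(** Moments of the semicircle law of variance s: the even ones are Catalan
    numbers times powers of s.  The two-step recursion is the one that comes
    from integration by parts against the density. *)
Fixpoint scmom k : R := match k with
  | 0 => 1 | 1 => 0
  | k'.+2 => 4 * s * k'.+1%:R / k'.+4%:R * scmom k'
  end.

Arguments scmom : simpl never.

Lemma scmom0 : scmom 0 = 1. Proof. by []. Qed.
Lemma scmom1 : scmom 1 = 0. Proof. by []. Qed.
Lemma scmomSS k : scmom k.+2 = 4 * s * k.+1%:R / k.+4%:R * scmom k.
Proof. by []. Qed.

Let conv K := \sum_(p < K.+1) scmom p * scmom (K - p).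

(** By the symmetry p <-> K - p, the weight p averages to K / 2. *)
Let conv_weight (a : R) K :
  \sum_(p < K.+1) (p%:R + a) * (scmom p * scmom (K - p)) = (K%:R / 2 + a) * conv K.
Proof.
set L := LHS.
have L2 : L = \sum_(p < K.+1) ((K - p)%:R + a) * (scmom p * scmom (K - p)).
  rewrite /L (reindex_inj rev_ord_inj) /=; apply: eq_bigr => p _.
  have pK : (p <= K)%N by rewrite -ltnS ltn_ord.
  by rewrite subSS subKn// [scmom p * _]mulrC.
have : L + L = (K%:R + a + a) * conv K.
  rewrite {1}/L L2 -big_split mulr_sumr; apply: eq_bigr => p _ /=.
  have pK : (p <= K)%N by rewrite -ltnS ltn_ord.
  by rewrite natrB//; ring.
move=> h; lra.
Qed.

(** The Catalan recursion.  Weighting the convolution by p + 2 turns the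
    two-step recursion of the first factor into the preceding convolution,
    weighted by p + 1; [conv_weight] removes both weights. *)
Lemma scmom_conv k :
  scmom k.+2 = s * \sum_(p < k.+1) scmom p * scmom (k - p).
Proof.
rewrite -/(conv k).
suff [] : scmom k.+2 = s * conv k /\ scmom k.+3 = s * conv k.+1 by [].
elim: k => [|k [IH1 IH2]].
  split; first by rewrite /conv big_ord1 scmomSS /= scmom0; field.
  rewrite /conv big_ord_recl big_ord1 scmomSS /= subn0.
  by rewrite -[bump 0 0]/1%N scmom0 scmom1; ring.
split=> //; have := conv_weight 2 k.+2.
rewrite big_ord_recl big_ord_recl /= subn0 -[bump 0 0]/1%N scmom0 scmom1.
rewrite (eq_bigr (fun p : 'I_k.+1 => 4 * s * ((p%:R + 1) * (scmom p * scmom (k - p))))); last first.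
  move=> p _; rewrite /bump /= !add1n !subSS scmomSS.
  have p4 : p.+4%:R != 0 :> R by rewrite pnatr_eq0.
  have -> : p.+2%:R + 2 = p.+4%:R :> R by rewrite -natrD addn2.
  have -> : p%:R + 1 = p.+1%:R :> R by rewrite natr1.
  by field; rewrite -natrD pnatr_eq0.
rewrite -mulr_sumr conv_weight => h.
have e : (k.+2%:R / 2 + 2) * conv k.+2 = 2 * (k.+3%:R * scmom k.+2).
  by rewrite -h IH1; field.
have k6 : 6 + k%:R != 0 :> R by rewrite -natrD pnatr_eq0.
have -> : conv k.+2 = 4 * k.+3%:R / k.+2.+4%:R * scmom k.+2.
  apply: (mulfI (_ : k.+2%:R / 2 + 2 != 0)); last by rewrite e; field.
  by apply: contra_neq k6 => h0; rewrite -(mulr0 2) -h0; field.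
by rewrite scmomSS; field.
Qed.

Lemma scmom_rec k : scmom k.+1 = s * \sum_(p < k) scmom p * scmom (k - 1 - p).
Proof.
case: k => [|k]; first by rewrite big_ord0 mulr0 scmom1.
by rewrite scmom_conv subn1.
Qed.

Lemma scmom_bounds k : 0 <= s <= 1 -> 0 <= scmom k <= 4 ^+ k.
Proof.
move=> /andP[s0 s1]; suff [] : 0 <= scmom k <= 4 ^+ k /\ 0 <= scmom k.+1 <= 4 ^+ k.+1 by [].
elim: k => [|k [IH1 IH2]].
  by rewrite scmom0 scmom1 expr0 expr1 !lexx ler01 ler0n.
split=> //; rewrite scmomSS; case/andP: IH1 => h0 h1.
have k4 : 0 < k.+4%:R :> R by rewrite ltr0n.
have r1 : k.+1%:R / k.+4%:R <= 1 :> R by rewrite ler_pdivrMr// mul1r ler_nat; lia.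
have r0 : 0 <= k.+1%:R / k.+4%:R :> R by rewrite divr_ge0.
apply/andP; split; first by do ?apply: mulr_ge0 => //; rewrite ?invr_ge0.
rewrite -!mulrA !exprS; apply: ler_pM => //.
  by do ?apply: mulr_ge0 => //; rewrite ?invr_ge0.
apply: le_trans (_ : 1 * (1 * 4 ^+ k) <= _); last first.
  by rewrite !mul1r ler_peMl ?exprn_ge0//; lra.
apply: ler_pM => //; first by do ?apply: mulr_ge0 => //; rewrite ?invr_ge0.
by rewrite mulrA; apply: ler_pM.
Qed.

End semicircle_moments.

(** * Concentration of the spectral moments *)

Section uniform_bounds.
Context d (T : measurableType d) (R : realType) (P : probability T R).

(** Quantifying over all dimensions, vectors and matrices at once makes the
    constants in [bigO] uniform. *)
Record model := Model {
  md_n : nat; md_u : 'I_md_n -> R; md_v : 'I_md_n -> R; md_M : T -> 'M[R]_md_n;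
  md_P : gaussian_model P md_u md_v md_M }.

Implicit Types (F G : model -> T -> R) (x : model).

(** One-sided: it is used for nonnegative F. *)
Definition bigO e F := exists D, forall x,
  \int[P]_w F x w <= D * (md_n x)%:R^-1 ^+ e.

Definition polyfam F := forall x, polyrv (@md_M x) (F x).

Let pint F x : polyfam F -> P.-integrable setT (EFin \o F x).
Proof. by move=> pF; exact: (polyrv_int (md_P x) (pF x)). Qed.

Let nV0 x : 0 < (md_n x)%:R^-1 :> R.
Proof. by rewrite invr_gt0 ltr0n (model_n0 (md_P x)). Qed.

Let nV1 x : (md_n x)%:R^-1 <= 1 :> R.
Proof. by rewrite invf_le1 ?ltr0n ?ler1n (model_n0 (md_P x)). Qed.

Lemma bigO_ge0 e F : bigO e F -> exists2 D, 0 <= D & forall x,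
  \int[P]_w F x w <= D * (md_n x)%:R^-1 ^+ e.
Proof.
move=> [D hD]; exists `|D| => // x; apply: (le_trans (hD x)).
by rewrite ler_wpM2r ?ler_norm// exprn_ge0// ltW.
Qed.

Lemma bigO_weak e e' F : (e' <= e)%N -> bigO e F -> bigO e' F.
Proof.
move=> ee /bigO_ge0[D D0 hD]; exists D => x; apply: (le_trans (hD x)).
by rewrite ler_wpM2l// ler_wiXn2l// ltW.
Qed.

Lemma bigO_le e F G : polyfam F -> polyfam G -> (forall x w, F x w <= G x w) ->
  bigO e G -> bigO e F.
Proof.
move=> pF pG FG [D hD]; exists D => x; apply: le_trans (hD x).
by apply: le_Rintegral => //; try exact: pint.
Qed.

Lemma bigOD e F G : polyfam F -> polyfam G -> bigO e F -> bigO e G ->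
  bigO e (fun x w => F x w + G x w).
Proof.
move=> pF pG [D hD] [D' hD']; exists (D + D') => x.
by rewrite RintegralD//; try exact: pint; rewrite mulrDl lerD.
Qed.

Lemma bigOZ e c F : 0 <= c -> polyfam F -> bigO e F ->
  bigO e (fun x w => c * F x w).
Proof.
move=> c0 pF [D hD]; exists (c * D) => x.
by rewrite RintegralZl//; try exact: pint; rewrite -mulrA ler_wpM2l.
Qed.

Lemma bigO_scale e e' F : polyfam F -> bigO e F ->
  bigO (e + e') (fun x w => (md_n x)%:R^-1 ^+ e' * F x w).
Proof.
move=> pF [D hD]; exists D => x.
rewrite RintegralZl//; try exact: pint.
by rewrite addnC exprD mulrCA ler_wpM2l// exprn_ge0// ltW.
Qed.

Lemma polyfam_sum k (F : 'I_k -> model -> T -> R) : (forall i, polyfam (F i)) ->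
  polyfam (fun x w => \sum_i F i x w).
Proof. by move=> h x; apply: polyrv_sum => i; exact: h. Qed.

Lemma bigO_sum e k (F : 'I_k -> model -> T -> R) : (forall i, polyfam (F i)) ->
  (forall i, bigO e (F i)) -> bigO e (fun x w => \sum_i F i x w).
Proof.
move=> pF hF; have [D hD] := choice hF.
exists (\sum_i D i) => x.
rewrite Rintegral_sum; last by move=> i; exact: pint.
by rewrite mulr_suml; apply: ler_sum.
Qed.

(** An expectation bounded by half of itself plus another quantity is bounded by
    twice that quantity, because polynomials have finite expectations. *)
Lemma bigO_absorb e F G H : polyfam F -> polyfam G -> polyfam H ->
  (forall x, \int[P]_w F x w = \int[P]_w G x w) ->
  (forall x w, G x w <= 2^-1 * F x w + H x w) -> bigO e H -> bigO e F.
Proof.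
move=> pF pG pH FG GH [D hD]; exists (2 * D) => x.
have h : \int[P]_w G x w <= 2^-1 * (\int[P]_w F x w) + \int[P]_w H x w.
  rewrite -RintegralZl//; last exact: pint.
  have pF2 : P.-integrable setT (EFin \o (fun w => 2^-1 * F x w)).
    by apply: real_integrableZ; exact: pint.
  rewrite -RintegralD//; last exact: pint.
  apply: le_Rintegral => //; first exact: pint.
  by apply: real_integrableD => //; exact: pint.
have := hD x; rewrite -FG in h; rewrite -mulrA; lra.
Qed.

Definition tm k x w := tmom (@md_M x) k w.
Definition vs x := var_scale (@md_u x) (@md_v x).
Definition dev k x w := tm k x w - scmom (vs x) k.

Lemma polyfam_tm k : polyfam (tm k).
Proof. by move=> x; exact: polyrv_tmom. Qed.

Lemma polyfamD F G : polyfam F -> polyfam G -> polyfam (fun x w => F x w + G x w).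
Proof. by move=> pF pG x; exact: polyrvD. Qed.

Lemma polyfamM F G : polyfam F -> polyfam G -> polyfam (fun x w => F x w * G x w).
Proof. by move=> pF pG x; exact: polyrvM. Qed.

Lemma polyfam_cst (c : model -> R) : polyfam (fun x _ => c x).
Proof. by move=> x; exact: polyrv_cst. Qed.

Lemma polyfamX m F : polyfam F -> polyfam (fun x w => F x w ^+ m).
Proof. by move=> pF x; exact: polyrvX. Qed.

Lemma polyfam_dev k : polyfam (dev k).
Proof.
exact: (polyfamD (@polyfam_tm k) (@polyfam_cst (fun x => - scmom (vs x) k))).
Qed.

Let drift k x w := sd_drift (@md_u x) (@md_v x) (@md_M x) k w.
Let quad k x w := sd_quad (@md_u x) (@md_v x) (@md_M x) k w.

Let polyfam_drift k : polyfam (drift k).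
Proof. by move=> x; exact: polyrv_drift. Qed.

Let polyfam_quad k : polyfam (quad k).
Proof. by move=> x; exact: polyrv_quad. Qed.

Ltac poly := repeat first
  [ exact: polyfam_tm | exact: polyfam_dev | exact: polyfam_drift | exact: polyfam_quad
  | exact: polyfam_cst | apply: polyfamX | apply: polyfamD
  | apply: polyfamM | apply: polyfam_sum => ? ].

Lemma bigO_cst : bigO 0 (fun _ _ => 1).
Proof.
exists 1 => x; rewrite expr0 mulr1 Rintegral_cst// mul1r.
by rewrite le_eqVlt; apply/orP; left; apply/eqP; exact: (congr1 fine (probability_setT P)).
Qed.

(** The Schwinger-Dyson equation for c = 0: by [sd_drift_apriori], [sd_quad_le] and [tmomD_le]
    its right-hand side is at most C t_2k y^m with y = t_(2k+2), and Young's
    inequality leaves half of y^(m+1) plus a power of t_2k. *)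
Lemma moments_bounded k m : bigO 0 (fun x w => tm k.*2 x w ^+ m).
Proof.
elim: k m => [|k IH] m.
  apply: bigO_le bigO_cst; [poly|poly|] => x w.
  by rewrite /tm (tmom0 (md_P x)) expr1n.
case: m => [|m]; first by apply: bigO_le bigO_cst; [poly|poly|] => x w; rewrite expr0.
(* sum of the constants of the drift and quadratic bounds *)
pose C : R := 10 * k.*2.+1%:R + m%:R * (k.*2.+2%:R * 4).
have C0 : 0 <= C by rewrite addr_ge0 ?mulr_ge0.
apply: (@bigO_absorb 0 _ (fun x w => drift k.*2.+1 x w * tm k.*2.+2 x w ^+ m +
    m%:R * tm k.*2.+2 x w ^+ m.-1 * (k.*2.+2%:R * quad k.*2.+1 x w))
    (fun x w => 2 ^+ m * C ^+ m.+1 * tm k.*2 x w ^+ m.+1)); [poly|poly|poly| | |].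
- move=> x; have := schwinger_dyson (md_P x) k.*2.+1 0 m.
  rewrite /= => h; transitivity (\int[P]_w ((tmom (@md_M x) k.*2.+2 w - 0) ^+ m.+1)).
    by apply: eq_Rintegral => w _; rewrite subr0.
  by rewrite h; apply: eq_Rintegral => w _; rewrite !subr0.
- move=> x w; set y := tm k.*2.+2 x w; set z := tm k.*2 x w.
  have y0 : 0 <= y by apply: (tmom_ge0 (md_P x)); rewrite /= negbK odd_double.
  have z0 : 0 <= z by apply: (tmom_ge0 (md_P x)); rewrite odd_double.
  have h1 : drift k.*2.+1 x w <= 10 * k.*2.+1%:R * z.
    exact: le_trans (ler_norm _) (sd_drift_apriori (md_P x) k w).
  have h2 : quad k.*2.+1 x w <= 4 * (y * z).
    apply: le_trans (ler_norm _) _; apply: le_trans (sd_quad_le (md_P x) _ w) _.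
    have e : (k.*2.+1 + k.*2.+1 = k.*2.+2 + k.*2)%N by lia.
    have := @tmomD_le _ _ _ _ _ _ _ _ (md_P x) k.*2.+2 k.*2 w.
    rewrite e /= negbK odd_double /= => /(_ isT isT) h.
    rewrite -/(tm _ x w) -/y -/z in h; rewrite -/(tm _ x w) -mulrA ler_wpM2l//.
    apply: (@le_trans _ _ ((md_n x)%:R^-1 ^+ 2 * ((md_n x)%:R * (y * z)))).
      by rewrite ler_wpM2l// exprn_ge0// ltW.
    have n0 : (md_n x)%:R != 0 :> R by rewrite -invr_eq0 gt_eqF.
    rewrite (_ : _ * _ = (md_n x)%:R^-1 * (y * z)); last by field.
    by rewrite ler_piMl// mulr_ge0.
  have h3 : drift k.*2.+1 x w * y ^+ m + m%:R * y ^+ m.-1 * (k.*2.+2%:R * quad k.*2.+1 x w)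
     <= (C * z) * y ^+ m.
    have ym : 0 <= y ^+ m by rewrite exprn_ge0.
    apply: (@le_trans _ _ (10 * k.*2.+1%:R * z * y ^+ m +
        m%:R * y ^+ m.-1 * (k.*2.+2%:R * (4 * (y * z))))).
      apply: lerD; first by rewrite ler_wpM2r.
      by rewrite ler_wpM2l ?mulr_ge0 ?exprn_ge0// ler_wpM2l.
    rewrite le_eqVlt /C; apply/orP; left; apply/eqP.
    case: (m) => [|m']; first by ring.
    by rewrite /= !exprS; ring.
  have half0 : 0 < 2^-1 :> R by rewrite invr_gt0.
  have := young m (mulr_ge0 C0 z0) y0 half0.
  by rewrite invrK (exprMn m.+1 C z) => h4; apply: (le_trans h3); rewrite -(mulrA (2 ^+ m)).
- apply: bigOZ; [by rewrite mulr_ge0 ?exprn_ge0|poly|exact: IH].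
Qed.

Let vs01 x : 0 <= vs x <= 1.
Proof.
by have /andP[h1 h2] := var_scale_bounds (md_P x); apply/andP; split; rewrite /vs; lra.
Qed.

(** Bound for the summand t_p t_q - m_p m_q of the drift, written as
    (m_p + dev_p) (m_q + dev_q) - m_p m_q, plus the error of [sd_drift_le]. *)
Let term k (p : 'I_k) x w :=
  `|dev p x w| * `|dev (k - 1 - p) x w| + 4 ^+ k * `|dev (k - 1 - p) x w| +
  (4 ^+ k * `|dev p x w| + 4 * sqrt_err (@md_M x) p (k - 1 - p) w).

Let drift_term_le k x w :
  `|drift k x w - scmom (vs x) k.+1| <= \sum_(p < k) term p x w.
Proof.
have /andP[s0 s1] := vs01 x.
have h := sd_drift_le (md_P x) k w.
have -> : drift k x w - scmom (vs x) k.+1 =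
    (drift k x w - vs x * \sum_(p < k) tm p x w * tm (k - 1 - p) x w) +
    \sum_(p < k) vs x * (tm p x w * tm (k - 1 - p) x w -
                         scmom (vs x) p * scmom (vs x) (k - 1 - p)).
  by rewrite scmom_rec -mulr_sumr sumrB; ring.
rewrite (le_trans (ler_normD _ _))// (le_trans (lerD h (ler_norm_sum _ _ _)))//.
rewrite mulr_sumr -big_split; apply: ler_sum => p _; rewrite /term.
set q := (k - 1 - p)%N; set a := dev p x w; set b := dev q x w.
have -> : tm p x w * tm q x w - scmom (vs x) p * scmom (vs x) q =
    a * b + scmom (vs x) p * b + scmom (vs x) q * a.
  by rewrite /a /b /dev; ring.
have cle j : (j <= k)%N -> `|scmom (vs x) j| <= 4 ^+ k.
  move=> jk; have /andP[c0 c4] := scmom_bounds j (vs01 x).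
  by rewrite ger0_norm// (le_trans c4)// ler_weXn2l//; lra.
have hp : `|scmom (vs x) p * b| <= 4 ^+ k * `|b|.
  by rewrite normrM ler_wpM2r// cle// ltnW.
have hq : `|scmom (vs x) q * a| <= 4 ^+ k * `|a|.
  by rewrite normrM ler_wpM2r// cle// /q; lia.
rewrite /= normrM (ger0_norm s0) addrC [in leRHS]addrA lerD2r.
rewrite (@le_trans _ _ `|a * b + scmom (vs x) p * b + scmom (vs x) q * a|)//.
  exact: ler_piMl.
rewrite (le_trans (ler_normD _ _))// lerD//.
by rewrite (le_trans (ler_normD _ _))// normrM lerD.
Qed.

Let term_bound m k (p : 'I_k) x w : (0 < m)%N ->
  term p x w ^+ (2 * m) <= 2 ^+ (2 * m) * (2 ^+ (2 * m) * (
    (dev p x w ^+ (2 * (2 * m)) + dev (k - 1 - p) x w ^+ (2 * (2 * m)) +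
     4 ^+ k ^+ (2 * m) * dev (k - 1 - p) x w ^+ (2 * m)) +
    (4 ^+ k ^+ (2 * m) * dev p x w ^+ (2 * m) + 4 ^+ (2 * m) *
      ((md_n x)%:R^-1 ^+ m * (tm p.*2 x w ^+ (2 * m) + tm (k - 1 - p).*2 x w ^+ (2 * m)))))).
Proof.
move=> m0; rewrite /term; set q := (k - 1 - p)%N.
have k4 : 0 <= 4 ^+ k :> R by rewrite exprn_ge0.
have r0 := sqrt_err_ge0 (@md_M x) p q w.
have r2 : sqrt_err (@md_M x) p q w ^+ 2 =
    (md_n x)%:R^-1 * (tm p.*2 x w * tm q.*2 x w).
  by rewrite (sqr_sqrt_err (md_P x)) !addnn.
have t0 j : 0 <= tm j.*2 x w by rewrite (tmom_ge0 (md_P x))// odd_double.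
have ni0 : 0 <= (md_n x)%:R^-1 :> R by rewrite ltW.
move: (dev p x w) (dev q x w) (tm p.*2 x w) (t0 p) (tm q.*2 x w) (t0 q)
  (sqrt_err _ _ _ _) r0 r2 => a b al al0 be be0 r r0 r2 {t0}.
have even_norm (y : R) : `|y| ^+ (2 * m) = y ^+ (2 * m).
  by rewrite !exprM real_normK// num_real.
have two (y z : R) : 0 <= y -> 0 <= z -> y * z <= y ^+ 2 + z ^+ 2.
  by move=> y0 z0; have := exprn_mul_le_add 1 1 y0 z0; rewrite !expr1.
rewrite (le_trans (exprD_le _ _ _)) ?addr_ge0 ?mulr_ge0// ler_wpM2l ?exprn_ge0//.
rewrite mulrDr lerD//; rewrite (le_trans (exprD_le _ _ _)) ?mulr_ge0// ler_wpM2l ?exprn_ge0//.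
  rewrite lerD// !exprMn !even_norm//.
  have e (y : R) : y ^+ (2 * (2 * m)) = (y ^+ (2 * m)) ^+ 2.
    by rewrite -exprM mulnC.
  by rewrite !e two// exprM exprn_ge0// sqr_ge0.
rewrite lerD// !exprMn ?even_norm// ler_wpM2l ?exprn_ge0//.
rewrite exprM r2 exprMn ler_wpM2l ?(exprn_ge0 _ ni0)// exprMn mulnC !exprM.
by rewrite two ?exprn_ge0.
Qed.

Let drift_dev_bound k m : (0 < m)%N ->
  (forall j, (j < k)%N -> forall m, bigO m (fun x w => dev j x w ^+ (2 * m))) ->
  bigO m (fun x w => (drift k x w - scmom (vs x) k.+1) ^+ (2 * m)).
Proof.
move=> m0 IH.
pose B (p : 'I_k) x w := 2 ^+ (2 * m) * (2 ^+ (2 * m) * (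
    (dev p x w ^+ (2 * (2 * m)) + dev (k - 1 - p) x w ^+ (2 * (2 * m)) +
     4 ^+ k ^+ (2 * m) * dev (k - 1 - p) x w ^+ (2 * m)) +
    (4 ^+ k ^+ (2 * m) * dev p x w ^+ (2 * m) + 4 ^+ (2 * m) *
      ((md_n x)%:R^-1 ^+ m * (tm p.*2 x w ^+ (2 * m) + tm (k - 1 - p).*2 x w ^+ (2 * m)))))).
have pB p : polyfam (B p).
  rewrite /B; poly.
have hB p : bigO m (B p).
  have hp : (p < k)%N by []; have hq : (k - 1 - p < k)%N by lia.
  apply: bigOZ; [by rewrite exprn_ge0|poly|].
  apply: bigOZ; [by rewrite exprn_ge0|poly|].
  have w2 j : (j < k)%N -> bigO m (fun x w => dev j x w ^+ (2 * (2 * m))).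
    by move=> jk; apply: (@bigO_weak (2 * m)); [lia|exact: IH].
  apply: bigOD; [poly|poly| |].
    apply: bigOD; [poly|poly| |].
      by apply: bigOD; [poly|poly|exact: w2|exact: w2].
    by apply: bigOZ; [rewrite !exprn_ge0|poly|exact: IH].
  apply: bigOD; [poly|poly| |].
    by apply: bigOZ; [rewrite !exprn_ge0|poly|exact: IH].
  apply: bigOZ; [by rewrite exprn_ge0|poly|].
  rewrite -[X in bigO X]add0n; apply: bigO_scale; first poly.
  by apply: bigOD; [poly|poly|exact: moments_bounded|exact: moments_bounded].
have pD : polyfam (fun x w => drift k x w - scmom (vs x) k.+1).
  exact: (polyfamD (@polyfam_drift k) (@polyfam_cst (fun x => - scmom (vs x) k.+1))).
apply: (@bigO_le m _ (fun x w => (2 ^+ (2 * m)) ^+ k * \sum_(p < k) B p x w)).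
- exact: polyfamX.
- poly; exact: pB.
- move=> x w; have e : (2 * m = (2 * m.-1).+2)%N by lia.
  rewrite -[leLHS]ger0_norm ?exprn_even_ge0 ?oddM// normrX.
  apply: (@le_trans _ _ ((\sum_(p < k) term p x w) ^+ (2 * m))).
    have h := drift_term_le k x w.
    by apply: lerXn2r => //; rewrite nnegrE// (le_trans _ h).
  apply: (@le_trans _ _ ((2 ^+ (2 * m)) ^+ k * \sum_(p < k) term p x w ^+ (2 * m))).
    rewrite {1 2 3}e; apply: expr_sum_le => p.
    by rewrite /term !addr_ge0 ?mulr_ge0 ?exprn_ge0 ?sqrt_err_ge0.
  by rewrite ler_wpM2l ?exprn_ge0//; apply: ler_sum => p _; exact: term_bound.
- by apply: bigOZ; [rewrite !exprn_ge0|apply: polyfam_sum|exact: bigO_sum].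
Qed.

(** The Schwinger-Dyson equation for c = m_(k+1).  Two applications of Young's inequality leave
    half of the unknown moment, a moment of the deviation of the drift (which
    is of order n^-m by the induction hypothesis) and a term of order n^(-2m)
    from the quadratic part. *)
Theorem deviation_moments k m : bigO m (fun x w => dev k x w ^+ (2 * m)).
Proof.
elim/ltn_ind: k m => -[|k] IH m.
  apply: (@bigO_le m _ (fun _ _ => (m == 0)%:R)); [poly|poly| |].
    move=> x w; rewrite /dev /tm (tmom0 (md_P x)) scmom0 subrr expr0n.
    by case: m.
  case: m => [|m]; first exact: bigO_cst.
  by exists 0 => x; rewrite mul0r Rintegral_cst// mul0r.
case: m => [|m].
  by apply: bigO_le bigO_cst; [poly|poly|] => x w; rewrite expr0.
have {}IH : forall j, (j < k.+1)%N -> forall m, bigO m (fun x w => dev j x w ^+ (2 * m)).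
  by move=> j jk m'; exact: IH.
have IHk j : (j < k)%N -> forall m, bigO m (fun x w => dev j x w ^+ (2 * m)).
  by move=> jk; apply: IH; exact: ltnW.
pose A x w := drift k x w - scmom (vs x) k.+1.
have pA : polyfam A.
  exact: (polyfamD (@polyfam_drift k) (@polyfam_cst (fun x => - scmom (vs x) k.+1))).
pose b x w := (2 * m).+1%:R * (k.+1%:R * (4 * ((md_n x)%:R^-1 ^+ 2 * tm k.*2 x w))).
have pb : polyfam b by rewrite /b; poly.
apply: (@bigO_absorb _ _ (fun x w => A x w * dev k.+1 x w ^+ (2 * m).+1 +
    (2 * m).+1%:R * dev k.+1 x w ^+ (2 * m) * (k.+1%:R * quad k x w))
  (fun x w => 4 ^+ (2 * m).+1 * A x w ^+ (2 * m.+1) + 4 ^+ m * b x w ^+ m.+1)).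
- poly.
- poly.
- poly.
- move=> x; have := schwinger_dyson (md_P x) k (scmom (vs x) k.+1) (2 * m).+1.
  by rewrite -(_ : (2 * m.+1 = (2 * m).+2)%N)//; lia.
- move=> x w; set Y := dev k.+1 x w; set a := A x w.
  have quart : 0 < 4^-1 :> R by rewrite invr_gt0.
  have e : (2 * m.+1 = (2 * m).+2)%N by lia.
  have b0 : 0 <= b x w.
    have t0 : 0 <= tm k.*2 x w by rewrite (tmom_ge0 (md_P x))// odd_double.
    by do ?apply: mulr_ge0 => //; rewrite ?exprn_ge0// ltW.
  have h1 : a * Y ^+ (2 * m).+1 <= 4^-1 * Y ^+ (2 * m.+1) +
      4 ^+ (2 * m).+1 * a ^+ (2 * m.+1).
    have := young (2 * m).+1 (normr_ge0 a) (normr_ge0 Y) quart.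
    rewrite invrK -e -!normrX.
    rewrite !(@ger0_norm _ (_ ^+ (2 * m.+1))) ?exprn_even_ge0 ?oddM//.
    by apply: le_trans; rewrite -normrM ler_norm.
  have h2 : (2 * m).+1%:R * Y ^+ (2 * m) * (k.+1%:R * quad k x w) <=
      4^-1 * Y ^+ (2 * m.+1) + 4 ^+ m * b x w ^+ m.+1.
    have := young m b0 (sqr_ge0 Y) quart.
    rewrite invrK -!exprM; apply: le_trans.
    have Y0 : 0 <= Y ^+ (2 * m) by rewrite exprn_even_ge0// oddM.
    have hq := le_trans (ler_norm _) (sd_quad_le (md_P x) k w).
    rewrite -mulrA mulrCA [leRHS]mulrC ler_wpM2l// /b ler_wpM2l// ler_wpM2l//.
    by rewrite mulrA -addnn.
  apply: (le_trans (lerD h1 h2)); lra.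
- apply: bigOD.
  + poly.
  + poly.
  + apply: bigOZ; [by rewrite exprn_ge0|poly|].
    exact: drift_dev_bound.
  + apply: bigOZ; [by rewrite exprn_ge0|poly|].
    pose D : R := (2 * m).+1%:R * (k.+1%:R * 4).
    have bE : (fun x w => b x w ^+ m.+1) = (fun x w => D ^+ m.+1 *
        ((md_n x)%:R^-1 ^+ (2 * m.+1) * tm k.*2 x w ^+ m.+1)).
      apply/funext => x; apply/funext => w.
      by rewrite exprM -!exprMn /b /D; congr (_ ^+ _); ring.
    rewrite bE; apply: bigOZ; [by rewrite exprn_ge0// !mulr_ge0|poly|].
    apply: (@bigO_weak (0 + 2 * m.+1)); first by lia.
    by apply: bigO_scale; [poly|exact: moments_bounded].
Qed.

End uniform_bounds.

(** * Moments of the semicircle law *)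

Section semicircle_law_moments.
Variables (R : realType) (s2 : R).
Hypothesis s20 : 0 < s2.
Local Notation leb := (@lebesgue_measure R).
Let a : R := 2 * Num.sqrt s2.
Let rt (x : R) := Num.sqrt (4 * s2 - x ^+ 2).

Let a0 : 0 < a. Proof. by rewrite mulr_gt0// sqrtr_gt0. Qed.
Let a2 : a ^+ 2 = 4 * s2.
Proof. by rewrite exprMn sqr_sqrtr ?ltW//; ring. Qed.

Let in_open (x : R) : x \in `]- a, a[ -> 0 < 4 * s2 - x ^+ 2.
Proof.
rewrite in_itv /= => /andP[h1 h2]; rewrite subr_gt0 -a2.
by rewrite -(real_normK (num_real x)) ltrXn2r// ?nnegrE ?(ltW a0)// ltr_norml h1.
Qed.

Let rt_continuous : continuous rt.
Proof.
move=> x; apply: continuous_comp; last exact: sqrt_continuous.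
by apply: cvgB; [exact: cvg_cst|exact: exprn_continuous].
Qed.

Let rt_gt0 (x : R) : x \in `]- a, a[ -> 0 < rt x.
Proof. by move=> /in_open xa; rewrite sqrtr_gt0. Qed.

Let rt2 (x : R) : x \in `]- a, a[ -> rt x ^+ 2 = 4 * s2 - x ^+ 2.
Proof. by move=> /in_open xa; rewrite sqr_sqrtr// ltW. Qed.

Let is_derive_rt (x : R) : x \in `]- a, a[ -> is_derive x 1 rt (- x / rt x).
Proof.
move=> xa; have h := is_derive1_sqrt (in_open xa).
have dg : is_derive x 1 (fun x : R => 4 * s2 - x ^+ 2) (- (2 * x)).
  have -> : (fun x : R => 4 * s2 - x ^+ 2) = cst (4 * s2) - ((@id R) ^+ 2).
    by apply/funext => y.
  by apply: is_derive_eq; rewrite /GRing.scale /=; ring.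
have hd := @is_derive1_comp _ Num.sqrt (fun x : R => 4 * s2 - x ^+ 2) x _ _ h dg.
apply: (is_derive_eq hd).
have rx0 : rt x != 0 by rewrite gt_eqF ?rt_gt0.
by rewrite -/(rt x); field.
Qed.

Let ftc (F f : R -> R) : continuous F -> continuous f ->
  (forall x : R, x \in `]- a, a[ -> is_derive x 1 F (f x)) ->
  (\int[leb]_(x in `[(- a)%R, a]) (f x)%:E = (F a - F (- a))%:E)%E.
Proof.
move=> cF cf dF; have aa : - a < a by have := a0; lra.
rewrite (@continuous_FTC2 _ f F)//.
- exact: continuous_subspaceT.
- split.
  + by move=> x xa; exact: (@ex_derive _ _ _ _ _ _ _ (dF x xa)).
  + exact/cvg_at_right_filter/cF.
  + exact/cvg_at_left_filter/cF.
- by move=> x xa; rewrite derive1E; exact: (@derive_val _ _ _ _ _ _ _ (dF x xa)).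
Qed.

Let cX j : continuous (fun x : R => x ^+ j). Proof. by move=> x; exact: exprn_continuous. Qed.

Let ra : rt a = 0. Proof. by rewrite /rt a2 subrr sqrtr0. Qed.
Let rNa : rt (- a) = 0. Proof. by rewrite /rt sqrrN a2 subrr sqrtr0. Qed.

Let integrable_pow k : leb.-integrable `[- a, a] (EFin \o (fun x => x ^+ k * rt x)).
Proof.
apply: continuous_compact_integrable; first exact: segment_compact.
apply: continuous_subspaceT => x; apply: cvgM; [exact: cX|exact: rt_continuous].
Qed.

(** The integrand is the derivative of x^k (4 s2 - x^2)^(3/2), which vanishes at
    both ends of the support. *)
Let ibp k : (\int[leb]_(x in `[(- a)%R, a])
  ((k%:R * x ^+ k.-1 * (4 * s2) - (k + 3)%:R * x ^+ k.+1) * rt x)%:E = 0)%E.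
Proof.
apply: etrans (@ftc (fun x => x ^+ k * (4 * s2 - x ^+ 2) * rt x) _ _ _ _) _; last first.
- by rewrite ra rNa !mulr0 subrr.
- move=> x xa; have drt := is_derive_rt xa.
  have -> : (fun x : R => x ^+ k * (4 * s2 - x ^+ 2) * rt x) =
      ((@id R) ^+ k * (cst (4 * s2) - (@id R) ^+ 2)) * rt.
    by apply/funext => y; rewrite !fctE.
  have h := is_deriveM (is_deriveM (is_deriveX k (is_derive_id x (1 : R)))
     (is_deriveB (is_derive_cst (4 * s2) x (1:R)) (is_deriveX 2 (is_derive_id x (1 : R))))) drt.
  apply: (is_derive_eq h).
  have rx0 : rt x != 0 by rewrite gt_eqF ?rt_gt0.
  have e : 4 * s2 = rt x ^+ 2 + x ^+ 2 by rewrite rt2//; ring.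
  rewrite !fctE /GRing.scale /=; move: (rt x) e rx0 => r -> r0.
  case: k h => [|k] _ /=; first by rewrite !expr0; field.
  by rewrite !exprS natrD; field.
- move=> x; apply: cvgM; last exact: rt_continuous.
  apply: cvgB; last by apply: cvgM; [exact: cvg_cst|exact: cX].
  by apply: cvgM; [apply: cvgM; [exact: cvg_cst|exact: cX]|exact: cvg_cst].
- move=> x; apply: cvgM; last exact: rt_continuous.
  apply: cvgM; first exact: cX.
  by apply: cvgB; [exact: cvg_cst|exact: cX].
Qed.

Let J k := \int[leb]_(x in `[- a, a]) (x ^+ k * rt x).

Let JE k : (\int[leb]_(x in `[(- a)%R, a]) (x ^+ k * rt x)%:E = (J k)%:E)%E.
Proof. by rewrite /J /Rintegral fineK// integrable_fin_num//; exact: integrable_pow. Qed.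

Let J_ibp k : k%:R * (4 * s2) * J k.-1 = (k + 3)%:R * J k.+1.
Proof.
have iZ j (r : R) : leb.-integrable `[- a, a] (EFin \o (fun x => r * (x ^+ j * rt x))).
  by apply: eq_integrable (integrableZl _ r (integrable_pow j)).
have : \int[leb]_(x in `[- a, a])
   (k%:R * (4 * s2) * (x ^+ k.-1 * rt x) - (k + 3)%:R * (x ^+ k.+1 * rt x)) = 0.
  rewrite /Rintegral -[RHS]/(fine 0%E) -(ibp k); congr fine.
  by apply: eq_integral => x _; congr EFin; ring.
rewrite RintegralB//; try exact: iZ.
rewrite !RintegralZl//; try exact: integrable_pow.
by move/eqP; rewrite subr_eq0 => /eqP.
Qed.

(** A primitive of [rt].  The arctangent is half of arcsin (x / a), in a form
    that is continuous up to the endpoints. *)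
Let G (x : R) := 2^-1 * (x * rt x) + a ^+ 2 * atan (x / (a + rt x)).

Let art x : a + rt x != 0.
Proof. by rewrite gt_eqF// ltr_pwDl ?sqrtr_ge0. Qed.

Let J0 : J 0 = 2 * pi * s2.
Proof.
suff : (J 0)%:E = (G a - G (- a))%:E.
  case=> ->; rewrite /G ra rNa addr0 !mulr0 !add0r mulNr divff ?gt_eqF//.
  by rewrite atanN atan1 mulrN opprK a2; field.
rewrite -JE; under eq_integral do rewrite expr0 mul1r.
apply: ftc.
- move=> x; apply: cvgD; apply: cvgM; try exact: cvg_cst.
    by apply: cvgM; [exact: cvg_id|exact: rt_continuous].
  suff h : (y / (a + rt y)) @[y --> x] --> x / (a + rt x).
    exact: (cvg_comp _ _ h (@continuous_atan R _)).
  apply: cvgM; first exact: cvg_id.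
  apply: cvgV; first exact: art.
  by apply: cvgD; [exact: cvg_cst|exact: rt_continuous].
- exact: rt_continuous.
move=> x xa; have drt := is_derive_rt xa.
have hi := @is_deriveV R (cst a + rt) x _ 1 (art x) (is_deriveD (is_derive_cst a x (1 : R)) drt).
have hq := is_deriveM (is_derive_id x (1 : R)) hi.
have hat := @is_derive1_comp _ atan _ x _ _ (is_derive1_atan _) hq.
have := is_deriveD (is_deriveZ 2^-1 (is_deriveM (is_derive_id x (1 : R)) drt))
  (is_deriveZ (a ^+ 2) hat).
rewrite (_ : _ + _ = G); last first.
  by apply/funext => y; rewrite !fctE.
move=> h; apply: (is_derive_eq h).
rewrite !fctE /GRing.scale /=.
have e : a ^+ 2 = rt x ^+ 2 + x ^+ 2 by rewrite a2 rt2//; ring.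
have rx0 : rt x != 0 by rewrite gt_eqF ?rt_gt0.
have ax0 := art x; have an0 : a != 0 by rewrite gt_eqF.
move: (rt x) e rx0 ax0 => r e r0 ar0.
have x2 : x ^+ 2 = a ^+ 2 - r ^+ 2 by rewrite e; ring.
have -> : 1 + (x / (a + r)) ^+ 2 = 2 * a / (a + r).
  by rewrite exprMn exprVn x2; field.
have -> : x * (- (a + r) ^- 2 * (0 + - x / r)) = x ^+ 2 / ((a + r) ^+ 2 * r).
  by field; rewrite r0.
have -> : x * (- x / r) = - x ^+ 2 / r by field.
by rewrite x2; field; rewrite r0 ar0.
Qed.

(** The recursion of [scmom] is the integration by parts [J_ibp], and the total
    mass is [J0]. *)
Lemma semicircle_moment k :
  (semicircle_law s2).-integrable setT (EFin \o (fun x => x ^+ k)) /\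
  \int[semicircle_law s2]_x (x ^+ k) = scmom s2 k.
Proof.
have JS : (2 * pi * s2)^-1 * J k = scmom s2 k.
  have pi0 := @pi_gt0 R.
  have c0 : 2 * pi * s2 != 0 by rewrite gt_eqF// !mulr_gt0.
  suff [] : (2 * pi * s2)^-1 * J k = scmom s2 k /\
            (2 * pi * s2)^-1 * J k.+1 = scmom s2 k.+1 by [].
  elim: k => [|k [IH1 IH2]].
    rewrite scmom0 scmom1 J0 mulVf//; split => //.
    have := J_ibp 0; rewrite mul0r mul0r => /esym/eqP.
    by rewrite mulf_eq0 pnatr_eq0 /= => /eqP ->; rewrite mulr0.
  split => //; rewrite scmomSS -IH1.
  have := J_ibp k.+1; rewrite /= addSn addn3 => h.
  have k4 : k.+4%:R != 0 :> R by rewrite pnatr_eq0.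
  by rewrite (_ : J k.+2 = k.+4%:R^-1 * (k.+1%:R * (4 * s2) * J k)); [ring|rewrite h mulKf].
have pdfE x : x ^+ k * semicircle_pdf s2 x =
    ((fun x => (2 * pi * s2)^-1 * (x ^+ k * rt x)) \_ `[- a, a]) x.
  rewrite patchE mem_setE in_itv /= /semicircle_pdf -/a.
  by case: ifP => _; rewrite ?mulr0// mulrCA.
have iZ : leb.-integrable `[- a, a] (EFin \o (fun x => (2 * pi * s2)^-1 * (x ^+ k * rt x))).
  by apply: eq_integrable (integrableZl _ _ (integrable_pow k)).
have iP : leb.-integrable setT (fun x => (x ^+ k * semicircle_pdf s2 x)%:E).
  under eq_fun do rewrite pdfE.
  have mD : measurable (`[- a, a]%classic : set (measurableTypeR R)).
    exact: measurable_itv.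
  have := (@integrable_mkcond _ _ _ leb _ _ mD).1 iZ.
  by rewrite restrict_EFin.
have nuE B : measurable B -> semicircle_law s2 B =
   (\int[leb]_(x in idfun @^-1` B) (semicircle_pdf s2 x)%:E)%E by [].
have [i1 i2] := @integral_density _ _ (measurableTypeR R) (measurableTypeR R) R leb (semicircle_law s2) idfun
  (semicircle_pdf s2) (@measurable_id _ _ setT) (measurable_semicircle_pdf s2)
  (semicircle_pdf_ge0 s2) nuE (fun x => x ^+ k) (measurable_funX _ (@measurable_id _ _ _)) iP.
split=> //; rewrite -JS.
have -> : (2 * pi * s2)^-1 * J k =
    \int[leb]_(x in `[- a, a]) ((2 * pi * s2)^-1 * (x ^+ k * rt x)).
  by rewrite RintegralZl//; exact: integrable_pow.
rewrite /Rintegral i2; congr fine; rewrite [RHS]integral_mkcond.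
apply: eq_integral => x _; rewrite pdfE.
by rewrite !patchE; case: ifP.
Qed.

End semicircle_law_moments.

(** * Polynomial approximation *)

Section weierstrass.
Variable R : realType.

Section bernstein.
Variable A : comNzRingType.

(** The mean of h over the number of successes in n trials of probability t,
    conditioning on the first trial.  For t a polynomial it is the Bernstein
    polynomial of h; [bernstein_horner] relates both readings. *)
Fixpoint bernstein (t : A) n (h : nat -> A) : A :=
  if n is n'.+1 then t * bernstein t n' (h \o succn) + (1 - t) * bernstein t n' h
  else h 0%N.

End bernstein.

Lemma bernstein_horner (p : {poly R}) x n (h : nat -> R) :
  (bernstein p n (fun k => (h k)%:P)).[x] = bernstein p.[x] n h.
Proof.
elim: n h => [|n IH] h /=; first by rewrite hornerC.
rewrite hornerD !hornerM hornerD hornerN hornerC.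
by congr (_ * _ + _ * _); [exact: (IH (h \o succn))|exact: IH].
Qed.

Section unit_interval.
Variable t : R.
Hypothesis t01 : 0 <= t <= 1.

Lemma bernstein_le n (h g : nat -> R) : (forall k, (k <= n)%N -> h k <= g k) ->
  bernstein t n h <= bernstein t n g.
Proof.
have /andP[t0 t1] := t01.
elim: n h g => [|n IH] h g hg /=; first exact: hg.
apply: lerD; rewrite ler_wpM2l ?subr_ge0//; apply: IH => k kn; apply: hg => //.
exact: leqW.
Qed.

Lemma bernstein_lin n (r s : R) (h g : nat -> R) :
  bernstein t n (fun k => r * h k + s * g k) =
  r * bernstein t n h + s * bernstein t n g.
Proof.
elim: n h g => [//|n IH] h g /=.
by rewrite (IH h g) (IH (h \o succn) (g \o succn)); ring.
Qed.

Lemma bernstein_cst n (r : R) : bernstein t n (fun=> r) = r.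
Proof. by elim: n => [//|n IH] /=; rewrite /comp IH; ring. Qed.

(** For r = n t this is the variance of the binomial law. *)
Lemma bernstein_sqr n (r : R) : bernstein t n (fun k => (k%:R - r) ^+ 2) =
  n%:R * (t * (1 - t)) + (n%:R * t - r) ^+ 2.
Proof.
elim: n r => [|n IH] r /=; first by ring.
have e : (fun k : nat => (k%:R - r) ^+ 2) \o succn = (fun k => (k%:R - (r - 1)) ^+ 2).
  by apply/funext => k /=; rewrite -natr1; ring.
by rewrite e !IH -natr1; ring.
Qed.

End unit_interval.

Lemma segment_uniformly_continuous (f : R -> R) (a b e : R) : continuous f ->
  0 < e -> exists2 dl, 0 < dl & forall x y, a <= x <= b -> `|x - y| < dl ->
    `|f x - f y| < e.
Proof.
move=> cf e0; have := @segment_compact R a b; rewrite compact_near_coveringP.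
move=> /(_ R (0 : R)^'+ (fun dl x => forall y, `|x - y| < dl -> `|f x - f y| < e)).
case=> [x _|dl /= dl0 h].
  have /cvgrPdist_lt /(_ (e / 2)) := cf x.
  case; first by rewrite divr_gt0.
  move=> r /= r0 hr.
  exists (ball x (r / 2), [set dl | dl < r / 2]) => /=.
    split; first by apply: nbhsx_ballx; rewrite divr_gt0.
    by apply: nbhs_right_lt; rewrite divr_gt0.
  move=> [z dl] /= [xz dlr] y zy; rewrite /ball /= in xz.
  have h1 : `|f x - f z| < e / 2 by apply: hr => /=; rewrite (lt_trans xz)//; lra.
  have h2 : `|f x - f y| < e / 2.
    apply: hr => /=; rewrite -(subrK z x) -addrA (le_lt_trans (ler_normD _ _))//.
    by rewrite (lt_le_trans (ltrD xz (lt_trans zy dlr)))//; lra.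
  rewrite -(subrK (f x) (f z)) -addrA (le_lt_trans (ler_normD _ _))//.
  by rewrite distrC in h1; lra.
exists (dl / 2); first by rewrite divr_gt0.
move=> x y xab xy.
have dl2 : 0 < dl / 2 by rewrite divr_gt0.
have bdl : ball_ Num.norm 0 dl (dl / 2).
  by rewrite /= sub0r normrN gtr0_norm//; lra.
by have := h _ bdl dl2 x; rewrite /= in_itv /=; apply.
Qed.

(** Bernstein's proof on [-K, K]: where x and the node are closer than dl, the
    values of f differ by at most e / 2; elsewhere their difference is at most
    2 B (distance / dl)^2, whose mean is a multiple of the binomial variance,
    of order 1 / n. *)
Lemma weierstrass (f : R -> R) (B K e : R) : continuous f ->
  (forall x, `|f x| <= B) -> 0 < K -> 0 < e ->
  exists p : {poly R}, forall x, `|x| <= K -> `|f x - p.[x]| <= e.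
Proof.
move=> cf fB K0 e0.
have B0 : 0 <= B by apply: le_trans (fB 0).
have [dl dl0 hdl] := segment_uniformly_continuous (- K) K cf (divr_gt0 e0 (ltr0n R 2)).
pose c := 2 * B * (2 * K) ^+ 2 / dl ^+ 2.
have c0 : 0 <= c by rewrite divr_ge0 ?mulr_ge0 ?exprn_ge0// ltW.
pose n := (Num.truncn (2 * c / e)).+1.
have n0 : (0 : R) < n%:R by rewrite ltr0n.
have cn : c / n%:R <= e / 2.
  rewrite ler_pdivrMr// mulrC -ler_pdivrMr ?divr_gt0//.
  by rewrite invf_div mulrA [c * 2]mulrC ltW// truncnS_gt.
pose node k : R := 2 * K * (k%:R / n%:R) - K.
pose h k := f (node k).
exists (bernstein ((2 * K)^-1 *: ('X + K%:P)) n (fun k => (h k)%:P)) => x xK.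
rewrite bernstein_horner hornerZ hornerD hornerX hornerC.
set t := _^-1 * (x + K); move: (xK); rewrite ler_norml => /andP[Kx xK'].
have K20 : 0 < 2 * K by rewrite mulr_gt0.
have t01 : 0 <= t <= 1.
  rewrite mulr_ge0 ?invr_ge0 ?(ltW K20)//=; last lra.
  by rewrite ler_pdivrMl//; lra.
have xt : x = 2 * K * t - K by rewrite /t mulVKf ?gt_eqF// addrK.
have key k : `|f x - h k| <= e / 2 + 2 * B * (2 * K / (n%:R * dl)) ^+ 2 * (k%:R - n%:R * t) ^+ 2.
  have r0 : 0 <= 2 * B * (2 * K / (n%:R * dl)) ^+ 2 * (k%:R - n%:R * t) ^+ 2.
    by apply: mulr_ge0 (sqr_ge0 _); apply: mulr_ge0 (sqr_ge0 _); apply: mulr_ge0.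
  case: (ltP `|x - node k| dl) => hd.
    have hx : - K <= x <= K by rewrite Kx.
    by rewrite (le_trans (ltW (hdl _ _ hx hd)))// lerDl.
  rewrite (@le_trans _ _ (2 * B))//.
    by rewrite (le_trans (ler_normB _ _))//; have := fB x; have := fB (node k); rewrite /h; lra.
  rewrite (@le_trans _ _ (2 * B * (2 * K / (n%:R * dl)) ^+ 2 * (k%:R - n%:R * t) ^+ 2))//; last by rewrite lerDr ltW// divr_gt0.
  have -> : 2 * B * (2 * K / (n%:R * dl)) ^+ 2 * (k%:R - n%:R * t) ^+ 2 =
      2 * B * ((x - node k) / dl) ^+ 2.
    by rewrite /node xt; field; rewrite !gt_eqF.
  rewrite ler_peMr ?mulr_ge0// -(real_normK (num_real _)) expr_ge1//.
  by rewrite normrM normfV (gtr0_norm dl0) ler_pdivlMr// mul1r.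
pose q k := e / 2 + 2 * B * (2 * K / (n%:R * dl)) ^+ 2 * (k%:R - n%:R * t) ^+ 2.
have Eq : bernstein t n q <= e.
  have -> : q = (fun k => e / 2 * 1 + 2 * B * (2 * K / (n%:R * dl)) ^+ 2 * (k%:R - n%:R * t) ^+ 2).
    by apply/funext => k; rewrite mulr1.
  rewrite (bernstein_lin t n (e / 2) _ (fun=> 1)) bernstein_cst bernstein_sqr subrr.
  rewrite expr0n addr0 mulr1.
  have -> : 2 * B * (2 * K / (n%:R * dl)) ^+ 2 * (n%:R * (t * (1 - t))) =
     c / n%:R * (t * (1 - t)).
    by rewrite /c; field; rewrite !gt_eqF.
  have /andP[t0 t1] := t01.
  have tt : t * (1 - t) <= 1 by rewrite mulr_ile1//; lra.
  have tt0 : 0 <= t * (1 - t) by rewrite mulr_ge0//; lra.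
  have : c / n%:R * (t * (1 - t)) <= e / 2.
    by rewrite (le_trans _ cn)// ler_piMr// divr_ge0// ltW.
  lra.
have diff : f x - bernstein t n h = bernstein t n (fun k => 1 * (f x) + (-1) * h k).
  by rewrite (bernstein_lin t n 1 (-1) (fun=> f x)) bernstein_cst; ring.
rewrite diff ler_norml; apply/andP; split.
  have := @bernstein_le t t01 n (fun k => - 1 * q k + 0 * 0) (fun k => 1 * f x + -1 * h k).
  rewrite (bernstein_lin t n (-1) 0 q (fun=> 0)).
  have hk k : (k <= n)%N -> -1 * q k + 0 * 0 <= 1 * f x + -1 * h k.
    by move=> _; have := key k; rewrite ler_norml -/(q k) => /andP[]; lra.
  by move=> /(_ hk); lra.
apply: le_trans Eq; apply: bernstein_le => // k _.
by have := key k; rewrite ler_norml -/(q k) => /andP[]; lra.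
Qed.

End weierstrass.

(** * From moments to weak convergence *)

Section moment_method.
Variable R : realType.
Local Notation mR := (measurableTypeR R).

Definition all_moments (mu : {measure set mR -> \bar R}) :=
  forall k, mu.-integrable setT (EFin \o (fun x : R => x ^+ k)).

Section one_measure.
Variable mu : {measure set mR -> \bar R}.
Hypothesis muk : all_moments mu.

Lemma horner_integrable (p : {poly R}) :
  mu.-integrable setT (EFin \o (fun x : R => p.[x])).
Proof.
under eq_fun do rewrite horner_coef.
by apply: real_integrable_sum => i; exact: real_integrableZ.
Qed.

Lemma integral_horner (p : {poly R}) :
  \int[mu]_x p.[x] = \sum_(i < size p) p`_i * \int[mu]_x (x ^+ i).
Proof.
under eq_Rintegral do rewrite horner_coef.
rewrite Rintegral_sum; last by move=> i; exact: real_integrableZ.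
by apply: eq_bigr => i _; rewrite RintegralZl.
Qed.

Lemma bounded_integrable (f : R -> R) B : measurable_fun setT f ->
  (forall x, `|f x| <= B) -> mu.-integrable setT (EFin \o f).
Proof.
move=> mf fB; have i1 := real_integrableZ B (muk 0).
apply: (le_integrable measurableT _ _ i1); first exact/measurable_EFinP.
by move=> x _ /=; rewrite lee_fin expr0 mulr1 (le_trans (fB x))// ler_norm.
Qed.

Lemma integral_approx (f : R -> R) (p : {poly R}) (e a : R) m :
  mu.-integrable setT (EFin \o f) ->
  (forall x, `|f x - p.[x]| <= e + a * x ^+ m) ->
  `|\int[mu]_x f x - \int[mu]_x p.[x]| <=
  e * \int[mu]_x (x ^+ 0) + a * \int[mu]_x (x ^+ m).
Proof.
move=> fi fp; have pi := horner_integrable p.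
rewrite -RintegralB//.
have hi : mu.-integrable setT (EFin \o (fun x : R => e * x ^+ 0 + a * x ^+ m)).
  by apply: real_integrableD; exact: real_integrableZ.
have di := real_integrableB fi pi.
rewrite (le_trans (le_normr_Rintegral _ _))//.
have -> : e * \int[mu]_x (x ^+ 0) + a * \int[mu]_x (x ^+ m) =
    \int[mu]_x (e * x ^+ 0 + a * x ^+ m).
  by rewrite RintegralD//; try exact: real_integrableZ; rewrite !RintegralZl.
apply: le_Rintegral => //.
  exact: (integrable_norm di).
by move=> x _; rewrite /= expr0 mulr1.
Qed.

End one_measure.

(** Away from the support, a polynomial is dominated by a high power, for which
    the moment bound of the limit is small. *)
Lemma horner_growth (p : {poly R}) (x : R) m : 2 <= `|x| -> (size p <= m)%N ->
  `|p.[x]| <= (\sum_(i < size p) `|p`_i| * 2 ^+ i) * (`|x| / 2) ^+ m.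
Proof.
move=> x2 pm; rewrite horner_coef (le_trans (ler_norm_sum _ _ _))// mulr_suml.
apply: ler_sum => i _; rewrite normrM normrX -mulrA ler_wpM2l//.
have x1 : 1 <= `|x| / 2 by rewrite ler_pdivlMr// mul1r.
rewrite -[X in X ^+ i <= _](@mulfVK _ 2)// exprMn mulrC ler_wpM2l ?exprn_ge0//.
by rewrite ler_weXn2l// (leq_trans _ pm)// ltnW.
Qed.

(** Approximate f by a polynomial p on [-2, 2].  Outside, |f - p| is at most
    A (x / 2)^(2m), whose integral against the limit is at most A 3^-m, small
    for large m.  The bound (4/3)^m on the moments says that the limit is
    supported in a segment of radius 2 / sqrt 3 < 2. *)
Theorem moments_weak_cvg (mu : nat -> {measure set mR -> \bar R})
    (nu : {measure set mR -> \bar R}) :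
  (forall n, all_moments (mu n)) -> all_moments nu ->
  (forall k, \int[mu n]_x (x ^+ k) @[n --> \oo] --> \int[nu]_x (x ^+ k)) ->
  (forall m, \int[nu]_x (x ^+ (2 * m)) <= (4 / 3) ^+ m) ->
  weak_cvg mu nu.
Proof.
move=> muk nuk cvgk nu_le f cf [B0 [_ fB0]].
have [B B0' fB] : exists2 B, 0 <= B & forall x, `|f x| <= B.
  exists (`|B0| + 1); first by rewrite addr_ge0.
  by move=> x; apply: fB0 => //; rewrite (le_lt_trans (ler_norm _))// ltrDl.
have mf : measurable_fun setT f by exact: continuous_measurable_fun.
apply/cvgrPdist_lt => e' e'0; pose e := e' / 5.
have e0 : 0 < e by rewrite divr_gt0.
have [p hp] := weierstrass cf fB (ltr0n R 2) e0.
(* bounds f by B and the polynomial by its coefficients, as in [horner_growth] *)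
pose A := B + \sum_(i < size p) `|p`_i| * 2 ^+ i.
have A0 : 0 <= A by rewrite addr_ge0// sumr_ge0// => i _; rewrite mulr_ge0// exprn_ge0.
have [m [pm Am]] : exists m, (size p <= 2 * m)%N /\ A * 3^-1 ^+ m <= e.
  have : A * 3^-1 ^+ m @[m --> \oo] --> A * 0.
    apply: cvgMl_tmp; apply: cvg_expr; rewrite ger0_norm ?invr_ge0// invf_lt1//; lra.
  rewrite mulr0 => /cvgrPdist_le /(_ e e0) [N _ hN].
  exists (maxn N (size p)); split; first by rewrite (leq_trans (leq_maxr N _))// leq_pmull.
  have := hN (maxn N (size p)) (leq_maxl _ _); rewrite /= sub0r normrN.
  by apply: le_trans; rewrite ler_norm.
have fp x : `|f x - p.[x]| <= e + A * 4^-1 ^+ m * x ^+ (2 * m).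
  have ax : 0 <= A * 4^-1 ^+ m * x ^+ (2 * m).
    by rewrite mulr_ge0 ?exprn_even_ge0 ?oddM// mulr_ge0// exprn_ge0// invr_ge0.
  case: (leP `|x| 2) => x2; first by rewrite (le_trans (hp _ x2))// lerDl.
  rewrite (@le_trans _ _ (A * 4^-1 ^+ m * x ^+ (2 * m)))//; last by rewrite lerDr ltW.
  have x1 : 1 <= (`|x| / 2) ^+ (2 * m) by rewrite exprn_ege1// ler_pdivlMr// mul1r ltW.
  have -> : A * 4^-1 ^+ m * x ^+ (2 * m) = A * (`|x| / 2) ^+ (2 * m).
    rewrite -mulrA; congr (_ * _); rewrite !exprM -exprMn; congr (_ ^+ _).
    by rewrite exprMn real_normK ?num_real//; field.
  apply: (le_trans (ler_normB _ _)); rewrite /A mulrDl; apply: lerD.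
    by apply: (le_trans (fB x)); rewrite ler_peMr.
  by apply: horner_growth; [exact: ltW | exact: pm].
have mufi n : (mu n).-integrable setT (EFin \o f) by exact: (bounded_integrable (muk n) mf fB).
have nufi : nu.-integrable setT (EFin \o f) by exact: (bounded_integrable nuk mf fB).
have h1 n := integral_approx (muk n) (mufi n) fp.
have h2 := integral_approx nuk nufi fp.
pose c := A * 4^-1 ^+ m.
(* the moment bound turns 4^-1 into 3^-1 *)
have c43 : c * (4 / 3) ^+ m <= e.
  by rewrite /c -mulrA -exprMn (_ : 4^-1 * (4 / 3) = 3^-1)//; field.
have c0 : 0 <= c by rewrite mulr_ge0// exprn_ge0// invr_ge0.
have nu1 : e * \int[nu]_x (x ^+ 0) <= e.
  by have := nu_le 0; rewrite muln0 expr0 => h; rewrite ler_piMr// ltW.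
have nu2 : c * \int[nu]_x (x ^+ (2 * m)) <= e.
  by rewrite (le_trans _ c43)// ler_wpM2l.
have cp : \int[mu n]_x p.[x] @[n --> \oo] --> \int[nu]_x p.[x].
  rewrite integral_horner//; under eq_fun do rewrite integral_horner//.
  by apply: cvg_big => [x|i _]; [exact: add_continuous | exact: cvgMl_tmp].
have cb : e * \int[mu n]_x (x ^+ 0) + c * \int[mu n]_x (x ^+ (2 * m)) @[n --> \oo] -->
    e * \int[nu]_x (x ^+ 0) + c * \int[nu]_x (x ^+ (2 * m)).
  by apply: cvgD; exact: cvgMl_tmp.
have hb : \forall n \near \oo,
    e * \int[mu n]_x (x ^+ 0) + c * \int[mu n]_x (x ^+ (2 * m)) < 2 * e + e / 2.
  move/cvgrPdist_lt : cb => /(_ (e / 2)) [|N _ hN]; first by rewrite divr_gt0.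
  exists N => // n /hN /=; rewrite ltr_norml => /andP[h _]; lra.
have hpn : \forall n \near \oo, `|\int[nu]_x p.[x] - \int[mu n]_x p.[x]| < e / 2.
  by move/cvgrPdist_lt : cp; apply; rewrite divr_gt0.
near=> n.
have hbn : e * \int[mu n]_x (x ^+ 0) + c * \int[mu n]_x (x ^+ (2 * m)) < 2 * e + e / 2.
  by near: n.
have hpn' : `|\int[nu]_x p.[x] - \int[mu n]_x p.[x]| < e / 2 by near: n.
have := h1 n; rewrite -/c in h2 *; move=> h1n.
move: h2 h1n hpn'; rewrite /e in e0 nu1 nu2 hbn *.
rewrite !ler_norml !ltr_norml => /andP[? ?] /andP[? ?] /andP[? ?].
apply/andP; split; lra.
Unshelve. all: by end_near. Qed.

End moment_method.

(** * Almost sure convergence of the spectral distributions *)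

Section empirical_spectral_distribution.
Variables (R : realType) (n : nat) (A : 'M[R]_n).
Implicit Types f : R -> R.

Lemma ge0_integral_esd f : measurable_fun setT f -> (forall x, 0 <= f x) ->
  (\int[esd A]_x (f x)%:E = (n%:R^-1 * \sum_(x <- eigenvalues A) f x)%:E)%E.
Proof.
move=> mf f0; have mf' : measurable_fun setT (EFin \o f) by exact/measurable_EFinP.
rewrite ge0_integral_mscale//; last by move=> x _; rewrite lee_fin.
rewrite ge0_integral_measure_sum//; last by move=> x _; rewrite lee_fin.
rewrite EFinM; congr (_ * _)%E.
rewrite (big_nth 0) big_mkord -sumEFin; apply: eq_bigr => i _.
by rewrite integral_dirac// diracT mul1e.
Qed.

Lemma esd_integrable f : measurable_fun setT f ->
  (esd A).-integrable setT (EFin \o f).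
Proof.
move=> mf; apply/integrableP; split; first exact/measurable_EFinP.
have h : (\int[esd A]_x (`|f x|)%:E < +oo)%E; last exact: h.
by rewrite ge0_integral_esd ?ltry//; exact: measurableT_comp.
Qed.

(** Adding |f| reduces to the nonnegative case. *)
Lemma integral_esd f : measurable_fun setT f ->
  \int[esd A]_x f x = n%:R^-1 * \sum_(x <- eigenvalues A) f x.
Proof.
move=> mf; pose g (x : R) : R := `|f x|; have mg : measurable_fun setT g by exact: measurableT_comp.
have fi := esd_integrable mf; have gi := esd_integrable mg.
have h0 (h : R -> R) : measurable_fun setT h -> (forall x, 0 <= h x) ->
    \int[esd A]_x h x = n%:R^-1 * \sum_(x <- eigenvalues A) h x.
  by move=> mh h0; rewrite /Rintegral ge0_integral_esd.
have := h0 (fun x => f x + g x); rewrite RintegralD// (h0 g)//; last by move=> x; rewrite /g.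
rewrite big_split/= mulrDr => H; apply: (addIr (n%:R^-1 * \sum_(x <- eigenvalues A) g x)).
apply: H; first exact: measurable_funD.
by move=> x; have := ler_norm (- f x); rewrite normrN /g => h; lra.
Qed.

Lemma exprn_measurable k : measurable_fun setT (fun x : R => x ^+ k).
Proof. by apply: continuous_measurable_fun; exact: exprn_continuous. Qed.

Lemma esd_all_moments : all_moments (esd A).
Proof. by move=> k; apply: esd_integrable; exact: exprn_measurable. Qed.

Lemma esd_moment k : A^T = A ->
  \int[esd A]_x (x ^+ k) = n%:R^-1 * \tr (A ^+ k).
Proof.
move=> /symmetric_spectrum[D [pD tD]].
rewrite integral_esd; last exact: exprn_measurable.
rewrite tD; congr (_ * _).
rewrite (perm_big _ (roots_char_poly_perm pD)) big_map/=.
by rewrite -[RHS]big_enum.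
Qed.

End empirical_spectral_distribution.

Section semicircle_limit.
Variable R : realType.

Lemma scmom_even_le (s : R) m : 0 <= s -> 0 <= scmom s (2 * m) <= (4 * s) ^+ m.
Proof.
move=> s0; elim: m => [|m /andP[IH0 IH]]; first by rewrite muln0 scmom0 expr0 ler01 lexx.
rewrite (_ : 2 * m.+1 = (2 * m).+2)%N; last by rewrite mulnS.
have s4 : 0 <= 4 * s by rewrite mulr_ge0.
have q1 : 0 <= ((2 * m).+1%:R / (2 * m).+4%:R : R) <= 1.
  by rewrite divr_ge0//= ler_pdivrMr ?ltr0n// mul1r ler_nat; lia.
case/andP: q1 => q0 q1; rewrite scmomSS -(mulrA (4 * s)) exprS; apply/andP; split.
  by do ?apply: mulr_ge0.
rewrite -[leLHS]mulrA ler_wpM2l// (le_trans _ IH)// ler_piMl//.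
Qed.

Lemma scmom_cvg (s : R^nat) (l : R) k : s @ \oo --> l ->
  scmom (s n) k @[n --> \oo] --> scmom l k.
Proof.
move=> sl; suff [] : (scmom (s n) k @[n --> \oo] --> scmom l k) /\
  (scmom (s n) k.+1 @[n --> \oo] --> scmom l k.+1) by [].
elim: k => [|k [IH1 IH2]].
  by split; [rewrite scmom0 | rewrite scmom1]; exact: cvg_cst.
split => //; rewrite scmomSS; under eq_fun do rewrite scmomSS.
apply: cvgM => //; apply: cvgMr_tmp; apply: cvgMr_tmp; exact: cvgMl_tmp.
Qed.

End semicircle_limit.

Section almost_sure.
Context d (T : measurableType d) (R : realType) (P : probability T R).

(** By comparison with the telescoping sum of 1/i - 1/(i+1). *)
Lemma sum_inv_sqr_le2 n : \sum_(i < n) i.+1%:R^-1 ^+ 2 <= 2 :> R.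
Proof.
case: n => [|n]; first by rewrite big_ord0.
suff h : \sum_(i < n.+1) i.+1%:R^-1 ^+ 2 <= 2 - n.+1%:R^-1 :> R.
  by rewrite (le_trans h)// gerBl invr_ge0.
elim: n => [|n IH]; first by rewrite big_ord1 invr1 expr1n; lra.
rewrite big_ord_recr/=; apply: (le_trans (lerD IH (lexx _))).
have a0 : 0 < n.+1%:R^-1 :> R by rewrite invr_gt0 ltr0n.
have b0 : 0 < n.+2%:R^-1 :> R by rewrite invr_gt0 ltr0n.
have e : n.+1%:R^-1 - n.+2%:R^-1 = n.+1%:R^-1 * n.+2%:R^-1 :> R.
  by rewrite -(natr1 n.+1); field; rewrite [1 + n%:R]addrC !natr1 !pnatr_eq0.
have ab : n.+2%:R^-1 <= n.+1%:R^-1 :> R by rewrite lef_pV2 ?posrE ?ltr0n// ler_nat.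
have := ler_wpM2r (ltW b0) ab; rewrite -e -expr2; move: (n.+2%:R^-1) (n.+1%:R^-1) => b a h; lra.
Qed.

(** The sum of the X n has finite expectation, so it is finite almost surely and
    its terms tend to 0. *)
Lemma ae_cvg0 (X : nat -> T -> R) D :
  (forall n, P.-integrable setT (EFin \o X n)) -> (forall n w, 0 <= X n w) ->
  (forall n, \int[P]_w X n w <= D * n.+1%:R^-1 ^+ 2) ->
  {ae P, forall w, X n w @[n --> \oo] --> 0}.
Proof.
move=> Xi X0 XD.
have mX n : measurable_fun setT (EFin \o X n) by exact: (measurable_int P).
have X0' n w : (0 <= (EFin \o X n) w)%E by rewrite lee_fin.
pose S w := (\sum_(n <oo) (EFin \o X n) w)%E.
have S0 w : (0 <= S w)%E by apply: nneseries_ge0.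
have mS : measurable_fun setT S by apply: ge0_emeasurable_sum.
have D0 : 0 <= D.
  have := XD 0%N; rewrite invr1 expr1n mulr1; apply: le_trans.
  by apply: Rintegral_ge0.
have Sfin : (\int[P]_w S w <= (2 * D)%:E)%E.
  rewrite integral_nneseries//; apply: lime_le.
    by apply: is_cvg_nneseries => n _ _; apply: integral_ge0.
  apply: nearW => N; rewrite big_mkord.
  have -> : (\sum_(i < N) \int[P]_w (EFin \o X i) w)%E = (\sum_(i < N) \int[P]_w X i w)%:E.
    rewrite -sumEFin; apply: eq_bigr => i _.
    by rewrite fineK//; exact: (integrable_fin_num measurableT (Xi i)).
  rewrite lee_fin (@le_trans _ _ (\sum_(i < N) D * i.+1%:R^-1 ^+ 2))//.
    by apply: ler_sum.
  by rewrite -mulr_sumr mulrC ler_wpM2r// sum_inv_sqr_le2.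
have Si : P.-integrable setT S.
  apply/integrableP; split => //.
  rewrite (eq_integral S) => [|w _]; last by rewrite gee0_abs.
  by rewrite (le_lt_trans Sfin)// ltry.
have := integrable_ae measurableT Si; apply: filterS => w /(_ Logic.I) Sw.
apply: (@cvg_series_cvg_0 _ _ (X ^~ w)).
apply: nondecreasing_is_cvgn.
  apply/nondecreasing_seqP => n; rewrite /series/= big_nat_recr//= lerDl//.
exists (fine (S w)) => _ [n _ <-].
rewrite -lee_fin fineK// /series/= -sumEFin.
apply: nneseries_lim_ge => i _ _; exact: X0'.
Qed.

End almost_sure.

Section dot_limit.
Variable R : realType.

Lemma norm2_sqr n (x : 'cV[R]_n) : norm2 x ^+ 2 = \sum_(i < n) x i ord0 ^+ 2.
Proof. by rewrite sqr_sqrtr// sumr_ge0// => i _; rewrite sqr_ge0. Qed.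

Lemma dot_sphere n (x y : 'cV[R]_n) : sphere2 x -> sphere2 y ->
  dot (fun i => x i ord0) (fun i => y i ord0) = 1 - norm2 (x - y) ^+ 2 / 2.
Proof.
rewrite /sphere2/= => hx hy.
have nx := norm2_sqr x; have ny := norm2_sqr y.
rewrite hx hy expr1n in nx ny; rewrite norm2_sqr.
have -> : \sum_(i < n) (x - y) i ord0 ^+ 2 =
    \sum_(i < n) x i ord0 ^+ 2 + \sum_(i < n) y i ord0 ^+ 2 -
    2 * dot (fun i => x i ord0) (fun i => y i ord0).
  rewrite /dot mulr_sumr -big_split -sumrB; apply: eq_bigr => i _ /=.
  by rewrite !mxE; ring.
by rewrite -nx -ny; field.
Qed.

Lemma var_scale_cvg (u v : forall n : nat, 'cV[R]_n) :
  (forall n, (0 < n)%N -> sphere2 (u n)) ->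
  (forall n, (0 < n)%N -> sphere2 (v n)) ->
  norm2 (u n - v n) @[n --> \oo] --> (0 : R) ->
  var_scale (fun i => u n.+1 i ord0) (fun i => v n.+1 i ord0) @[n --> \oo] -->
    (3^-1 : R).
Proof.
move=> hu hv; rewrite -(cvg_shiftS (fun n => norm2 (u n - v n))) => huv.
have -> : 3^-1 = (1 + (1 - (0 : R) * 0 / 2) * (1 - 0 * 0 / 2)) / 6 by field.
under eq_fun do rewrite /var_scale (dot_sphere (hu _ (ltn0Sn _)) (hv _ (ltn0Sn _))) !expr2.
apply: cvgMr_tmp; apply: cvgD; first exact: cvg_cst.
have h : 1 - norm2 (u n.+1 - v n.+1) * norm2 (u n.+1 - v n.+1) / 2 @[n --> \oo] -->
    1 - (0 : R) * 0 / 2.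
  by apply: cvgB; [exact: cvg_cst | apply: cvgMr_tmp; exact: cvgM].
exact: cvgM.
Qed.

End dot_limit.

Theorem proposition2p3 (R : realType) (d : measure_display)
    (T : measurableType d) (P : probability T R)
    (u v : forall n : nat, 'cV[R]_n)
    (G : forall n : nat, 4.-tuple 'I_n -> {RV P >-> R})
    (hu : forall n : nat, (0 < n)%N -> sphere2 (u n))
    (hv : forall n : nat, (0 < n)%N -> sphere2 (v n))
    (hG : forall n : nat, (0 < n)%N -> GOTE4 (G n))
    (huv : norm2 (u n - v n) @[n --> \oo] --> (0 : R)) :
  {ae P, forall w : T,
    weak_cvg
      (fun n : nat => esd ((Num.sqrt (n%:R : R))^-1 *:
                           contract2 (fun s => G n s w) (u n) (v n)))
      (semicircle_law (3^-1 : R))}.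
Proof.
have gm n := gote_model (ltn0Sn n) (hu _ (ltn0Sn n)) (hv _ (ltn0Sn n)) (hG _ (ltn0Sn n)).
(* a model needs a positive dimension, hence the shift by one *)
pose x n : model P := Model (gm n).
have s30 : 0 < 3^-1 :> R by rewrite invr_gt0.
have dev0 k : {ae P, forall w, dev k (x n) w @[n --> \oo] --> (0 : R)}.
  (* the fourth moment is O(n^-2), which is summable *)
  have [D hD] := deviation_moments P k 2.
  have dev4 : {ae P, forall w, dev k (x n) w ^+ 4 @[n --> \oo] --> (0 : R)}.
    apply: (@ae_cvg0 _ _ _ P (fun n w => dev k (x n) w ^+ 4) D).
    - by move=> n; exact: (polyrv_int (md_P (x n)) (polyfamX 4 (@polyfam_dev _ _ _ P k) (x n))).
    - by move=> n w; rewrite exprn_even_ge0.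
    - by move=> n; exact: hD.
  apply: filterS dev4 => w w4; apply/cvgrPdist_lt => e e0.
  move/cvgrPdist_lt : w4 => /(_ (e ^+ 4)); rewrite exprn_gt0// => /(_ isT).
  apply: filterS => n; rewrite !sub0r !normrN normrX.
  by rewrite ltr_pXn2r ?nnegrE ?normr_ge0 ?(ltW e0).
have := ae_foralln dev0; apply: filterS => w devw.
apply: moments_weak_cvg.
- by move=> n; exact: esd_all_moments.
- by move=> k; exact: (semicircle_moment s30 k).1.
- move=> k; rewrite (semicircle_moment s30 k).2 -cvg_shiftS.
  have := @scmom_cvg _ _ _ k (var_scale_cvg hu hv huv).
  move=> /(cvgD (devw k)); rewrite add0r; apply: cvg_trans; apply: near_eq_cvg.
  apply: nearW => n /=; rewrite (esd_moment _ (model_sym (gm n) w)).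
  by rewrite /dev subrK.
- move=> m; rewrite (semicircle_moment s30 _).2.
  by have /andP[_] := scmom_even_le m (ltW s30).
Qed.
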